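(* Let $A$ be a sectorial operator on a Banach space $X$ with $\omega(A)=0$ and assume that $A$ has a uniformly bounded $H^\infty$-calculus. Then there exists a constant $C>0$ such that for any $\theta\in(0,\pi)$ and any $F\in H^\infty_0(\Sigma_\theta;E_A)$, $$\Vert F(A)\Vert\leq C\,R\bigl(\{F(t)\,:\,t>0\}\bigr).$$
   Context: $X$ is a complex Banach space, $B(X)$ the algebra of bounded operators on $X$. Sectors and function spaces: $\Sigma_\theta=\{re^{i\phi}: r>0,\ |\phi|<\theta\}$. $H^\infty_0(\Sigma_\theta)$ is the set of bounded analytic $f\colon\Sigma_\theta\to\mathbb{C}$ for which there exist $\epsilon,C>0$ with $|f(\lambda)|\leq C\min(|\lambda|^\epsilon,|\lambda|^{-\epsilon})$ on $\Sigma_\theta$; $\Vert f\Vert_{\infty,\theta}=\sup_{\lambda\in\Sigma_\theta}|f(\lambda)|$. Sectorial operators: a closed linear operator $A\colon D(A)\subset X\to X$ with dense domain is $\omega$-sectorial, $\omega\in(0,\pi)$, if its spectrum $\sigma(A)$ is contained in $\overline{\Sigma_\omega}$ and for every $\theta\in(\omega,\pi)$ there is $C_\theta>0$ with $\Vert\lambda(\lambda-A)^{-1}\Vert\leq C_\theta$ for all $\lambda\in\mathbb{C}\setminus\overline{\Sigma_\theta}$. $\omega(A)=\inf\{\omega: A\text{ is }\omega\text{-sectorial}\}$. Functional calculus: for $\theta\in(\omega(A),\pi)$ and $f\in H^\infty_0(\Sigma_\theta)$, $f(A)=\frac{1}{2\pi i}\int_{\Gamma_\gamma}f(\lambda)(\lambda-A)^{-1}d\lambda$,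 where $\omega(A)<\gamma<\theta$ and $\Gamma_\gamma$ is $\partial\Sigma_\gamma$ oriented counterclockwise (independent of $\gamma$). An operator $A$ with $\omega(A)=0$ has a uniformly bounded $H^\infty$-calculus if there is $C>0$ with $\Vert f(A)\Vert\leq C\Vert f\Vert_{\infty,\theta}$ for all $\theta\in(0,\pi)$ and all $f\in H^\infty_0(\Sigma_\theta)$. Operator valued calculus: $E_A\subset B(X)$ is the set of $T\in B(X)$ with $T(\lambda-A)^{-1}=(\lambda-A)^{-1}T$ for all $\lambda$ in the resolvent set of $A$. $H^\infty_0(\Sigma_\theta;E_A)$ is the set of bounded analytic functions $F\colon\Sigma_\theta\to B(X)$ with values in $E_A$ for which there are $\epsilon,C>0$ with $\Vert F(\lambda)\Vert\leq C\min(|\lambda|^\epsilon,|\lambda|^{-\epsilon})$ on $\Sigma_\theta$. For such $F$, $F(A)=\frac{1}{2\pi i}\int_{\Gamma_\gamma}F(\lambda)(\lambda-A)^{-1}d\lambda$ with $\gamma\in(\omega(A),\theta)$. $R$-bounds: let $(\epsilon_k)_{k\geq 1}$ be independent Rademacher variables on a probability space $\Omega_0$ and put $\Vert\sum_k\epsilon_k\otimes x_k\Vert_{\mathrm{Rad}(X)}=\bigl(\int_{\Omega_0}\Vert\sum_k\epsilon_k(\lambda)x_k\Vert_X^2\,d\lambda\bigr)^{1/2}$. For $\tau\subset B(X)$, $R(\tau)$ is the smallest $C\geq0$ such that $\Vert\sum_k\epsilon_k\otimes T_kx_k\Vert_{\mathrm{Rad}(X)}\leq C\Vert\sum_k\epsilon_k\otimes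 x_k\Vert_{\mathrm{Rad}(X)}$ for all finite families $T_k\in\tau$, $x_k\in X$ ($R(\tau)=\infty$ if there is none). *)

(* Defs.v *)
(* Banach spaces, complex differentiability and (improper) Riemann integrals of
   Banach-space valued functions are Coquelicot's; the probability space that
   carries the Rademacher variables is MathComp-Analysis', over the standard
   library's R. *)
From mathcomp Require Import all_boot all_order all_algebra.
From mathcomp Require Import all_classical all_reals all_analysis.
From mathcomp Require Import Rstruct Rstruct_topology.
From Stdlib Require Import Reals Lra ClassicalEpsilon.
From Stdlib Require Import FunctionalExtensionality PropExtensionality ProofIrrelevance.
From Coquelicot Require Import Coquelicot.

Set Implicit Arguments.
Unset Strict Implicit.
Unset Printing Implicit Defensive.

Local Open Scope ring_scope.

Definition mutually_independent (K : realType) (d : measure_display)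
    (Omega : measurableType d) (P : probability Omega K) (Z : nat -> {RV P >-> K}) : Prop :=
  forall (J : seq nat) (B : nat -> set K),
    uniq J -> (forall j, measurable (B j)) ->
    P (\bigcap_(j in [set` J]) (Z j @^-1` B j))%classic
    = (\prod_(j <- J) P (Z j @^-1` B j)%classic)%E.

Definition rademacher (K : realType) (d : measure_display) (Omega : measurableType d)
    (P : probability Omega K) (eps : nat -> {RV P >-> K}) : Prop :=
  mutually_independent eps /\
  forall k, P (eps k @^-1` [set 1])%classic = (2^-1)%:E
         /\ P (eps k @^-1` [set -1])%classic = (2^-1)%:E.

Local Open Scope R_scope.

(* The standard library's R as a realType. *)
Notation realR := Rstruct.RbaseSymbolsImpl_R__canonical__reals_Real.

(* [is_linear] includes boundedness. *)
Record bddop (X : NormedModule C_AbsRing) := BddOp {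
  bddop_fun :> X -> X;
  bddop_linear : is_linear bddop_fun }.

Section BoundedOperators.
Context {X : NormedModule C_AbsRing}.
Implicit Types (S T : bddop X).

Definition opnorm (T : bddop X) : R :=
  Rbar.real (Lub_Rbar (fun r => exists x : X, norm x <= 1 /\ r = norm (T x))).

Lemma bddop_ext S T : (forall x, S x = T x) -> S = T.
Proof.
destruct S as [s Hs], T as [t Ht]; simpl; intros H.
assert (E : s = t) by (apply functional_extensionality; exact H).
subst t; f_equal; apply proof_irrelevance.
Qed.

Lemma is_linear_plus_fun S T : is_linear (fun x => plus (S x) (T x)).
Proof.
destruct S as [s [s1 s2 [Ms [HMs s3]]]], T as [t [t1 t2 [Mt [HMt t3]]]]; simpl.
split.
- intros x y; rewrite s1 t1 -!plus_assoc; f_equal.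
  rewrite !plus_assoc; f_equal; apply plus_comm.
- intros k x; rewrite s2 t2; symmetry; apply: scal_distr_l.
- exists (Ms + Mt); split; [lra|]; intros x.
  eapply Rle_trans; [apply norm_triangle|].
  specialize (s3 x); specialize (t3 x); lra.
Qed.

Lemma is_linear_scal_fun (k : C) T : is_linear (fun x => scal (k : C_AbsRing) (T x)).
Proof.
destruct T as [t [t1 t2 [Mt [HMt t3]]]]; simpl; split.
- intros x y; rewrite t1; apply: scal_distr_l.
- intros l x; rewrite t2 !scal_assoc; f_equal; apply: Cmult_comm.
- exists (Cmod k * Mt + 1); split.
  + assert (H := Cmod_ge_0 k); nra.
  + intros x; eapply Rle_trans; [apply: norm_scal|].
    assert (H := norm_ge_0 x); assert (H' := Cmod_ge_0 k); specialize (t3 x).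
    change (abs (k : C_AbsRing)) with (Cmod k); nra.
Qed.

Lemma is_linear_comp_fun S T : is_linear (fun x => S (T x)).
Proof.
destruct S as [s Hs], T as [t Ht]; simpl.
apply (is_linear_comp t s Ht Hs).
Qed.

Lemma is_linear_zero_fun : is_linear (fun _ : X => zero : X).
Proof. apply is_linear_zero. Qed.

Definition bddop_zero : bddop X := BddOp is_linear_zero_fun.
Definition bddop_plus S T : bddop X := BddOp (is_linear_plus_fun S T).
Definition bddop_scal (k : C) T : bddop X := BddOp (is_linear_scal_fun k T).
Definition bddop_opp T : bddop X := bddop_scal (RtoC (-1)) T.
Definition bddop_comp S T : bddop X := BddOp (is_linear_comp_fun S T).

Lemma opnorm_is_lub T :
  is_lub_Rbar (fun r => exists x : X, norm x <= 1 /\ r = norm (T x)) (opnorm T).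
Proof.
unfold opnorm.
destruct (Lub_Rbar_correct (fun r => exists x : X, norm x <= 1 /\ r = norm (T x)))
  as [U L].
set (E := fun r => exists x : X, norm x <= 1 /\ r = norm (T x)) in *.
destruct (linear_norm _ (bddop_linear T)) as [M [HM HT]].
assert (B : Rbar_le (Lub_Rbar E) M).
{ apply L; intros r [x [Hx ->]]; simpl.
  eapply Rle_trans; [apply HT|]; assert (H := norm_ge_0 x); nra. }
assert (Z : Rbar_le 0 (Lub_Rbar E)).
{ apply U; exists zero; split.
  - rewrite norm_zero; lra.
  - rewrite (linear_zero _ (bddop_linear T)) norm_zero; reflexivity. }
destruct (Lub_Rbar E); simpl in *; try easy; split; assumption.
Qed.

Lemma opnorm_ge_0 T : 0 <= opnorm T.
Proof.
destruct (opnorm_is_lub T) as [U _].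
apply (U 0); exists zero; split.
- rewrite norm_zero; lra.
- rewrite (linear_zero _ (bddop_linear T)) norm_zero; reflexivity.
Qed.

Lemma norm_scal_C (k : C) (x : X) :
  norm (scal (k : C_AbsRing) x) = Cmod k * norm x.
Proof.
apply Rle_antisym; [apply: norm_scal|].
destruct (classic (k = RtoC 0)) as [->|Hk].
{ rewrite Cmod_0 Rmult_0_l; apply norm_ge_0. }
assert (Hp : 0 < Cmod k) by (apply Cmod_gt_0; exact Hk).
replace (norm x) with (norm (scal (Cinv k : C_AbsRing) (scal (k : C_AbsRing) x))).
2:{ rewrite scal_assoc; change (mult (Cinv k : C_AbsRing) k) with (Cmult (Cinv k) k).
    rewrite Cinv_l //; f_equal; apply: scal_one. }
eapply Rle_trans; [apply Rmult_le_compat_l; [lra|apply: norm_scal]|].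
change (abs (Cinv k : C_AbsRing)) with (Cmod (Cinv k)).
rewrite Cmod_inv //; right; field; lra.
Qed.

Lemma norm_bddop_le T x : norm (T x) <= opnorm T * norm x.
Proof.
destruct (opnorm_is_lub T) as [U _].
destruct (Req_dec (norm x) 0) as [H0|H0].
{ rewrite (norm_eq_zero _ H0) (linear_zero _ (bddop_linear T)) !norm_zero; lra. }
assert (Hp : 0 < norm x) by (assert (H := norm_ge_0 x); lra).
assert (Hc : Cmod (RtoC (/ norm x)) = / norm x).
{ rewrite Cmod_R Rabs_pos_eq //; left; apply Rinv_0_lt_compat; exact Hp. }
assert (H : norm (T (scal (RtoC (/ norm x) : C_AbsRing) x)) <= opnorm T).
{ apply (U (norm (T (scal (RtoC (/ norm x) : C_AbsRing) x)))); eexists; split; [|reflexivity].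
  rewrite norm_scal_C Hc; right; field; lra. }
rewrite (linear_scal _ (bddop_linear T)) norm_scal_C Hc in H.
apply (Rmult_le_reg_l (/ norm x)); [apply Rinv_0_lt_compat; exact Hp|].
eapply Rle_trans; [exact H|]; right; field; lra.
Qed.

Lemma opnorm_le T M : 0 <= M -> (forall x, norm (T x) <= M * norm x) -> opnorm T <= M.
Proof.
intros HM HT; destruct (opnorm_is_lub T) as [_ L].
apply (L (Finite M)); intros r [x [Hx ->]]; simpl.
eapply Rle_trans; [apply HT|]; nra.
Qed.

Definition bddop_AbelianMonoid_mixin : AbelianMonoid.mixin_of (bddop X).
Proof.
apply (@AbelianMonoid.Mixin (bddop X) bddop_plus bddop_zero).
- intros S T; apply bddop_ext; intros x; apply plus_comm.
- intros S T U; apply bddop_ext; intros x; apply plus_assoc.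
- intros S; apply bddop_ext; intros x; apply plus_zero_r.
Defined.

Definition bddop_AbelianGroup_mixin :
  AbelianGroup.mixin_of (AbelianMonoid.Pack (bddop X) bddop_AbelianMonoid_mixin (bddop X)).
Proof.
apply (@AbelianGroup.Mixin
  (AbelianMonoid.Pack (bddop X) bddop_AbelianMonoid_mixin (bddop X)) bddop_opp).
intros S; apply bddop_ext; intros x; simpl.
replace (scal (RtoC (-1) : C_AbsRing) (S x)) with (opp (S x)); [apply: plus_opp_r|].
rewrite -(scal_opp_one (K := C_AbsRing)); f_equal.
unfold RtoC; cbv; f_equal; ring.
Defined.

Canonical bddop_AbelianMonoid :=
  AbelianMonoid.Pack (bddop X) bddop_AbelianMonoid_mixin (bddop X).
Canonical bddop_AbelianGroup :=
  AbelianGroup.Pack (bddop X)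
    (AbelianGroup.Class (bddop X) bddop_AbelianMonoid_mixin bddop_AbelianGroup_mixin) (bddop X).

Definition bddop_ModuleSpace_mixin : ModuleSpace.mixin_of C_Ring bddop_AbelianGroup.
Proof.
apply (@ModuleSpace.Mixin C_Ring bddop_AbelianGroup bddop_scal).
- intros k l S; apply bddop_ext; intros x; apply: scal_assoc.
- intros S; apply bddop_ext; intros x; apply: scal_one.
- intros k S T; apply bddop_ext; intros x; apply: scal_distr_l.
- intros k l S; apply bddop_ext; intros x; apply: scal_distr_r.
Defined.

Canonical bddop_ModuleSpace :=
  ModuleSpace.Pack C_Ring (bddop X)
    (ModuleSpace.Class C_Ring (bddop X) _ bddop_ModuleSpace_mixin) (bddop X).

Lemma bddop_minusE S T x : (minus S T : bddop X) x = minus (S x) (T x).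
Proof.
change (plus (S x) (scal (RtoC (-1) : C_AbsRing) (T x)) = minus (S x) (T x)).
unfold minus; f_equal.
rewrite -(scal_opp_one (K := C_AbsRing)); f_equal.
unfold RtoC; cbv; f_equal; ring.
Qed.

Lemma opnorm_plus S T : opnorm (bddop_plus S T) <= opnorm S + opnorm T.
Proof.
apply opnorm_le.
- assert (H := opnorm_ge_0 S); assert (H' := opnorm_ge_0 T); lra.
- intros x; simpl; eapply Rle_trans; [apply norm_triangle|].
  assert (H := norm_bddop_le S x); assert (H' := norm_bddop_le T x); lra.
Qed.

Lemma opnorm_scal (k : C) T : opnorm (bddop_scal k T) <= Cmod k * opnorm T.
Proof.
apply opnorm_le.
- apply Rmult_le_pos; [apply Cmod_ge_0|apply opnorm_ge_0].
- intros x; simpl; rewrite norm_scal_C Rmult_assoc.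
  apply Rmult_le_compat_l; [apply Cmod_ge_0|apply norm_bddop_le].
Qed.

Lemma opnorm_eq_0 T : opnorm T = 0 -> T = bddop_zero.
Proof.
intros H; apply bddop_ext; intros x; simpl; apply norm_eq_zero.
apply Rle_antisym; [|apply norm_ge_0].
eapply Rle_trans; [apply norm_bddop_le|]; rewrite H; lra.
Qed.

Lemma opnorm_minus_sym S T : opnorm (minus S T) <= opnorm (minus T S).
Proof.
apply opnorm_le; [apply opnorm_ge_0|]; intros x.
eapply Rle_trans; [|apply norm_bddop_le].
rewrite !bddop_minusE -(norm_opp (minus (T x) (S x))) opp_minus; apply Rle_refl.
Qed.

Definition bddop_UniformSpace_mixin : UniformSpace.mixin_of (bddop X).
Proof.
apply (@UniformSpace.Mixin (bddop X) bddop_zero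
  (fun S (e : R) T => opnorm (minus T S) < e)).
- intros S e; replace (opnorm (minus S S)) with 0; [apply cond_pos|].
  apply Rle_antisym; [apply opnorm_ge_0|]; apply opnorm_le; [lra|]; intros x.
  rewrite bddop_minusE minus_eq_zero norm_zero; lra.
- intros S T e H; eapply Rle_lt_trans; [apply opnorm_minus_sym|exact H].
- intros S T U e1 e2 H1 H2.
  rewrite (minus_trans T).
  eapply Rle_lt_trans; [apply opnorm_plus|]; lra.
Defined.

Canonical bddop_UniformSpace := UniformSpace.Pack (bddop X) bddop_UniformSpace_mixin (bddop X).
Canonical bddop_NormedModuleAux :=
  NormedModuleAux.Pack C_AbsRing (bddop X)
    (NormedModuleAux.Class C_AbsRing (bddop X)
       (ModuleSpace.class C_Ring bddop_ModuleSpace) bddop_UniformSpace_mixin) (bddop X).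

Definition bddop_NormedModule_mixin : NormedModule.mixin_of C_AbsRing bddop_NormedModuleAux.
Proof.
apply (@NormedModule.Mixin C_AbsRing bddop_NormedModuleAux opnorm 1).
- apply opnorm_plus.
- apply opnorm_scal.
- intros S T e H; exact H.
- intros S T e H; rewrite Rmult_1_l; exact H.
- apply opnorm_eq_0.
Defined.

Canonical bddop_NormedModule :=
  NormedModule.Pack C_AbsRing (bddop X)
    (NormedModule.Class C_AbsRing (bddop X) _ bddop_NormedModule_mixin) (bddop X).

End BoundedOperators.

Section Completeness.
Variable X : CompleteNormedModule C_AbsRing.

Lemma minus_eq_0 (G : AbelianGroup) (x y : G) : minus x y = zero -> x = y.
Proof.
intros H; rewrite -(plus_zero_r x) -(plus_opp_l y) plus_assoc.
change (plus (minus x y) y = y); rewrite H; apply plus_zero_l.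
Qed.

Lemma bddop_cauchy_cvg (F : (bddop X -> Prop) -> Prop) :
  ProperFilter F -> cauchy F ->
  exists L : bddop X, forall e : posreal, F (ball L e).
Proof.
intros PF CF.
pose (G := fun (x : X) (Q : X -> Prop) => F (fun T => Q (T x))).
assert (PG : forall x : X, ProperFilter (G x)).
{ intros x; apply (@Hierarchy.filtermap_proper_filter _ _ (fun T : bddop X => T x) F PF). }
assert (nearP : forall (T : bddop X) (e : posreal) (x : X) (S : bddop X), ball T e S ->
  norm (minus (S x) (T x)) <= e * norm x).
{ intros T e x S HS; rewrite -bddop_minusE.
  eapply Rle_trans; [apply norm_bddop_le|].
  apply Rmult_le_compat_r; [apply norm_ge_0|left; exact HS]. }
assert (CG : forall x : X, cauchy (G x)).
{ intros x e.
  assert (Hn := norm_ge_0 x).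
  assert (Hd : 0 < e / (norm x + 1)).
  { apply Rdiv_lt_0_compat; [apply cond_pos|lra]. }
  destruct (CF (mkposreal _ Hd)) as [T HT].
  exists (T x); unfold G; apply: filter_imp HT => S HS.
  apply: norm_compat1.
  eapply Rle_lt_trans; [apply (nearP _ _ _ _ HS)|]; simpl.
  assert (He := cond_pos e).
  apply (Rmult_lt_reg_r (norm x + 1)); [lra|].
  replace (e / (norm x + 1) * norm x * (norm x + 1)) with (e * norm x) by (field; lra).
  nra. }
pose (L := fun x : X => lim (G x)).
assert (HL : forall (x : X) (e : R), 0 < e -> F (fun S => norm (minus (S x) (L x)) < e)).
{ intros x e He.
  assert (Hf := @norm_factor_gt_0 _ X).
  assert (Hd : 0 < e / @norm_factor _ X) by (apply Rdiv_lt_0_compat; lra).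
  assert (H := complete_cauchy (G x) (PG x) (CG x) (mkposreal _ Hd)).
  unfold G in H; apply: filter_imp H => S HS.
  eapply Rlt_le_trans; [apply (norm_compat2 _ _ _ HS)|]; simpl.
  right; field; lra. }
assert (small : forall u : X, (forall e, 0 < e -> norm u <= e) -> u = zero).
{ intros u Hu; apply: norm_eq_zero; apply Rle_antisym; [|apply norm_ge_0].
  apply le_epsilon; intros e He; rewrite Rplus_0_l; apply Hu; exact He. }
assert (key : forall (T : bddop X) (e : posreal) (x : X), F (ball T e) ->
  norm (minus (L x) (T x)) <= e * norm x).
{ intros T e x HT; apply le_epsilon; intros h Hh.
  destruct (filter_ex _ (filter_and _ _ HT (HL x h Hh))) as [S [H1 H2]].
  rewrite (minus_trans (S x)); eapply Rle_trans; [apply: norm_triangle|].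
  rewrite -(norm_opp (minus (L x) (S x))) opp_minus.
  assert (H3 := nearP _ _ x _ H1); lra. }
assert (LL : is_linear L).
{ split.
  - intros x y; apply: minus_eq_0.
    apply small; intros e He.
    assert (He3 : 0 < e / 3) by lra.
    destruct (filter_ex _ (filter_and _ _ (HL (plus x y) _ He3)
       (filter_and _ _ (HL x _ He3) (HL y _ He3)))) as [S [H1 [H2 H3]]].
    rewrite (minus_trans (S (plus x y))).
    eapply Rle_trans; [apply: norm_triangle|].
    rewrite -(norm_opp (minus (L (plus x y)) _)) opp_minus.
    rewrite {2}(linear_plus _ (bddop_linear S)).
    assert (E : minus (plus (S x) (S y)) (plus (L x) (L y))
      = plus (minus (S x) (L x)) (minus (S y) (L y))).
    { unfold minus; rewrite opp_plus -!plus_assoc; f_equal.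
      rewrite !plus_assoc; f_equal; apply plus_comm. }
    apply Rle_trans with (e / 3 + (e / 3 + e / 3)); [|lra].
    apply Rplus_le_compat; [left; exact H1|].
    eapply Rle_trans; [apply Req_le; apply: (f_equal norm E)|].
    eapply Rle_trans; [apply: norm_triangle|].
    apply Rplus_le_compat; left; [exact H2|exact H3].
  - intros k x; apply: minus_eq_0; apply small; intros e He.
    assert (Hk := Cmod_ge_0 k).
    assert (He2 : 0 < e / 2) by lra.
    assert (He3 : 0 < e / 2 / (Cmod k + 1)) by (apply Rdiv_lt_0_compat; lra).
    destruct (filter_ex _ (filter_and _ _ (HL (scal k x) _ He2) (HL x _ He3)))
      as [S [H1 H2]].
    rewrite (minus_trans (S (scal k x))).
    eapply Rle_trans; [apply: norm_triangle|].
    rewrite -(norm_opp (minus (L (scal k x)) _)) opp_minus.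
    rewrite {2}(linear_scal _ (bddop_linear S)).
    assert (H3 : Cmod k * norm (minus (S x) (L x)) <= e / 2).
    { apply Rle_trans with (Cmod k * (e / 2 / (Cmod k + 1))).
      - apply Rmult_le_compat_l; lra.
      - apply (Rmult_le_reg_r (Cmod k + 1)); [lra|].
        replace (Cmod k * (e / 2 / (Cmod k + 1)) * (Cmod k + 1))
          with (Cmod k * (e / 2)) by (field; lra).
        nra. }
    apply Rle_trans with (e / 2 + e / 2); [|lra].
    apply Rplus_le_compat; [left; exact H1|].
    eapply Rle_trans; [|exact H3].
    rewrite -norm_scal_C; apply Req_le; symmetry; apply: (f_equal norm (scal_minus_distr_l k (S x) (L x))).
  - destruct (CF (mkposreal 1 Rlt_0_1)) as [T HT].
    exists (1 + opnorm T); assert (H0 := opnorm_ge_0 T); split; [lra|]; intros x.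
    replace (L x) with (plus (minus (L x) (T x)) (T x)).
    2:{ unfold minus; rewrite -plus_assoc plus_opp_l; apply: plus_zero_r. }
    eapply Rle_trans; [apply: norm_triangle|].
    assert (H1 := key _ _ x HT); assert (H2 := norm_bddop_le T x); simpl in H1; lra. }
exists (BddOp LL); intros e.
destruct (CF (pos_div_2 e)) as [T HT].
apply: filter_imp (HT) => S HS.
replace (pos e) with (pos_div_2 e + pos_div_2 e) by (simpl; lra).
assert (HLT : opnorm (minus (BddOp LL) T) <= pos_div_2 e).
{ apply opnorm_le; [left; apply cond_pos|]; intros x; rewrite bddop_minusE; simpl.
  apply (key T (pos_div_2 e) x HT). }
change (opnorm (minus S (BddOp LL)) < pos_div_2 e + pos_div_2 e).
rewrite (minus_trans T).
eapply Rle_lt_trans; [apply: opnorm_plus|].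
assert (H1 := opnorm_minus_sym T (BddOp LL)).
change (opnorm (minus S T) < pos_div_2 e) in HS.
lra.
Qed.

Definition bddop_lim (F : (bddop X -> Prop) -> Prop) : bddop X :=
  epsilon (inhabits bddop_zero) (fun L => forall e : posreal, F (ball L e)).

Definition bddop_CompleteSpace_mixin : CompleteSpace.mixin_of (@bddop_UniformSpace X).
Proof.
apply (@CompleteSpace.Mixin (@bddop_UniformSpace X) bddop_lim).
- intros F PF CF; unfold bddop_lim.
  apply (epsilon_spec (inhabits bddop_zero) (fun L => forall e : posreal, F (ball L e))).
  apply bddop_cauchy_cvg; assumption.
- intros F1 F2 H1 H2.
  assert (E : F1 = F2).
  { apply functional_extensionality; intros Q; apply propositional_extensionality.
    split; [apply H2|apply H1]. }
  rewrite E; intros e; apply ball_center.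
Defined.

Canonical bddop_CompleteSpace :=
  CompleteSpace.Pack (bddop X)
    (CompleteSpace.Class _ bddop_UniformSpace_mixin bddop_CompleteSpace_mixin) (bddop X).
Canonical bddop_CompleteNormedModule :=
  CompleteNormedModule.Pack C_AbsRing (bddop X)
    (CompleteNormedModule.Class C_AbsRing (bddop X)
       (NormedModule.class C_AbsRing bddop_NormedModule) bddop_CompleteSpace_mixin) (bddop X).

End Completeness.

(* Coquelicot integrates functions R -> V with V a normed module over R. *)
Section RestrictionOfScalars.
Variable V : CompleteNormedModule C_AbsRing.

Definition toR_ModuleSpace_mixin :
  ModuleSpace.mixin_of R_Ring (CompleteNormedModule.AbelianGroup _ V).
Proof.
apply (@ModuleSpace.Mixin R_Ring (CompleteNormedModule.AbelianGroup _ V)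
  (fun (r : R) (v : V) => scal (RtoC r : C_AbsRing) v)).
- intros r s v; rewrite scal_assoc; f_equal; symmetry; apply: RtoC_mult.
- intros v; apply: scal_one.
- intros r u v; apply: scal_distr_l.
- intros r s v; rewrite -scal_distr_r; f_equal; apply: RtoC_plus.
Defined.

Definition toR_ModuleSpace :=
  ModuleSpace.Pack R_Ring V
    (ModuleSpace.Class R_Ring V _ toR_ModuleSpace_mixin) V.

Definition toR_NormedModuleAux :=
  NormedModuleAux.Pack R_AbsRing V
    (NormedModuleAux.Class R_AbsRing V (ModuleSpace.class R_Ring toR_ModuleSpace)
       (UniformSpace.class (CompleteNormedModule.UniformSpace _ V))) V.

Definition toR_NormedModule_mixin : NormedModule.mixin_of R_AbsRing toR_NormedModuleAux.
Proof.
apply (@NormedModule.Mixin R_AbsRing toR_NormedModuleAux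
  (fun v : V => norm v) (@norm_factor _ V)).
- intros u v; apply: norm_triangle.
- intros r v; eapply Rle_trans; [apply: norm_scal|].
  change (abs (RtoC r : C_AbsRing)) with (Cmod (RtoC r)); rewrite Cmod_R.
  apply Rle_refl.
- intros u v e; apply: norm_compat1.
- intros u v e; apply: norm_compat2.
- intros v; apply: norm_eq_zero.
Defined.

Definition toR_NormedModule :=
  NormedModule.Pack R_AbsRing V
    (NormedModule.Class R_AbsRing V _ toR_NormedModule_mixin) V.

Definition toR : CompleteNormedModule R_AbsRing :=
  CompleteNormedModule.Pack R_AbsRing V
    (CompleteNormedModule.Class R_AbsRing V (NormedModule.class R_AbsRing toR_NormedModule)
       (CompleteSpace.mixin _
          (CompleteSpace.class (CompleteNormedModule.CompleteSpace _ V)))) V.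

End RestrictionOfScalars.

Definition cis (phi : R) : C := (cos phi, sin phi).

(* Improper at both ends; [scal] is the complex scaling, from dz = e^(i phi) dr. *)
Definition ray_int (V : CompleteNormedModule C_AbsRing) (phi : R) (g : C -> V) : V :=
  @RInt_gen (toR V)
    (fun r : R => scal (cis phi : C_AbsRing) (g (Cmult (RtoC r) (cis phi))))
    (at_right 0) (Rbar_locally p_infty).

(* Counterclockwise, the boundary of the sector comes in from infinity along the
   ray of angle gamma and goes out along the ray of angle -gamma. *)
Definition contour_int (V : CompleteNormedModule C_AbsRing) (gamma : R) (g : C -> V) : V :=
  minus (ray_int (- gamma) g) (ray_int gamma g).

Definition sector (theta : R) (z : C) : Prop :=
  exists r phi : R, 0 < r /\ Rabs phi < theta /\ z = Cmult (RtoC r) (cis phi).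

Definition in_closure (U : UniformSpace) (P : U -> Prop) (x : U) : Prop :=
  forall e : posreal, exists y, ball x e y /\ P y.

(* Functions on a sector are represented by total functions on C, whose values
   outside the sector are never used. *)
Definition H0inf (V : NormedModule C_AbsRing) (theta : R) (f : C -> V) : Prop :=
  (forall z, sector theta z -> ex_derive (K := C_AbsRing) (V := V) f z) /\
  (exists M, forall z, sector theta z -> norm (f z) <= M) /\
  (exists eps c : R, 0 < eps /\ 0 < c /\
     forall z, sector theta z ->
       norm (f z) <= c * Rmin (Rpower (Cmod z) eps) (Rpower (Cmod z) (- eps))).

Definition supnorm (theta : R) (f : C -> C) : R :=
  Rbar.real (Lub_Rbar (fun r => exists z, sector theta z /\ r = Cmod (f z))).

(* The values of [op_fun] outside [op_dom] are never used. *)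
Record operator (X : NormedModule C_AbsRing) := Operator {
  op_dom : X -> Prop;
  op_fun :> X -> X;
  op_dom_zero : op_dom zero;
  op_dom_plus : forall x y, op_dom x -> op_dom y -> op_dom (plus x y);
  op_dom_scal : forall (k : C_AbsRing) x, op_dom x -> op_dom (scal k x);
  op_plus : forall x y, op_dom x -> op_dom y ->
    op_fun (plus x y) = plus (op_fun x) (op_fun y);
  op_scal : forall (k : C_AbsRing) x, op_dom x ->
    op_fun (scal k x) = scal k (op_fun x) }.

Section Sectorial.
Variable X : CompleteNormedModule C_AbsRing.
Implicit Types A : operator X.

Definition closed_op A : Prop :=
  closed (fun p : X * X => op_dom A (fst p) /\ snd p = A (fst p)).

Definition densely_defined A : Prop := forall x : X, in_closure (op_dom A) x.

Definition is_resolvent A (lambda : C) (S : bddop X) : Prop :=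
  (forall x, op_dom A (S x) /\
     minus (scal (lambda : C_AbsRing) (S x)) (A (S x)) = x) /\
  (forall x, op_dom A x ->
     S (minus (scal (lambda : C_AbsRing) x) (A x)) = x).

Definition resolvent_set A (lambda : C) : Prop := exists S, is_resolvent A lambda S.

Definition spectrum A (lambda : C) : Prop := ~ resolvent_set A lambda.

(* Unspecified outside the resolvent set. *)
Definition resolvent A (lambda : C) : bddop X := iota (is_resolvent A lambda).

Definition sectorial_angle A (omega : R) : Prop :=
  0 < omega < PI /\
  (forall lambda : C, spectrum A lambda -> in_closure (sector omega) lambda) /\
  (forall theta, omega < theta < PI ->
     exists c, 0 < c /\ forall lambda : C, ~ in_closure (sector theta) lambda ->
       norm (scal (lambda : C_AbsRing) (resolvent A lambda)) <= c).

Definition sectorial A : Prop :=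
  closed_op A /\ densely_defined A /\ exists omega, sectorial_angle A omega.

Definition omega_of A : Rbar := Glb_Rbar (sectorial_angle A).

Definition inv_2ipi : C := Cinv (Cmult (RtoC (2 * PI)) Ci).

(* Both calculi carry the angle gamma of the contour, of which their values do
   not depend as long as omega_of A < gamma < theta. *)
Definition fcalc A (gamma : R) (f : C -> C) : bddop X :=
  scal (inv_2ipi : C_AbsRing)
    (contour_int gamma (fun l => scal (f l : C_AbsRing) (resolvent A l))).

Definition opcalc A (gamma : R) (F : C -> bddop X) : bddop X :=
  scal (inv_2ipi : C_AbsRing)
    (contour_int gamma (fun l => bddop_comp (F l) (resolvent A l))).

Definition unif_bounded_calculus A : Prop :=
  exists c, 0 < c /\
    forall theta, 0 < theta < PI ->
    forall f : C -> C, H0inf (V := C_NormedModule) theta f ->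
    forall gamma : R, Rbar_lt (omega_of A) gamma -> gamma < theta ->
      norm (fcalc A gamma f) <= c * supnorm theta f.

Definition commutant A (T : bddop X) : Prop :=
  forall lambda, resolvent_set A lambda ->
    bddop_comp T (resolvent A lambda) = bddop_comp (resolvent A lambda) T.

Definition H0inf_commutant A (theta : R) (F : C -> bddop X) : Prop :=
  H0inf theta F /\ forall z, sector theta z -> commutant A (F z).

(* [sum_n u n] is u 0 + ... + u n, so families are indexed by 0, ..., n. *)
Definition rad_norm (d : measure_display) (Omega : measurableType d)
    (P : probability Omega realR) (eps : nat -> {RV P >-> realR}) (n : nat) (x : nat -> X) : R :=
  sqrt (fine (\int[P]_w
    ((norm (sum_n (fun k => scal (RtoC (eps k w) : C_AbsRing) (x k)) n)) ^ 2)%R%:E)%E).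

(* The infimum is p_infty when there is no such c, and attained otherwise. *)
Definition rbound (d : measure_display) (Omega : measurableType d)
    (P : probability Omega realR) (eps : nat -> {RV P >-> realR}) (tau : bddop X -> Prop) : Rbar :=
  Glb_Rbar (fun c => 0 <= c /\
    forall (n : nat) (T : nat -> bddop X) (x : nat -> X),
      (forall k, (k <= n)%nat -> tau (T k)) ->
      rad_norm eps n (fun k => T k (x k)) <= c * rad_norm eps n x).

End Sectorial.

(* Main.v *)
(* Put S(w) = e^w (e^w - A)^(-1) and P(s) = (S(s - i g) - S(s + i g)) / (2 i pi),
   which is p_s(A) for the Poisson kernel p_s of width g. Since S' = S - S^2,
     2 pi tan(g) P(s)^2 = ((S + i tan(g) S')(s - i g) - (S - i tan(g) S')(s + i g)) / (2 i pi)
   holds exactly, so Cauchy's theorem moves 2 pi tan(g) int F(e^s) P(s)^2 ds to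
   the contour of angle gamma, where it tends to F(A) as g -> 0. Cutting the line
   into translates of [0, g] turns the integral into that, over 0 < t < g, of
   sum_j F(e^(s_j)) P(s_j)^2 with s_j = t + j g. The functions sum_j +-p_(s_j) are
   O(1/g) on the sector of angle g/2, so the uniformly bounded calculus gives
   sum_j +-P(s_j) = O(1/g). As sum_j T_j P_j^2 x is the mean of
   (sum_j eps_j P_j)(sum_k eps_k T_k P_k x), the sum is O(R / g^2), and the powers
   of g cancel. *)
Require Import Defs.
From mathcomp Require Import all_boot all_order all_algebra.
From mathcomp Require Import all_classical all_reals all_analysis.
From mathcomp Require Import Rstruct Rstruct_topology.
From Stdlib Require Import Reals Lra Lia ClassicalEpsilon.
From Coquelicot Require Import Coquelicot.
Local Open Scope R_scope.

(** The R-bound sees F only on the positive half-line, whereas F(A) integrates F over the rays of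
    angle gamma and -gamma. Bringing F down to the axis leaves the resolvent factor at angle g from
    it, where its bound depends on g. The operators P(s) are combinations whose signed sums are
    still controlled, at the price 1/g of the sup norm of the kernels; as these are only bounded on
    a sector that shrinks with g, the constant of the calculus must be the same for all angles. P is
    squared because its two copies do different work: one is bounded as an operator for each choice
    of signs, the other makes the vectors to which the R-bound applies. The price 1/g^2 is paid by
    the length g of the folding interval and by the factor 2 pi tan(g) <= 4 pi g, which leaves 4 pi
    g (16 pi c / g)^2 g r = 1024 pi^3 c^2 r. The coordinate z = e^w turns dilations into
    translations and dz / z into ds: all kernels are translates of one, rays become horizontal
    lines, and Goursat's theorem on rectangles is the only form of Cauchy's theorem involved. *)

Notation cscal k := (scal (k : C_AbsRing)).

(** * Linear identities in modules, and integrals of vector-valued functions *)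

(* Linear identities in a complex module are decided by comparing the
   coefficients of the atoms. *)
Inductive mexp : Type :=
  | MVar of nat | MZero | MPlus of mexp & mexp | MOpp of mexp | MScal of C & mexp.

Section ModuleExpressions.
Context {V : ModuleSpace C_Ring}.

Fixpoint mdenote (env : list V) (e : mexp) : V :=
  match e with
  | MVar n => List.nth n env zero
  | MZero => zero
  | MPlus a b => plus (mdenote env a) (mdenote env b)
  | MOpp a => opp (mdenote env a)
  | MScal k a => scal (k : C_Ring) (mdenote env a)
  end.

Fixpoint mcoef (e : mexp) (i : nat) : C :=
  match e with
  | MVar n => if Nat.eqb n i then RtoC 1 else RtoC 0
  | MZero => RtoC 0
  | MPlus a b => Cplus (mcoef a i) (mcoef b i)
  | MOpp a => Copp (mcoef a i)
  | MScal k a => Cmult k (mcoef a i)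
  end.

Fixpoint mcomb (env : list V) (c : nat -> C) : V :=
  match env with
  | nil => zero
  | cons v env' => plus (scal (c O : C_Ring) v) (mcomb env' (fun i => c (S i)))
  end.

Lemma mcomb_ext (env : list V) (c c' : nat -> C) :
  (forall i, (i < length env)%coq_nat -> c i = c' i) -> mcomb env c = mcomb env c'.
Proof.
revert c c'; induction env as [|v env IH]; intros c c' H; [reflexivity|]; simpl.
rewrite (H O); [|simpl; lia]; f_equal; apply IH; intros i Hi; apply H; simpl; lia.
Qed.

Lemma mcomb_zero (env : list V) : mcomb env (fun _ => RtoC 0) = zero.
Proof.
induction env as [|v env IH]; [reflexivity|]; simpl; rewrite IH.
change (plus (scal (zero : C_Ring) v) zero = zero).
rewrite scal_zero_l; apply plus_zero_l.
Qed.

Lemma mcomb_plus (env : list V) (c c' : nat -> C) :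
  mcomb env (fun i => Cplus (c i) (c' i)) = plus (mcomb env c) (mcomb env c').
Proof.
revert c c'; induction env as [|v env IH]; intros c c'; simpl.
{ symmetry; apply plus_zero_l. }
rewrite (IH (fun i => c (S i)) (fun i => c' (S i))).
change (Cplus (c O) (c' O)) with (plus (c O : C_Ring) (c' O)).
rewrite scal_distr_r -!plus_assoc; f_equal.
rewrite !plus_assoc; f_equal; apply plus_comm.
Qed.

Lemma mcomb_scal (env : list V) (k : C) (c : nat -> C) :
  mcomb env (fun i => Cmult k (c i)) = scal (k : C_Ring) (mcomb env c).
Proof.
revert c; induction env as [|v env IH]; intros c; simpl.
{ symmetry; apply scal_zero_r. }
rewrite (IH (fun i => c (S i))) scal_distr_l; f_equal.
symmetry; apply: scal_assoc.
Qed.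

Lemma mcomb_var (env : list V) (n : nat) :
  mcomb env (fun i => if Nat.eqb n i then RtoC 1 else RtoC 0) = List.nth n env zero.
Proof.
revert n; induction env as [|v env IH]; intros [|n]; simpl; try reflexivity.
- rewrite mcomb_zero plus_zero_r; apply: scal_one.
- rewrite (IH n); change (plus (scal (zero : C_Ring) v) (List.nth n env zero) = List.nth n env zero).
  rewrite scal_zero_l; apply plus_zero_l.
Qed.

Lemma mdenote_comb (env : list V) (e : mexp) : mdenote env e = mcomb env (mcoef e).
Proof.
induction e as [n| |a IHa b IHb|a IHa|k a IHa]; simpl.
- symmetry; apply mcomb_var.
- symmetry; apply mcomb_zero.
- rewrite IHa IHb; symmetry; apply mcomb_plus.
- rewrite IHa -(scal_opp_one (K := C_Ring)) -mcomb_scal; apply mcomb_ext.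
  intros i _; cbv [opp one]; simpl; ring.
- rewrite IHa; symmetry; apply mcomb_scal.
Qed.

Fixpoint mcoefs_eq (n : nat) (a b : mexp) : Prop :=
  match n with
  | O => True
  | S n' => mcoef a n' = mcoef b n' /\ mcoefs_eq n' a b
  end.

Lemma mdenote_eq (env : list V) (a b : mexp) :
  mcoefs_eq (length env) a b -> mdenote env a = mdenote env b.
Proof.
intros H; rewrite !mdenote_comb; apply mcomb_ext.
revert H; generalize (length env) as n; induction n as [|n IH]; [lia|].
intros [H1 H2] i Hi; destruct (Nat.eq_dec i n) as [->|Hn]; [exact H1|].
apply IH; [exact H2|lia].
Qed.

End ModuleExpressions.

Ltac madd x l :=
  let rec go l' :=
    match l' with
    | nil => let r := constr:(cons x l) in r
    | cons ?y ?t => let _ := match goal with _ => constr_eq x y end in l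
    | cons ?y ?t => go t
    end in go l.

Ltac mfind x l :=
  match l with
  | cons ?y ?t => let _ := match goal with _ => constr_eq x y end in constr:(O)
  | cons ?y ?t => let n := mfind x t in constr:(S n)
  end.

Ltac matoms V t l :=
  lazymatch t with
  | plus ?a ?b => let l1 := matoms V a l in matoms V b l1
  | minus ?a ?b => let l1 := matoms V a l in matoms V b l1
  | opp ?a => matoms V a l
  | scal _ ?a => matoms V a l
  | zero => l
  | _ => madd (t : V) l
  end.

Ltac mreify V t l :=
  lazymatch t with
  | plus ?a ?b => let x := mreify V a l in let y := mreify V b l in constr:(MPlus x y)
  | minus ?a ?b => let x := mreify V a l in let y := mreify V b l in constr:(MPlus x (MOpp y))
  | opp ?a => let x := mreify V a l in constr:(MOpp x)
  | scal ?k ?a => let x := mreify V a l in constr:(MScal k x)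
  | zero => constr:(MZero)
  | _ => let n := mfind (t : V) l in constr:(MVar n)
  end.

Ltac Cnorm :=
  repeat match goal with
  | |- context [@mult ?K ?a ?b] => change (@mult K a b) with (Cmult a b)
  | |- context [@plus ?K ?a ?b] => change (@plus K a b) with (Cplus a b)
  | |- context [@minus ?K ?a ?b] => change (@minus K a b) with (Cminus a b)
  | |- context [@opp ?K ?a] => change (@opp K a) with (Copp a)
  | |- context [@one ?K] => change (@one K) with (RtoC 1)
  | |- context [@zero ?K] => change (@zero K) with (RtoC 0)
  end.

(* Leaves one equation between complex coefficients for each atom. *)
Tactic Notation "mreduce" constr(V) :=
  lazymatch goal with
  | |- ?a = ?b =>
    let l0 := constr:(@nil V) in
    let l1 := matoms V a l0 in
    let l2 := matoms V b l1 in
    let x := mreify V a l2 in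
    let y := mreify V b l2 in
    change (mdenote (V := V) l2 x = mdenote (V := V) l2 y);
    apply mdenote_eq; cbn [mcoefs_eq mcoef length Nat.eqb]; repeat split
  end.
Tactic Notation "mring" constr(V) := mreduce V; Cnorm; ring.

Tactic Notation "norm_split" constr(V) :=
  eapply Rle_trans; [apply (norm_triangle (V := V))|].

Tactic Notation "Rmin_bounds" ident(H1) ident(H2) constr(a) constr(b) :=
  assert (H1 := Rmin_l a b); assert (H2 := Rmin_r a b).
Tactic Notation "Rmax_bounds" ident(H1) ident(H2) constr(a) constr(b) :=
  assert (H1 := Rmax_l a b); assert (H2 := Rmax_r a b).

Section LinearIntegral.
Context {U W : NormedModule R_AbsRing}.

Lemma Riemann_sum_linear (L : U -> W) (f : R -> U) (p : SF_seq.SF_seq) :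
  is_linear L ->
  Riemann_sum (fun x => L (f x)) p = L (Riemann_sum f p).
Proof.
intros HL; induction p using SF_seq.SF_cons_ind.
- symmetry; apply (linear_zero _ HL).
- rewrite !Riemann_sum_cons IHp (linear_plus _ HL) (linear_scal _ HL); reflexivity.
Qed.

Lemma is_RInt_linear (L : U -> W) (f : R -> U) (a b : R) (l : U) :
  is_linear L -> is_RInt f a b l -> is_RInt (fun x => L (f x)) a b (L l).
Proof.
intros HL H; unfold is_RInt in *.
apply (filterlim_ext (fun p => L (scal (Rcomplements.sign (b - a)) (Riemann_sum f p)))).
- intros p; rewrite (linear_scal _ HL) Riemann_sum_linear; [reflexivity|exact HL].
- eapply filterlim_comp; [exact H|]; apply linear_cont; exact HL.
Qed.

End LinearIntegral.

Section Integral.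
Context {V : CompleteNormedModule C_AbsRing}.
Implicit Types (f g : R -> V) (a b c : R).

Definition RI f a b : V := @RInt (toR V) f a b.

Definition cont_on f a b : Prop :=
  forall x, Rmin a b <= x <= Rmax a b -> continuous f x.

Lemma continuous_norm f (x : R) :
  (forall e, 0 < e -> exists d, 0 < d /\
     forall y, Rabs (y - x) < d -> norm (minus (f y) (f x)) < e) ->
  continuous f x.
Proof.
intros H; unfold continuous; apply filterlim_locally; intros e.
destruct (H e (cond_pos e)) as [d [Hd H']].
exists (mkposreal d Hd); intros y Hy; apply: norm_compat1; apply H'; exact Hy.
Qed.

Lemma norm_continuous f (x : R) : continuous f x ->
  forall e, 0 < e -> exists d, 0 < d /\
     forall y, Rabs (y - x) < d -> norm (minus (f y) (f x)) < e.
Proof.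
intros H e He.
assert (Hf := @norm_factor_gt_0 _ V).
assert (He' : 0 < e / @norm_factor _ V) by (apply Rdiv_lt_0_compat; lra).
destruct (proj1 (filterlim_locally _ _) H (mkposreal _ He')) as [d Hd].
exists d; split; [apply cond_pos|]; intros y Hy.
eapply Rlt_le_trans; [apply (norm_compat2 _ _ _ (Hd y Hy))|]; simpl; right; field; lra.
Qed.

Lemma cont_ex f a b : cont_on f a b -> @ex_RInt (toR V) f a b.
Proof. intros H; apply (ex_RInt_continuous (V := toR V)); exact H. Qed.

Lemma RI_correct f a b : cont_on f a b -> @is_RInt (toR V) f a b (RI f a b).
Proof. intros H; apply (@RInt_correct (toR V)), cont_ex, H. Qed.

Lemma RI_unique f a b (l : V) : @is_RInt (toR V) f a b l -> RI f a b = l.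
Proof. apply (@is_RInt_unique (toR V)). Qed.

Lemma RI_Chasles f a b c : cont_on f a b -> cont_on f b c ->
  plus (RI f a b) (RI f b c) = RI f a c.
Proof. intros H1 H2; apply (@RInt_Chasles (toR V)); apply cont_ex; assumption. Qed.


Lemma RI_point f a : RI f a a = zero.
Proof. apply (@RInt_point (toR V)). Qed.

Lemma RI_ext f g a b : (forall x, Rmin a b <= x <= Rmax a b -> f x = g x) ->
  RI f a b = RI g a b.
Proof. intros H; apply (@RInt_ext (toR V)); intros x Hx; apply H; lra. Qed.

Lemma RI_plus f g a b : cont_on f a b -> cont_on g a b ->
  RI (fun x => plus (f x) (g x)) a b = plus (RI f a b) (RI g a b).
Proof. intros H1 H2; apply (@RInt_plus (toR V)); apply cont_ex; assumption. Qed.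

Lemma is_linear_scalC (k : C) :
  @is_linear R_AbsRing (toR V) (toR V) (fun v => cscal k v).
Proof.
split.
- intros x y; exact (scal_distr_l (k : C_AbsRing) (x : V) y).
- intros r x; change (cscal k (cscal (RtoC r) (x : V))
     = cscal (RtoC r) (cscal k (x : V))).
  mring V.
- exists (Cmod k + 1); assert (H := Cmod_ge_0 k); split; [lra|]; intros x.
  eapply Rle_trans; [apply: norm_scal|]; change (abs (k : C_AbsRing)) with (Cmod k).
  apply Rmult_le_compat_r; [apply: norm_ge_0|]; lra.
Qed.

Lemma RI_scal (k : C) f a b : cont_on f a b ->
  RI (fun x => cscal k (f x)) a b = cscal k (RI f a b).
Proof.
intros H; apply RI_unique.
apply (is_RInt_linear _ _ _ _ _ (is_linear_scalC k)), RI_correct, H.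
Qed.

Lemma RI_const (v : V) a b : RI (fun _ => v) a b = cscal (RtoC (b - a)) v.
Proof. apply (@RInt_const (toR V)). Qed.

(** Serves to integrate the first order Taylor polynomial along the sides of a rectangle in
    Goursat's argument. *)
Lemma RI_linear_id (v : V) a b :
  RI (fun x => cscal (RtoC x) v) a b
  = cscal (RtoC ((b ^ 2 - a ^ 2) / 2)) v.
Proof.
apply RI_unique.
apply (@is_RInt_linear R_NormedModule (toR V) (fun x => cscal (RtoC x) v) (fun x => x)).
- split.
  + intros x y; change (plus x y) with (x + y); rewrite RtoC_plus.
    exact (scal_distr_r (RtoC x : C_AbsRing) (RtoC y : C_AbsRing) v).
  + intros r x; change (scal r x) with (r * x); rewrite RtoC_mult.
    symmetry; exact (scal_assoc (RtoC r : C_AbsRing) (RtoC x : C_AbsRing) v).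
  + exists (norm v + 1); assert (H := norm_ge_0 v); split; [lra|]; intros x.
    eapply Rle_trans; [apply (norm_scal (RtoC x : C_AbsRing) v)|].
    change (abs (RtoC x : C_AbsRing)) with (Cmod (RtoC x)).
    rewrite Cmod_R Rmult_comm; change (norm x) with (Rabs x).
    assert (H' := Rabs_pos x); nra.
- replace ((b ^ 2 - a ^ 2) / 2) with (minus (b ^ 2 / 2) (a ^ 2 / 2)).
  2:{ unfold minus, plus, opp; simpl; lra. }
  apply (is_RInt_derive (fun x => x ^ 2 / 2) (fun x => x)).
  + intros x _; auto_derive; [exact I|field].
  + intros x _; apply continuous_id.
Qed.

Lemma RI_norm_fun f (g : R -> R) a b : a <= b -> cont_on f a b ->
  (forall x, a <= x <= b -> norm (f x) <= g x) ->
  ex_RInt g a b -> norm (RI f a b) <= RInt g a b.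
Proof.
intros Hab Hf Hg Ig.
apply (@norm_RInt_le (toR V) f g a b (RI f a b)).
- exact Hab.
- exact Hg.
- apply RI_correct, Hf.
- apply (@RInt_correct R_CompleteNormedModule), Ig.
Qed.

Lemma RI_norm_const f (M : R) a b : a <= b -> cont_on f a b ->
  (forall x, a <= x <= b -> norm (f x) <= M) -> norm (RI f a b) <= M * (b - a).
Proof.
intros Hab Hf HM.
eapply Rle_trans; [apply (RI_norm_fun f (fun _ => M)); try assumption; apply ex_RInt_const|].
rewrite RInt_const; right; unfold scal; simpl; unfold mult; simpl; ring.
Qed.

End Integral.

(** * The Cauchy theorem on rectangles *)

Lemma Cmod_Ci : Cmod Ci = 1.
Proof. symmetry; unfold Cmod, Ci; simpl; rewrite -{1}sqrt_1; f_equal; ring. Qed.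

Section ComplexDifferentiability.
Context {V : CompleteNormedModule C_AbsRing}.
Implicit Types (g : C -> V) (w : C) (D : V).

(** The remainder is compared with [e * Cmod u] without a quotient, so that [u = 0] is no special
    case. [cdiff_is_derive] and [is_derive_cdiff] translate to and from [is_derive]. *)
Definition cdiff g w D : Prop :=
  forall e, 0 < e -> exists d, 0 < d /\ forall u : C, Cmod u < d ->
    norm (minus (minus (g (Cplus w u)) (g w)) (cscal u D)) <= e * Cmod u.

Definition ccont g w : Prop :=
  forall e, 0 < e -> exists d, 0 < d /\ forall u : C, Cmod u < d ->
    norm (minus (g (Cplus w u)) (g w)) < e.

Lemma cdiff_lip g w D : cdiff g w D ->
  exists d, 0 < d /\ forall u : C, Cmod u < d ->
    norm (minus (g (Cplus w u)) (g w)) <= (norm D + 1) * Cmod u.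
Proof.
intros H; destruct (H 1 Rlt_0_1) as [d [Hd Hu]]; exists d; split; [exact Hd|].
intros u Hud; specialize (Hu u Hud).
replace (minus (g (Cplus w u)) (g w)) with
  (plus (minus (minus (g (Cplus w u)) (g w)) (cscal u D)) (cscal u D))
  by mring V.
eapply Rle_trans; [apply: norm_triangle|].
rewrite (norm_scal_C (X := V)); lra.
Qed.

Lemma cdiff_ccont g w D : cdiff g w D -> ccont g w.
Proof.
intros H e He; destruct (cdiff_lip _ _ _ H) as [d [Hd Hu]].
assert (H0 := norm_ge_0 D).
assert (Hq : 0 < e / (norm D + 1)) by (apply Rdiv_lt_0_compat; lra).
exists (Rmin d (e / (norm D + 1))); split; [apply Rmin_pos; assumption|]; intros u Hud.
Rmin_bounds H1 H2 d (e / (norm D + 1)).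
eapply Rle_lt_trans; [apply Hu; lra|].
apply Rlt_le_trans with ((norm D + 1) * (e / (norm D + 1))); [|right; field; lra].
apply Rmult_lt_compat_l; lra.
Qed.

Lemma Cmod_le_sum (x y : R) : Cmod (x, y) <= Rabs x + Rabs y.
Proof.
replace (x, y) with (Cplus (RtoC x) (Cmult Ci (RtoC y))).
2:{ unfold Cplus, Cmult, RtoC, Ci; simpl; f_equal; ring. }
eapply Rle_trans; [apply Cmod_triangle|].
rewrite Cmod_mult !Cmod_R.
rewrite Cmod_Ci; lra.
Qed.

Lemma ccont_horizontal g (x y : R) : ccont g (x, y) -> continuous (fun s => g (s, y)) x.
Proof.
intros H; apply continuous_norm; intros e He.
destruct (H e He) as [d [Hd Hu]]; exists d; split; [exact Hd|]; intros s Hs; cbv beta.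
assert (E : ((s, y) : C) = Cplus (x, y) (RtoC (s - x))).
{ unfold Cplus, RtoC; simpl; f_equal; ring. }
rewrite E; apply Hu; rewrite Cmod_R; exact Hs.
Qed.

Lemma ccont_vertical g (x y : R) : ccont g (x, y) -> continuous (fun s => g (x, s)) y.
Proof.
intros H; apply continuous_norm; intros e He.
destruct (H e He) as [d [Hd Hu]]; exists d; split; [exact Hd|]; intros s Hs; cbv beta.
assert (E : ((x, s) : C) = Cplus (x, y) (0, s - y)).
{ unfold Cplus; simpl; f_equal; ring. }
rewrite E; apply Hu; eapply Rle_lt_trans; [apply Cmod_le_sum|].
rewrite Rabs_R0; lra.
Qed.

Definition ccont_on g (a b c d : R) : Prop :=
  forall x y, a <= x <= b -> c <= y <= d -> ccont g (x, y).

(** The counterclockwise integral of g(z) dz around [a, b] x [c, d]; the factor [Ci] is dz = i dy on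
    the vertical sides. *)
Definition boundary_int g (a b c d : R) : V :=
  plus (minus (RI (fun x => g (x, c)) a b) (RI (fun x => g (x, d)) a b))
       (cscal Ci (minus (RI (fun y => g (b, y)) c d) (RI (fun y => g (a, y)) c d))).

Lemma ccont_on_horizontal g a b c d y x1 x2 : ccont_on g a b c d -> c <= y <= d ->
  a <= x1 <= b -> a <= x2 <= b -> cont_on (fun x => g (x, y)) x1 x2.
Proof.
intros H Hy H1 H2 x Hx; apply ccont_horizontal, H; [|exact Hy].
revert Hx; unfold Rmin, Rmax; destruct (Rle_dec x1 x2); lra.
Qed.

Lemma ccont_on_vertical g a b c d x y1 y2 : ccont_on g a b c d -> a <= x <= b ->
  c <= y1 <= d -> c <= y2 <= d -> cont_on (fun y => g (x, y)) y1 y2.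
Proof.
intros H Hx H1 H2 y Hy; apply ccont_vertical, H; [exact Hx|].
revert Hy; unfold Rmin, Rmax; destruct (Rle_dec y1 y2); lra.
Qed.

Lemma boundary_int_split_x g a m b c d : ccont_on g a b c d -> a <= m <= b -> c <= d ->
  boundary_int g a b c d = plus (boundary_int g a m c d) (boundary_int g m b c d).
Proof.
intros H Hm Hcd; unfold boundary_int.
rewrite -(RI_Chasles (fun x => g (x, c)) a m b) -?(RI_Chasles (fun x => g (x, d)) a m b).
{ mring V. }
all: apply (ccont_on_horizontal _ _ _ _ _ _ _ _ H); lra.
Qed.

Lemma boundary_int_split_y g a b c n d : ccont_on g a b c d -> c <= n <= d -> a <= b ->
  boundary_int g a b c d = plus (boundary_int g a b c n) (boundary_int g a b n d).
Proof.
intros H Hm Hcd; unfold boundary_int.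
rewrite -(RI_Chasles (fun y => g (a, y)) c n d) -?(RI_Chasles (fun y => g (b, y)) c n d).
{ mring V. }
all: apply (ccont_on_vertical _ _ _ _ _ _ _ _ H); lra.
Qed.

Lemma boundary_int_affine (v D : V) a b c d :
  boundary_int (fun z => plus v (cscal z D)) a b c d = zero.
Proof.
assert (Hc : forall (k : R) (u : V), continuous (fun x => cscal (RtoC x) u) k).
{ intros k u; apply continuous_norm; intros e He; assert (H0 := norm_ge_0 u).
  exists (e / (norm u + 1)); split; [apply Rdiv_lt_0_compat; lra|]; intros y Hy.
  replace (minus _ _) with (cscal (RtoC (y - k)) u) by (rewrite RtoC_minus; mring V).
  rewrite (norm_scal_C (X := V)) Cmod_R.
  apply (Rmult_lt_compat_r (norm u + 1)) in Hy; [|lra].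
  replace (e / (norm u + 1) * (norm u + 1)) with e in Hy by (field; lra).
  assert (H1 := Rabs_pos (y - k)); nra. }
assert (HC : forall (u u' : V) s t, cont_on (fun x => plus u (cscal (RtoC x) u')) s t).
{ intros u u' s t x _; apply (@continuous_plus _ R_AbsRing (toR V)); [apply continuous_const|apply Hc]. }
assert (E : forall (u u' : V) s t, RI (fun x => plus u (cscal (RtoC x) u')) s t
  = plus (cscal (RtoC (t - s)) u) (cscal (RtoC ((t ^ 2 - s ^ 2) / 2)) u')).
{ intros u u' s t; rewrite RI_plus.
  - rewrite RI_const RI_linear_id; reflexivity.
  - intros x _; apply continuous_const.
  - intros x _; apply Hc. }
unfold boundary_int.
rewrite (RI_ext _ (fun x => plus (plus v (cscal (Cmult Ci (RtoC c)) D)) (cscal (RtoC x) D)) a b).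
2:{ intros x _; replace (x, c) with (Cplus (RtoC x) (Cmult Ci (RtoC c))); [mring V|].
    unfold Cplus, Cmult, RtoC, Ci; simpl; f_equal; ring. }
rewrite (RI_ext (fun x => plus v (cscal ((x, d)) D)) (fun x => plus (plus v (cscal (Cmult Ci (RtoC d)) D)) (cscal (RtoC x) D)) a b).
2:{ intros x _; replace (x, d) with (Cplus (RtoC x) (Cmult Ci (RtoC d))); [mring V|].
    unfold Cplus, Cmult, RtoC, Ci; simpl; f_equal; ring. }
rewrite (RI_ext (fun y => plus v (cscal ((b, y)) D)) (fun y => plus (plus v (cscal (RtoC b) D)) (cscal (RtoC y) (cscal Ci D))) c d).
2:{ intros y _; replace (b, y) with (Cplus (RtoC b) (Cmult Ci (RtoC y))); [mring V|].
    unfold Cplus, Cmult, RtoC, Ci; simpl; f_equal; ring. }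
rewrite (RI_ext (fun y => plus v (cscal ((a, y)) D)) (fun y => plus (plus v (cscal (RtoC a) D)) (cscal (RtoC y) (cscal Ci D))) c d).
2:{ intros y _; replace (a, y) with (Cplus (RtoC a) (Cmult Ci (RtoC y))); [mring V|].
    unfold Cplus, Cmult, RtoC, Ci; simpl; f_equal; ring. }
rewrite !E.
mreduce V; Cnorm.
- unfold Cplus, Cmult, Copp, RtoC, Ci; simpl; f_equal; field.
- unfold Cplus, Cmult, Copp, RtoC, Ci; simpl; f_equal; field.
Qed.

Lemma boundary_int_plus g g' a b c d : ccont_on g a b c d -> ccont_on g' a b c d ->
  a <= b -> c <= d ->
  boundary_int (fun z => plus (g z) (g' z)) a b c d
  = plus (boundary_int g a b c d) (boundary_int g' a b c d).
Proof.
intros H H' Hab Hcd; unfold boundary_int.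
rewrite (RI_plus (fun x => g (x, c)) (fun x => g' (x, c)))
        ?(RI_plus (fun x => g (x, d)) (fun x => g' (x, d)))
        ?(RI_plus (fun y => g (a, y)) (fun y => g' (a, y)))
        ?(RI_plus (fun y => g (b, y)) (fun y => g' (b, y))).
{ mring V. }
all: first [apply (ccont_on_horizontal _ _ _ _ _ _ _ _ H); lra
           |apply (ccont_on_horizontal _ _ _ _ _ _ _ _ H'); lra
           |apply (ccont_on_vertical _ _ _ _ _ _ _ _ H); lra
           |apply (ccont_on_vertical _ _ _ _ _ _ _ _ H'); lra].
Qed.

Lemma boundary_int_norm g a b c d M : ccont_on g a b c d -> a <= b -> c <= d ->
  (forall x y, a <= x <= b -> c <= y <= d -> norm (g (x, y)) <= M) ->
  norm (boundary_int g a b c d) <= 2 * M * ((b - a) + (d - c)).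
Proof.
intros H Hab Hcd HM; unfold boundary_int, minus.
assert (K1 : forall y, c <= y <= d -> norm (RI (fun x => g (x, y)) a b) <= M * (b - a)).
{ intros y Hy; apply RI_norm_const; [exact Hab| |intros x Hx; apply HM; lra].
  apply (ccont_on_horizontal _ _ _ _ _ _ _ _ H); lra. }
assert (K2 : forall x, a <= x <= b -> norm (RI (fun y => g (x, y)) c d) <= M * (d - c)).
{ intros x Hx; apply RI_norm_const; [exact Hcd| |intros y Hy; apply HM; lra].
  apply (ccont_on_vertical _ _ _ _ _ _ _ _ H); lra. }
eapply Rle_trans; [apply: norm_triangle|].
rewrite (norm_scal_C (X := V)).
rewrite Cmod_Ci. apply Rle_trans with ((M * (b - a) + M * (b - a)) + 1 * (M * (d - c) + M * (d - c))); [|lra].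
apply Rplus_le_compat; [|apply Rmult_le_compat_l; [lra|]];
  (eapply Rle_trans; [apply: norm_triangle|]); rewrite (norm_opp (V := V));
  apply Rplus_le_compat; first [apply K1; lra | apply K2; lra].
Qed.

End ComplexDifferentiability.

Section Goursat.
Context {V : CompleteNormedModule C_AbsRing}.
Variables (g : C -> V) (a c W L : R).
Hypotheses (HW : 0 < W) (HL : 0 < L).
Hypothesis Hg : forall x y, a <= x <= a + W -> c <= y <= c + L -> exists D, cdiff g (x, y) D.

Let side (n : nat) := / 2 ^ n.

Let side_pos n : 0 < side n.
Proof. apply Rinv_0_lt_compat, pow_lt; lra. Qed.

Let sideS n : side (S n) = side n / 2.
Proof. unfold side; simpl; field; apply pow_nonzero; lra. Qed.

Let inside (n : nat) (p : R * R) : Prop :=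
  a <= fst p /\ fst p + W * side n <= a + W /\ c <= snd p /\ snd p + L * side n <= c + L.

(** The threshold scales like the area: if all four quarters stay below theirs, so does the whole
    rectangle. Hence one quarter of a bad rectangle is bad. *)
Let bad (e : R) (n : nat) (p : R * R) : Prop :=
  inside n p /\
  e * side n * side n < norm (boundary_int g (fst p) (fst p + W * side n) (snd p) (snd p + L * side n)).

Let refines (n : nat) (p q : R * R) : Prop :=
  fst p <= fst q /\ fst q + W * side (S n) <= fst p + W * side n /\
  snd p <= snd q /\ snd q + L * side (S n) <= snd p + L * side n.

Let ccont_inside n p : inside n p ->
  ccont_on g (fst p) (fst p + W * side n) (snd p) (snd p + L * side n).
Proof.
intros [H1 [H2 [H3 H4]]] x y Hx Hy.
destruct (Hg x y) as [D HD]; [lra|lra|]; apply (cdiff_ccont _ _ _ HD).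
Qed.

Let bad_refine e n p : bad e n p -> exists q, bad e (S n) q /\ refines n p q.
Proof.
destruct p as [x y]; intros [Hin Hbad].
assert (Hs := side_pos n); assert (HSn := sideS n).
assert (Hw : 0 < W * side n) by (apply Rmult_lt_0_compat; assumption).
assert (Hl : 0 < L * side n) by (apply Rmult_lt_0_compat; assumption).
set (s := side n) in *; set (s' := side (S n)) in *.
assert (HC := ccont_inside _ _ Hin).
unfold inside in Hin; simpl in Hin, Hbad, HC; fold s in Hin, Hbad, HC.
assert (Ew : x + W * s / 2 + W * s' = x + W * s) by (rewrite HSn; lra).
assert (El : y + L * s / 2 + L * s' = y + L * s) by (rewrite HSn; lra).
assert (Ew' : x + W * s' = x + W * s / 2) by (rewrite HSn; lra).
assert (El' : y + L * s' = y + L * s / 2) by (rewrite HSn; lra).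
apply NNPP; intros Hno.
assert (Hsmall : forall x' y', (x' = x \/ x' = x + W * s / 2) -> (y' = y \/ y' = y + L * s / 2) ->
  norm (boundary_int g x' (x' + W * s') y' (y' + L * s')) <= e * s' * s').
{ intros x' y' Hx' Hy'; apply Rnot_lt_le; intros Hlt; apply Hno; exists (x', y').
  unfold bad, inside, refines; cbn [fst snd]; fold s s'.
  repeat split; try (exact Hlt); destruct Hx', Hy'; subst x' y'; lra. }
assert (B1 := Hsmall x y (or_introl erefl) (or_introl erefl)).
assert (B2 := Hsmall x (y + L * s / 2) (or_introl erefl) (or_intror erefl)).
assert (B3 := Hsmall (x + W * s / 2) y (or_intror erefl) (or_introl erefl)).
assert (B4 := Hsmall (x + W * s / 2) (y + L * s / 2) (or_intror erefl) (or_intror erefl)).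
rewrite Ew' El' in B1; rewrite Ew' El in B2; rewrite Ew El' in B3; rewrite Ew El in B4.
rewrite (boundary_int_split_x g x (x + W * s / 2) (x + W * s)) in Hbad; [|exact HC|lra|lra].
rewrite (boundary_int_split_y g x (x + W * s / 2) y (y + L * s / 2)) in Hbad; [|intros ? ? ? ?; apply HC; lra|lra|lra].
rewrite (boundary_int_split_y g (x + W * s / 2) (x + W * s) y (y + L * s / 2)) in Hbad; [|intros ? ? ? ?; apply HC; lra|lra|lra].
assert (T : forall u v : V, norm (plus u v) <= norm u + norm v) by (intros; apply: norm_triangle).
match type of Hbad with _ < norm (plus ?u ?v) => assert (T1 := T u v) end.
match type of T1 with _ <= norm (plus ?u ?v) + norm (plus ?u' ?v') =>
  assert (T2 := T u v); assert (T3 := T u' v') end.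
rewrite HSn in B1 B2 B3 B4; nra.
Qed.

Lemma goursat_square : boundary_int g a (a + W) c (c + L) = zero.
Proof.
apply: norm_eq_zero; apply Rle_antisym; [|apply norm_ge_0].
apply Rnot_lt_le; intros Hpos.
set (N := norm (boundary_int g a (a + W) c (c + L))) in *.
(* Half of the norm makes the strict inequality of [bad] true for the initial rectangle. *)
pose (e := N / 2).
assert (Bad0 : bad e 0 (a, c)).
{ assert (S0 : side 0 = 1) by (unfold side; simpl; field).
  unfold bad, inside; simpl; rewrite S0 !Rmult_1_r; unfold e; fold N; repeat split; lra. }
(* Badness sits inside the chosen property, so the sequence can be defined by recursion on points
   alone. *)
assert (Hnext : forall (n : nat) (p : R * R), {q | bad e n p -> bad e (S n) q /\ refines n p q}).
{ intros n p; apply constructive_indefinite_description.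
  destruct (classic (bad e n p)) as [H|H].
  - destruct (bad_refine _ _ _ H) as [q Hq]; exists q; intros _; exact Hq.
  - exists p; intros H'; contradiction. }
pose (z := fix z (n : nat) : R * R := match n with O => (a, c) | S n' => proj1_sig (Hnext n' (z n')) end).
assert (Hz : forall n, bad e n (z n)).
{ induction n as [|n IH]; [exact Bad0|]; simpl; apply (proj2_sig (Hnext n (z n)) IH). }
assert (Href : forall n, refines n (z n) (z (S n))).
{ intros n; simpl; apply (proj2_sig (Hnext n (z n)) (Hz n)). }
assert (Hmon : forall n k, fst (z n) <= fst (z (n + k)%coq_nat) /\
  fst (z (n + k)%coq_nat) + W * side (n + k)%coq_nat <= fst (z n) + W * side n /\
  snd (z n) <= snd (z (n + k)%coq_nat) /\
  snd (z (n + k)%coq_nat) + L * side (n + k)%coq_nat <= snd (z n) + L * side n).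
{ intros n; induction k as [|k IH].
  - rewrite Nat.add_0_r; lra.
  - rewrite Nat.add_succ_r; assert (R1 := Href (n + k)%coq_nat); unfold refines in R1; lra. }
assert (Hcross : forall m n, fst (z m) <= fst (z n) + W * side n /\ snd (z m) <= snd (z n) + L * side n).
{ intros m n.
  assert (P1 : 0 < W * side m) by (apply Rmult_lt_0_compat; [exact HW|apply side_pos]).
  assert (P2 : 0 < L * side m) by (apply Rmult_lt_0_compat; [exact HL|apply side_pos]).
  assert (P3 : 0 < W * side n) by (apply Rmult_lt_0_compat; [exact HW|apply side_pos]).
  assert (P4 : 0 < L * side n) by (apply Rmult_lt_0_compat; [exact HL|apply side_pos]).
  destruct (Nat.le_ge_cases m n) as [Hmn|Hmn].
  - assert (Hk : exists k, n = (m + k)%coq_nat) by (exists (n - m)%coq_nat; lia).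
    destruct Hk as [k ->]; assert (M := Hmon m k); lra.
  - assert (Hk : exists k, m = (n + k)%coq_nat) by (exists (m - n)%coq_nat; lia).
    destruct Hk as [k ->]; assert (M := Hmon n k); lra. }
destruct (completeness (fun r => exists n, r = fst (z n))) as [x [Ux Lx]].
{ exists (fst (z O) + W * side O); intros r [n ->]; apply Hcross. }
{ exists (fst (z O)), O; reflexivity. }
destruct (completeness (fun r => exists n, r = snd (z n))) as [y [Uy Ly]].
{ exists (snd (z O) + L * side O); intros r [n ->]; apply Hcross. }
{ exists (snd (z O)), O; reflexivity. }
assert (Hx : forall n, fst (z n) <= x <= fst (z n) + W * side n).
{ intros n; split; [apply Ux; exists n; reflexivity|].
  apply Lx; intros r [m ->]; apply Hcross. }
assert (Hy : forall n, snd (z n) <= y <= snd (z n) + L * side n).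
{ intros n; split; [apply Uy; exists n; reflexivity|].
  apply Ly; intros r [m ->]; apply Hcross. }
assert (S0 : side 0 = 1) by (unfold side; simpl; field).
destruct (Hg x y) as [D HD].
{ assert (H := Hx O); simpl in H; rewrite S0 Rmult_1_r in H; exact H. }
{ assert (H := Hy O); simpl in H; rewrite S0 Rmult_1_r in H; exact H. }
(* At stage n the remainder is at most this constant times (W + L) s, and [boundary_int_norm]
   contributes another factor 2 (W + L) s: the product is exactly the threshold e s^2. *)
assert (He : 0 < e / (2 * (W + L) ^ 2)).
{ apply Rdiv_lt_0_compat; [unfold e; lra|]; assert (0 < (W + L) ^ 2) by (apply pow_lt; lra); lra. }
destruct (HD _ He) as [d [Hd Hu]].
assert (Hn : exists n, (W + L) * side n < d).
{ destruct (pow_lt_1_zero (/ 2)) with (y := d / (W + L)) as [n Hn].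
  - rewrite Rabs_pos_eq; lra.
  - apply Rdiv_lt_0_compat; lra.
  - exists n; specialize (Hn n (le_n n)).
    rewrite pow_inv in Hn; fold (side n) in Hn.
    rewrite Rabs_pos_eq in Hn; [|left; apply side_pos].
    apply (Rmult_lt_compat_l (W + L)) in Hn; [|lra].
    replace ((W + L) * (d / (W + L))) with d in Hn by (field; lra); exact Hn. }
destruct Hn as [n Hn].
destruct (Hz n) as [Hin Hbad].
specialize (Hx n); specialize (Hy n).
assert (Hs := side_pos n).
set (s := side n) in *.
destruct (z n) as [x0 y0]; simpl in *; fold s in Hx, Hy, Hbad.
assert (HC := ccont_inside _ _ Hin); simpl in HC; fold s in HC.
assert (HW' : 0 < W * s) by (apply Rmult_lt_0_compat; assumption).
assert (HL' : 0 < L * s) by (apply Rmult_lt_0_compat; assumption).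
(* The negative of the first order Taylor polynomial of [g] at (x, y). Its boundary integral
   vanishes, so adding it replaces [g] by the remainder. *)
pose (aff := fun w : C => plus (minus (cscal ((x, y)) D) (g (x, y))) (cscal w (opp D))).
assert (Haff : ccont_on aff x0 (x0 + W * s) y0 (y0 + L * s)).
{ intros x1 y1 _ _; apply (cdiff_ccont _ _ (opp D)); intros e1 He1; exists 1; split; [lra|].
  intros u _; unfold aff.
  match goal with |- norm ?t <= _ => replace t with (zero : V) by mring V end.
  rewrite norm_zero; apply Rmult_le_pos; [lra|apply Cmod_ge_0]. }
assert (E := boundary_int_plus g aff _ _ _ _ HC Haff).
rewrite (boundary_int_affine (minus (cscal ((x, y)) D) (g (x, y))) (opp D)) in E.
rewrite plus_zero_r in E.
rewrite -E in Hbad; [|lra|lra].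
apply (Rlt_not_le _ _ Hbad).
eapply Rle_trans.
{ apply boundary_int_norm with (M := e / (2 * (W + L) ^ 2) * ((W + L) * s)).
  - intros x1 y1 Hx1 Hy1 e1 He1.
    destruct (HC x1 y1 Hx1 Hy1 (e1 / 2)) as [d1 [Hd1 K1]]; [lra|].
    destruct (Haff x1 y1 Hx1 Hy1 (e1 / 2)) as [d2 [Hd2 K2]]; [lra|].
    exists (Rmin d1 d2); split; [apply Rmin_pos; assumption|]; intros u Hu1.
    Rmin_bounds M1 M2 d1 d2.
    specialize (K1 u ltac:(lra)); specialize (K2 u ltac:(lra)).
    match goal with |- norm ?t < _ => replace t with (plus (minus (g (Cplus (x1, y1) u)) (g (x1, y1)))
      (minus (aff (Cplus (x1, y1) u)) (aff (x1, y1)))) by mring V end.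
    eapply Rle_lt_trans; [apply (norm_triangle (V := V))|].
    replace e1 with (e1 / 2 + e1 / 2) by lra; apply Rplus_lt_compat; assumption.
  - lra.
  - lra.
  - intros x1 y1 Hx1 Hy1.
    pose (u := (x1 - x, y1 - y) : C).
    assert (Hmod : Cmod u <= (W + L) * s).
    { eapply Rle_trans; [apply Cmod_le_sum|].
      assert (Rabs (x1 - x) <= W * s) by (apply Rabs_le; lra).
      assert (Rabs (y1 - y) <= L * s) by (apply Rabs_le; lra).
      lra. }
    specialize (Hu u ltac:(lra)).
    replace (Cplus (x, y) u) with ((x1, y1) : C) in Hu
      by (unfold u, Cplus; simpl; f_equal; ring).
    replace (plus (g (x1, y1)) (aff (x1, y1))) with (minus (minus (g (x1, y1)) (g (x, y))) (cscal u D)).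
    2:{ unfold aff; replace u with (Cminus (x1, y1) (x, y)) by (unfold u, Cminus, Cplus, Copp; simpl; f_equal; ring).
        mring V. }
    eapply Rle_trans; [exact Hu|]; apply Rmult_le_compat_l; [left; exact He|exact Hmod]. }
right; field; lra.
Qed.

End Goursat.

Lemma goursat {V : CompleteNormedModule C_AbsRing} (g : C -> V) (a b c d : R) :
  a <= b -> c <= d ->
  (forall x y, a <= x <= b -> c <= y <= d -> exists D, cdiff g (x, y) D) ->
  boundary_int g a b c d = zero.
Proof.
intros Hab Hcd Hg.
destruct (Req_dec a b) as [<-|Hab'].
{ unfold boundary_int; rewrite !RI_point; mring V. }
destruct (Req_dec c d) as [<-|Hcd'].
{ unfold boundary_int; rewrite !RI_point; mring V. }
replace b with (a + (b - a)) by ring; replace d with (c + (d - c)) by ring.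
apply goursat_square; [lra|lra|].
intros x y Hx Hy; apply Hg; lra.
Qed.

(** * The exponential coordinate *)

Definition cexp (w : C) : C := (exp (fst w) * cos (snd w), exp (fst w) * sin (snd w)).

Lemma RtoC_m1 : RtoC (-1) = Copp (RtoC 1).
Proof. unfold Copp, RtoC; simpl; f_equal; ring. Qed.

Lemma cos_Rabs (t : R) : cos t = cos (Rabs t).
Proof. unfold Rabs; destruct (Rcase_abs t); [rewrite cos_neg|]; reflexivity. Qed.

Lemma cexp_plus (w v : C) : cexp (Cplus w v) = Cmult (cexp w) (cexp v).
Proof.
destruct w as [x y], v as [x' y']; unfold cexp, Cplus, Cmult; simpl.
rewrite exp_plus cos_plus sin_plus; f_equal; ring.
Qed.

Lemma cexp_polar (s phi : R) : cexp (s, phi) = Cmult (RtoC (exp s)) (cis phi).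
Proof. unfold cexp, cis, Cmult, RtoC; simpl; f_equal; ring. Qed.

Lemma Cmod_cis (phi : R) : Cmod (cis phi) = 1.
Proof.
assert (H := sin2_cos2 phi); unfold Rsqr in H.
unfold Cmod, cis; cbn [fst snd]; replace (_ + _) with 1 by (simpl; lra); apply sqrt_1.
Qed.

Lemma Cmod_cexp (w : C) : Cmod (cexp w) = exp (fst w).
Proof.
destruct w as [s phi]; rewrite cexp_polar Cmod_mult Cmod_cis Cmod_R Rabs_pos_eq; simpl; [ring|].
left; apply exp_pos.
Qed.

Lemma cexp_neq_0 (w : C) : cexp w <> RtoC 0.
Proof. apply Cmod_gt_0; rewrite Cmod_cexp; apply exp_pos. Qed.

Lemma cexp_0 : cexp (RtoC 0) = RtoC 1.
Proof. unfold cexp, RtoC; simpl; rewrite exp_0 cos_0 sin_0; f_equal; ring. Qed.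

Lemma cexp_real (s : R) : cexp (RtoC s) = RtoC (exp s).
Proof. unfold cexp, RtoC; simpl; rewrite cos_0 sin_0; f_equal; ring. Qed.

(** The upper bound comes from e^x <= 1 / (1 - x), which is e^(-x) >= 1 - x multiplied by e^x. *)
Lemma exp_quadratic (x : R) : Rabs x <= / 2 -> 0 <= exp x - 1 - x <= 2 * x ^ 2.
Proof.
intros Hx; apply Rabs_le_between in Hx.
assert (H1 := exp_ineq1_le x); assert (H2 := exp_ineq1_le (- x)).
split; [lra|].
assert (H3 : exp x * exp (- x) = 1) by (rewrite -exp_plus Rplus_opp_r exp_0; reflexivity).
assert (H4 := exp_pos x); nra.
Qed.

Lemma Rabs_sin_le (x : R) : Rabs (sin x) <= Rabs x.
Proof.
destruct (MVT_gen sin 0 x cos) as [t [_ Ht]].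
- intros y _; auto_derive; [exact I|ring].
- intros y _; apply continuity_sin.
- rewrite sin_0 !Rminus_0_r in Ht; rewrite Ht Rabs_mult.
  assert (H := COS_bound t); assert (Rabs (cos t) <= 1) by (apply Rabs_le; lra).
  assert (H' := Rabs_pos x); nra.
Qed.

Lemma cos_quadratic (x : R) : 1 - x ^ 2 / 2 <= cos x <= 1.
Proof.
split; [|apply COS_bound].
replace x with (2 * (x / 2)) at 2 by field; rewrite cos_2a_sin.
assert (H := Rabs_sin_le (x / 2)); apply Rsqr_le_abs_1 in H; unfold Rsqr in H; lra.
Qed.

Lemma sin_quadratic (x : R) : Rabs x <= 1 -> Rabs (sin x - x) <= x ^ 2 / 2.
Proof.
intros Hx.
destruct (MVT_gen (fun x => sin x - x) 0 x (fun x => cos x - 1)) as [t [Hi Ht]].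
- intros y _; auto_derive; [exact I|ring].
- intros y _; apply continuity_pt_minus; [apply continuity_sin|apply derivable_continuous_pt, derivable_pt_id].
- rewrite sin_0 !Rminus_0_r in Ht; rewrite Ht Rabs_mult.
  assert (H := cos_quadratic t).
  assert (Htx : t ^ 2 <= x ^ 2).
  { rewrite -(pow2_abs t) -(pow2_abs x); apply pow_incr; split; [apply Rabs_pos|].
    revert Hi; unfold Rmin, Rmax; destruct (Rle_dec 0 x); intros Hi.
    - rewrite !Rabs_pos_eq; lra.
    - rewrite !Rabs_left1; lra. }
  assert (Rabs (cos t - 1) <= x ^ 2 / 2) by (apply Rabs_le; lra).
  assert (H' := Rabs_pos x); assert (H'' := pow2_ge_0 x); nra.
Qed.

Lemma cexp_quadratic (u : C) : Cmod u <= / 2 ->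
  Cmod (Cminus (Cminus (cexp u) (RtoC 1)) u) <= 6 * Cmod u ^ 2.
Proof.
intros Hu; destruct u as [x y].
assert (Hx : Rabs x <= Cmod (x, y)).
{ eapply Rle_trans; [|apply Rmax_Cmod]; apply Rmax_l. }
assert (Hy : Rabs y <= Cmod (x, y)).
{ eapply Rle_trans; [|apply Rmax_Cmod]; apply Rmax_r. }
assert (E := exp_quadratic x ltac:(lra)).
assert (Cy := cos_quadratic y); assert (Sy := sin_quadratic y ltac:(lra)).
assert (S1 := Rabs_sin_le y).
set (m := Cmod (x, y)) in *.
unfold cexp, Cminus, Cplus, Copp, RtoC; simpl fst; simpl snd.
eapply Rle_trans; [apply Cmod_le_sum|].
assert (Px := Rabs_pos x); assert (Py := Rabs_pos y).
assert (X2 : x ^ 2 <= m ^ 2) by (rewrite -(pow2_abs x); apply pow_incr; lra).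
assert (Y2 : y ^ 2 <= m ^ 2) by (rewrite -(pow2_abs y); apply pow_incr; lra).
assert (Hx1 := proj1 (Rabs_le_between x m) Hx).
assert (Hy1 := proj1 (Rabs_le_between y m) Hy).
assert (B1 : Rabs (exp x * cos y + - (1) + - x) <= 3 * m ^ 2).
{ replace (exp x * cos y + - (1) + - x) with ((exp x - 1 - x) * cos y + (1 + x) * (cos y - 1)) by ring.
  eapply Rle_trans; [apply Rabs_triang|]; rewrite !Rabs_mult.
  assert (Rabs (exp x - 1 - x) <= 2 * m ^ 2) by (apply Rabs_le; lra).
  assert (Rabs (cos y) <= 1) by (apply Rabs_le; assert (Hc := COS_bound y); lra).
  assert (Rabs (1 + x) <= 2) by (apply Rabs_le; lra).
  assert (Rabs (cos y - 1) <= m ^ 2 / 2) by (apply Rabs_le; lra).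
  assert (Q1 := Rabs_pos (exp x - 1 - x)); assert (Q2 := Rabs_pos (cos y - 1)).
  assert (Q3 := Rabs_pos (cos y)); assert (Q4 := Rabs_pos (1 + x)); nra. }
assert (B2 : Rabs (exp x * sin y + - 0 + - y) <= 3 * m ^ 2).
{ replace (exp x * sin y + - 0 + - y) with ((exp x - 1) * sin y + (sin y - y)) by ring.
  eapply Rle_trans; [apply Rabs_triang|]; rewrite !Rabs_mult.
  assert (Rabs (exp x - 1) <= 2 * m).
  { apply Rabs_le.
    assert (x ^ 2 <= m / 2) by nra. lra. }
  assert (Q1 := Rabs_pos (exp x - 1)); assert (Q2 := Rabs_pos (sin y)).
  assert (Rabs (exp x - 1) * Rabs (sin y) <= 2 * m * m) by (apply Rmult_le_compat; lra).
  lra. }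
lra.
Qed.

Lemma cexp_minus_1 (u : C) : Cmod u <= / 2 -> Cmod (Cminus (cexp u) (RtoC 1)) <= 4 * Cmod u.
Proof.
intros Hu; assert (H := cexp_quadratic u Hu); assert (H0 := Cmod_ge_0 u).
replace (Cminus (cexp u) (RtoC 1)) with (Cplus (Cminus (Cminus (cexp u) (RtoC 1)) u) u) by ring.
eapply Rle_trans; [apply Cmod_triangle|]; nra.
Qed.

(** * Algebra and differentiation of operator-valued functions *)

Section OperatorAlgebra.
Context {X : CompleteNormedModule C_AbsRing}.
Implicit Types (S T U : bddop X).

Lemma comp_plus_l S T U : bddop_comp (plus S T) U = plus (bddop_comp S U) (bddop_comp T U).
Proof. apply bddop_ext; intros x; reflexivity. Qed.

Lemma comp_plus_r S T U : bddop_comp S (plus T U) = plus (bddop_comp S T) (bddop_comp S U).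
Proof. apply bddop_ext; intros x; apply (linear_plus _ (bddop_linear S)). Qed.

Lemma comp_scal_l (k : C) S T :
  bddop_comp (cscal k S) T = cscal k (bddop_comp S T).
Proof. apply bddop_ext; intros x; reflexivity. Qed.

Lemma comp_scal_r (k : C) S T :
  bddop_comp S (cscal k T) = cscal k (bddop_comp S T).
Proof. apply bddop_ext; intros x; apply (linear_scal _ (bddop_linear S)). Qed.

Lemma comp_opp_l S T : bddop_comp (opp S) T = opp (bddop_comp S T).
Proof. apply comp_scal_l. Qed.

Lemma comp_opp_r S T : bddop_comp S (opp T) = opp (bddop_comp S T).
Proof. apply comp_scal_r. Qed.

Definition comp_expand :=
  (@comp_plus_l, @comp_plus_r, @comp_opp_l, @comp_opp_r, @comp_scal_l, @comp_scal_r).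

Lemma norm_comp S T : norm (bddop_comp S T) <= norm S * norm T.
Proof.
apply opnorm_le.
- apply Rmult_le_pos; apply: norm_ge_0.
- intros x; simpl; eapply Rle_trans; [apply norm_bddop_le|].
  rewrite Rmult_assoc; apply Rmult_le_compat_l; [apply opnorm_ge_0|apply norm_bddop_le].
Qed.

Notation BX := (bddop_CompleteNormedModule X).

Lemma cdiff_comp (F G : C -> bddop X) (w : C) (D E : bddop X) :
  cdiff F w D -> cdiff G w E ->
  cdiff (fun z => bddop_comp (F z) (G z)) w (plus (bddop_comp D (G w)) (bddop_comp (F w) E)).
Proof.
intros HF HG e He.
destruct (cdiff_lip _ _ _ HF) as [dF [HdF LF]]; destruct (cdiff_lip _ _ _ HG) as [dG [HdG LG]].
assert (P0 : 0 < norm D + 1) by (assert (H := norm_ge_0 D); lra).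
assert (P1 : 0 < norm E + 1) by (assert (H := norm_ge_0 E); lra).
assert (P2 : 0 < norm (F w) + 1) by (assert (H := norm_ge_0 (F w)); lra).
assert (P3 : 0 < norm (G w) + 1) by (assert (H := norm_ge_0 (G w)); lra).
destruct (HF (e / 3 / (norm (G w) + 1))) as [d1 [Hd1 K1]]; [apply Rdiv_lt_0_compat; lra|].
destruct (HG (e / 3 / (norm (F w) + 1))) as [d2 [Hd2 K2]]; [apply Rdiv_lt_0_compat; lra|].
set (d3 := e / 3 / ((norm D + 1) * (norm E + 1))).
assert (Hd3 : 0 < d3) by (apply Rdiv_lt_0_compat; [lra|apply Rmult_lt_0_compat; assumption]).
exists (Rmin (Rmin dF dG) (Rmin (Rmin d1 d2) d3)); split.
{ repeat apply Rmin_pos; assumption. }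
intros u Hu.
Rmin_bounds M1 M2 (Rmin dF dG) (Rmin (Rmin d1 d2) d3).
Rmin_bounds M3 M4 dF dG.
Rmin_bounds M5 M6 (Rmin d1 d2) d3.
Rmin_bounds M7 M8 d1 d2.
specialize (LF u ltac:(lra)); specialize (LG u ltac:(lra)).
specialize (K1 u ltac:(lra)); specialize (K2 u ltac:(lra)).
assert (Hu0 := Cmod_ge_0 u).
set (dFu := minus (minus (F (Cplus w u)) (F w)) (cscal u D)) in *.
set (dGu := minus (minus (G (Cplus w u)) (G w)) (cscal u E)) in *.
(* The Leibniz remainder: one first order remainder for each factor, and the product of the two
   increments, which is of second order. Each gets a third of [e]. *)
match goal with |- norm ?t <= _ => replace t with
  (plus (bddop_comp dFu (G w)) (plus (bddop_comp (F w) dGu)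
    (bddop_comp (minus (F (Cplus w u)) (F w)) (minus (G (Cplus w u)) (G w))))) end.
2:{ unfold dFu, dGu, minus; rewrite !comp_expand; mring BX. }
norm_split BX.
replace (e * Cmod u) with (e / 3 * Cmod u + (e / 3 * Cmod u + e / 3 * Cmod u)) by field.
apply Rplus_le_compat.
{ eapply Rle_trans; [apply norm_comp|].
  apply Rle_trans with (e / 3 / (norm (G w) + 1) * Cmod u * (norm (G w) + 1)).
  - apply Rmult_le_compat; [apply (norm_ge_0 dFu)|apply norm_ge_0|exact K1|lra].
  - right; field; lra. }
norm_split BX.
apply Rplus_le_compat.
{ eapply Rle_trans; [apply norm_comp|].
  apply Rle_trans with ((norm (F w) + 1) * (e / 3 / (norm (F w) + 1) * Cmod u)).
  - apply Rmult_le_compat; [apply norm_ge_0|apply (norm_ge_0 dGu)|lra|exact K2].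
  - right; field; lra. }
eapply Rle_trans; [apply norm_comp|].
apply Rle_trans with (((norm D + 1) * Cmod u) * ((norm E + 1) * d3)).
- apply Rmult_le_compat; [apply (norm_ge_0 (minus (F (Cplus w u)) (F w)))
    |apply (norm_ge_0 (minus (G (Cplus w u)) (G w)))|exact LF|].
  eapply Rle_trans; [exact LG|]; apply Rmult_le_compat_l; lra.
- right; unfold d3; field; lra.
Qed.

Lemma cdiff_const (T : bddop X) (w : C) : cdiff (fun _ => T) w zero.
Proof.
intros e He; exists 1; split; [lra|]; intros u _.
match goal with |- norm ?t <= _ => replace t with (zero : bddop X) by mring BX end.
rewrite (norm_zero (V := BX)); apply Rmult_le_pos; [lra|apply Cmod_ge_0].
Qed.

(* The resolvent identity in logarithmic coordinates characterises the
   functions [w |-> e^w (e^w - a)^-1]. *)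
Lemma cdiff_resolvent_family (G : C -> bddop X) (w : C) (d K : R) : 0 < d ->
  (forall u, Cmod u < d -> norm (G (Cplus w u)) <= K) ->
  (forall u, Cmod u < d -> minus (G (Cplus w u)) (G w)
     = cscal (Cminus (RtoC 1) (cexp u))
         (minus (bddop_comp (G (Cplus w u)) (G w)) (G w))) ->
  cdiff G w (minus (G w) (bddop_comp (G w) (G w))).
Proof.
intros Hd HK HG e He.
assert (K0 : 0 <= norm (G w)) by apply norm_ge_0.
assert (K1 : 0 <= K).
{ eapply Rle_trans; [|apply (HK (RtoC 0)); rewrite Cmod_0; exact Hd]; apply norm_ge_0. }
set (M := K * norm (G w) + norm (G w)).
assert (M0 : 0 <= M) by (unfold M; nra).
assert (Lip : forall u, Cmod u < d -> norm (minus (bddop_comp (G (Cplus w u)) (G w)) (G w)) <= M).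
{ intros u Hu; unfold minus; norm_split BX.
  rewrite (norm_opp (V := BX)); apply Rplus_le_compat_r.
  eapply Rle_trans; [apply norm_comp|]; apply Rmult_le_compat_r; [exact K0|apply HK, Hu]. }
(* 6 M comes from the quadratic remainder of the exponential, 16 M |G w| from (4 |u|) (4 |u| M) |G
   w|, and 1 ensures positivity. *)
set (B := 6 * M + 16 * M * norm (G w) + 1).
assert (B0 : 0 < B) by (unfold B; assert (0 <= M * norm (G w)) by (apply Rmult_le_pos; assumption); lra).
exists (Rmin (Rmin d (/ 2)) (e / B)); split.
{ repeat apply Rmin_pos; try lra; apply Rdiv_lt_0_compat; assumption. }
intros u Hu.
Rmin_bounds M1 M2 (Rmin d (/ 2)) (e / B).
Rmin_bounds M3 M4 d (/ 2).
assert (Hu0 := Cmod_ge_0 u).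
assert (L1 := Lip u ltac:(lra)).
assert (E1 := cexp_minus_1 u ltac:(lra)); assert (E2 := cexp_quadratic u ltac:(lra)).
assert (Ek : Cmod (Cminus (RtoC 1) (cexp u)) <= 4 * Cmod u).
{ replace (Cminus (RtoC 1) (cexp u)) with (Copp (Cminus (cexp u) (RtoC 1))) by ring.
  rewrite Cmod_opp; exact E1. }
(* Boundedness and the identity first give a Lipschitz estimate. Fed back into the identity, it
   shows that G(w + u) may be replaced by G(w) up to second order. *)
assert (ED : norm (minus (G (Cplus w u)) (G w)) <= 4 * Cmod u * M).
{ rewrite HG; [|lra]; rewrite (norm_scal_C (X := BX)).
  apply Rmult_le_compat; [apply Cmod_ge_0| |exact Ek|exact L1].
  apply (norm_ge_0 (V := BX)). }
assert (L0 : norm (minus (bddop_comp (G w) (G w)) (G w)) <= M).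
{ assert (L := Lip (RtoC 0)); replace (Cplus w (RtoC 0)) with w in L by ring.
  apply L; rewrite Cmod_0; exact Hd. }
match goal with |- norm ?t <= _ => replace t with
  (plus (cscal (Cminus (RtoC 1) (cexp u)) (bddop_comp (minus (G (Cplus w u)) (G w)) (G w)))
        (cscal (Copp (Cminus (Cminus (cexp u) (RtoC 1)) u))
          (minus (bddop_comp (G w) (G w)) (G w)))) end.
2:{ rewrite [X in minus X (scal _ _)]HG; [|lra].
    unfold minus; rewrite !comp_expand; mring BX. }
norm_split BX.
rewrite !(norm_scal_C (X := BX)) Cmod_opp.
assert (N1 := norm_comp (minus (G (Cplus w u)) (G w)) (G w)).
set (n1 := norm (bddop_comp (minus (G (Cplus w u)) (G w)) (G w))) in *.
set (n2 := norm (minus (G (Cplus w u)) (G w))) in *.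
assert (N2 : n1 <= 4 * Cmod u * M * norm (G w)).
{ eapply Rle_trans; [exact N1|]; apply Rmult_le_compat_r; [exact K0|exact ED]. }
assert (N3 : Cmod (Cminus (RtoC 1) (cexp u)) * n1 <= 4 * Cmod u * (4 * Cmod u * M * norm (G w))).
{ apply Rmult_le_compat; [apply Cmod_ge_0|apply (norm_ge_0 (V := BX))|exact Ek|exact N2]. }
assert (N4 : Cmod (Cminus (Cminus (cexp u) (RtoC 1)) u) * norm (minus (bddop_comp (G w) (G w)) (G w))
  <= 6 * Cmod u ^ 2 * M).
{ apply Rmult_le_compat; [apply Cmod_ge_0|apply (norm_ge_0 (V := BX))|exact E2|exact L0]. }
apply Rle_trans with (B * Cmod u * Cmod u).
{ unfold B; assert (0 <= Cmod u * Cmod u) by nra.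
  eapply Rle_trans; [apply Rplus_le_compat; [exact N3|exact N4]|].
  replace (_ + _) with ((6 * M + 16 * M * norm (G w)) * (Cmod u * Cmod u)) by ring.
  lra. }
apply Rmult_le_compat_r; [exact Hu0|].
apply Rle_trans with (B * (e / B)); [apply Rmult_le_compat_l; lra|right; field; lra].
Qed.

End OperatorAlgebra.

(** * Resolvents *)

Lemma Cmod_reverse_triangle (a b : C) : Rabs (Cmod a - Cmod b) <= Cmod (Cminus a b).
Proof.
assert (H1 := Cmod_triangle (Cminus a b) b); assert (H2 := Cmod_triangle (Cminus b a) a).
replace (Cplus (Cminus a b) b) with a in H1 by ring.
replace (Cplus (Cminus b a) a) with b in H2 by ring.
assert (E : Cmod (Cminus b a) = Cmod (Cminus a b)).
{ rewrite -Cmod_opp; f_equal; ring. }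
apply Rabs_le; lra.
Qed.

Section Resolvents.
Context {X : CompleteNormedModule C_AbsRing}.
Variable A : operator X.
Notation BX := (bddop_CompleteNormedModule X).

Lemma is_resolvent_unique (l : C) (S T : bddop X) :
  is_resolvent A l S -> is_resolvent A l T -> S = T.
Proof.
intros [H1 _] [_ H2]; apply bddop_ext; intros x.
destruct (H1 x) as [Hd Hx]; rewrite -[in RHS]Hx; symmetry; apply H2, Hd.
Qed.

Lemma resolvent_correct (l : C) : resolvent_set A l -> is_resolvent A l (resolvent A l).
Proof.
intros [S HS]; unfold resolvent; apply (@iota_correct C_AbsRing BX); exists S; split; [exact HS|].
intros T HT; apply (is_resolvent_unique l); assumption.
Qed.

Lemma resolvent_identity (l m : C) : resolvent_set A l -> resolvent_set A m ->
  minus (resolvent A l) (resolvent A m)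
  = cscal (Cminus m l) (bddop_comp (resolvent A l) (resolvent A m)).
Proof.
intros Hl Hm; apply resolvent_correct in Hl; apply resolvent_correct in Hm.
set (S := resolvent A l) in *; set (T := resolvent A m) in *.
apply bddop_ext; intros x; rewrite bddop_minusE.
change (minus (S x) (T x) = cscal (Cminus m l) (S (T x))).
destruct (proj1 Hm x) as [Hd Hx].
set (y := T x) in *.
assert (E : x = plus (minus (cscal l y) (A y)) (cscal (Cminus m l) y)).
{ rewrite -Hx; mring X. }
rewrite [in LHS]E (linear_plus _ (bddop_linear S)) (linear_scal _ (bddop_linear S)).
rewrite (proj2 Hl y Hd); mring X.
Qed.

Definition logres (w : C) : bddop X := cscal (cexp w) (resolvent A (cexp w)).

(** The resolvent identity, left undivided so that it remains valid when the two exponentials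
    coincide. *)
Lemma logres_product (w v : C) :
  resolvent_set A (cexp w) -> resolvent_set A (cexp v) ->
  cscal (Cminus (cexp v) (cexp w)) (bddop_comp (logres w) (logres v))
  = minus (cscal (cexp v) (logres w)) (cscal (cexp w) (logres v)).
Proof.
intros Hw Hv; assert (E := resolvent_identity _ _ Hw Hv).
unfold logres; rewrite !comp_expand.
replace (minus (cscal (cexp v) (cscal (cexp w) (resolvent A (cexp w))))
  (cscal (cexp w) (cscal (cexp v) (resolvent A (cexp v)))))
  with (cscal (Cmult (cexp v) (cexp w)) (minus (resolvent A (cexp w)) (resolvent A (cexp v))))
  by mring BX.
rewrite E; mring BX.
Qed.

(** The product identity divided by e^w. By homogeneity the scalar factor depends on [u] alone,
    which is the hypothesis of [cdiff_resolvent_family]. *)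
Lemma logres_shift (w u : C) :
  resolvent_set A (cexp (Cplus w u)) -> resolvent_set A (cexp w) ->
  minus (logres (Cplus w u)) (logres w)
  = cscal (Cminus (RtoC 1) (cexp u))
      (minus (bddop_comp (logres (Cplus w u)) (logres w)) (logres w)).
Proof.
intros Hw Hv; assert (E := logres_product _ _ Hw Hv).
assert (N := cexp_neq_0 w).
rewrite cexp_plus in E.
assert (E' : cscal (Cinv (cexp w))
  (cscal (Cminus (cexp w) (Cmult (cexp w) (cexp u)))
    (bddop_comp (logres (Cplus w u)) (logres w))) =
  cscal (Cinv (cexp w)) (minus (cscal (cexp w) (logres (Cplus w u)))
      (cscal (Cmult (cexp w) (cexp u)) (logres w)))) by (f_equal; exact E).
transitivity (minus (cscal (Cinv (cexp w))
  (minus (cscal (cexp w) (logres (Cplus w u)))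
      (cscal (Cmult (cexp w) (cexp u)) (logres w))))
  (cscal (Cminus (RtoC 1) (cexp u)) (logres w))).
- mreduce BX; Cnorm; field; exact N.
- rewrite -E'; mreduce BX; Cnorm; field; exact N.
Qed.

(** Identifies the line at height 2 pi - t with the one at height -t, so that a rectangle that
    encloses the negative axis in the exponential coordinate joins the two rays of a contour. *)
Lemma logres_periodic (x y : R) : logres (x, y + 2 * PI) = logres (x, y).
Proof.
unfold logres; replace (cexp (x, y + 2 * PI)) with (cexp (x, y)); [reflexivity|].
unfold cexp; cbn [fst snd]; rewrite cos_plus sin_plus cos_2PI sin_2PI; f_equal; ring.
Qed.

(** A cone condition stable under limits, through which membership in the closure of a sector can be
    refuted for every angle below pi. *)
Lemma sector_cos (theta : R) (z : C) : 0 < theta < PI ->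
  sector theta z -> Cmod z * cos theta <= fst z.
Proof.
intros Ht [r [phi [Hr [Hphi ->]]]].
rewrite Cmod_mult Cmod_cis Cmod_R Rabs_pos_eq; [|lra].
unfold Cmult, RtoC, cis; simpl.
assert (cos theta <= cos phi).
{ rewrite (cos_Rabs phi).
  assert (H0 := Rabs_pos phi); apply cos_decr_1; lra. }
nra.
Qed.

Lemma not_in_closure_sector (theta : R) (w : C) : 0 < theta < PI ->
  cos (snd w) < cos theta -> ~ in_closure (sector theta) (cexp w).
Proof.
intros Ht Hw H; destruct w as [s phi]; simpl in Hw.
set (m := exp s * (cos theta - cos phi)).
assert (Hm : 0 < m) by (unfold m; apply Rmult_lt_0_compat; [apply exp_pos|lra]).
(* Moving each coordinate by m / 4 changes the real part by at most m / 4 and the modulus by at most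
   m / 2. Together this is less than the gap m between the two sides of the cone condition. *)
destruct (H (mkposreal (m / 4) ltac:(lra))) as [z [Hz Hs]].
assert (Hs' := sector_cos _ _ Ht Hs).
assert (Hc := COS_bound theta).
destruct Hz as [Hz1 Hz2]; simpl in Hz1, Hz2.
change (Rabs (fst z - exp s * cos phi) < m / 4) in Hz1.
change (Rabs (snd z - exp s * sin phi) < m / 4) in Hz2.
assert (Hmod : Rabs (Cmod z - exp s) <= m / 2).
{ rewrite -(Cmod_cexp (s, phi)).
  eapply Rle_trans; [apply Cmod_reverse_triangle|].
  destruct z as [z1 z2]; unfold Cminus, Cplus, Copp, cexp; simpl in *.
  eapply Rle_trans; [apply Cmod_le_sum|]; unfold Rminus in *; lra. }
apply Rabs_def2 in Hz1; apply Rabs_le_between in Hmod.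
unfold m in *; simpl in *; nra.
Qed.

Hypothesis hA0 : omega_of A = Finite 0.

(** Comparing cosines says that the argument of e^w is outside the open sector of angle [g] whatever
    its determination modulo 2 pi, so no branch has to be chosen. *)
Lemma logres_bounded (g : R) : 0 < g < PI ->
  exists K, 0 < K /\ forall w, cos (snd w) <= cos g ->
    resolvent_set A (cexp w) /\ norm (logres w) <= K.
Proof.
intros Hg.
assert (Hom : exists om, sectorial_angle A om /\ om < g).
{ apply NNPP; intros Hno.
  assert (H := proj2 (Glb_Rbar_correct (sectorial_angle A))).
  specialize (H (Finite g)); unfold omega_of in hA0; rewrite hA0 in H; simpl in H.
  assert (g <= 0); [|lra].
  apply H; intros r Hr; simpl; apply Rnot_lt_le; intros Hlt; apply Hno; exists r; split; assumption. }
destruct Hom as [om [[Ho [Hspec Hres]] Hog]].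
(* An intermediate angle: it must exceed [om] for the resolvent bound and stay below [g], so that
   the points at angle [g] itself lie outside its closed sector. *)
destruct (Hres ((om + g) / 2) ltac:(lra)) as [K [HK HKb]].
exists K; split; [exact HK|]; intros w Hw.
assert (Hc1 : cos g < cos ((om + g) / 2)) by (apply cos_decreasing_1; lra).
assert (Hc2 : cos g < cos om) by (apply cos_decreasing_1; lra).
split.
- apply NNPP; intros Hn; apply (not_in_closure_sector om w); [lra|lra|].
  apply Hspec; exact Hn.
- apply HKb, not_in_closure_sector; lra.
Qed.

(** The local bound that [cdiff_resolvent_family] requires. The value [m] halfway between the cosine
    and 1 leaves room for the argument to move. *)
Lemma logres_bounded_off_axis (w : C) : cos (snd w) < 1 ->
  exists d K, 0 < d /\ forall u, Cmod u < d ->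
    resolvent_set A (cexp (Cplus w u)) /\ norm (logres (Cplus w u)) <= K.
Proof.
intros Hw; set (m := (1 + cos (snd w)) / 2).
assert (Hc := COS_bound (snd w)).
assert (Hm : 0 <= m < 1) by (unfold m; lra).
assert (Ea : cos (acos m) = m) by (apply cos_acos; lra).
assert (Hg : 0 < acos m < PI).
{ assert (Hb := acos_bound m); destruct Hb as [Hb1 Hb2]; split.
  - destruct Hb1 as [Hb1|Hb1]; [exact Hb1|]; rewrite -Hb1 cos_0 in Ea; lra.
  - destruct Hb2 as [Hb2|Hb2]; [exact Hb2|]; rewrite Hb2 cos_PI in Ea; lra. }
destruct (logres_bounded _ Hg) as [K [_ HK]].
destruct (continuity_cos (snd w) ((1 - cos (snd w)) / 2)) as [d [Hd Hcont]]; [lra|].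
exists d, K; split; [exact Hd|]; intros u Hu; apply HK; rewrite Ea; unfold m.
(* This form of continuity speaks only of points different from the limit point. *)
destruct (Req_dec (snd u) 0) as [H0|H0].
{ unfold Cplus; simpl; rewrite H0 Rplus_0_r; lra. }
assert (Hsnd : Rabs (snd u) <= Cmod u).
{ eapply Rle_trans; [|apply Rmax_Cmod]; apply Rmax_r. }
assert (H := Hcont (snd w + snd u)).
unfold dist in H; simpl in H; unfold R_dist, D_x, no_cond in H.
assert (H' : Rabs (cos (snd w + snd u) - cos (snd w)) < (1 - cos (snd w)) / 2).
{ apply H; split; [split; [exact I|lra]|].
  replace (snd w + snd u - snd w) with (snd u) by ring; lra. }
apply Rabs_def2 in H'; unfold Cplus; simpl; lra.
Qed.

Lemma off_axis_resolvent_set (w : C) : cos (snd w) < 1 -> resolvent_set A (cexp w).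
Proof.
intros Hw; destruct (logres_bounded_off_axis w Hw) as [d [K [Hd H]]].
assert (H' := H (RtoC 0)); replace (Cplus w (RtoC 0)) with w in H' by ring.
apply H'; rewrite Cmod_0; exact Hd.
Qed.

Lemma cdiff_logres (w : C) : cos (snd w) < 1 ->
  cdiff logres w (minus (logres w) (bddop_comp (logres w) (logres w))).
Proof.
intros Hw; destruct (logres_bounded_off_axis w Hw) as [d [K [Hd H]]].
apply (cdiff_resolvent_family _ _ d K); [exact Hd|intros u Hu; apply H, Hu|].
intros u Hu; apply logres_shift; [apply H, Hu|apply off_axis_resolvent_set, Hw].
Qed.

Lemma commutant_logres (T : bddop X) (w : C) : commutant A T -> cos (snd w) < 1 ->
  bddop_comp T (logres w) = bddop_comp (logres w) T.
Proof.
intros HT Hw; unfold logres; rewrite comp_scal_r comp_scal_l HT; [reflexivity|].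
apply off_axis_resolvent_set, Hw.
Qed.

(** Exchanging [w] and [v] changes the sign of both sides of the product identity except for the
    order of the factors. *)
Lemma logres_commute (w v : C) : cos (snd w) < 1 -> cos (snd v) < 1 ->
  bddop_comp (logres w) (logres v) = bddop_comp (logres v) (logres w).
Proof.
intros Hw Hv.
assert (Rw := off_axis_resolvent_set w Hw); assert (Rv := off_axis_resolvent_set v Hv).
destruct (classic (cexp v = cexp w)) as [E|N].
{ unfold logres; rewrite E; reflexivity. }
assert (N' : Cminus (cexp v) (cexp w) <> RtoC 0).
{ apply Cminus_eq_contra, N. }
assert (E1 := logres_product w v Rw Rv); assert (E2 := logres_product v w Rv Rw).
transitivity (cscal (Cinv (Cminus (cexp v) (cexp w)))
  (cscal (Cminus (cexp v) (cexp w)) (bddop_comp (logres w) (logres v)))).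
{ mreduce BX; Cnorm; field; exact N'. }
rewrite E1.
transitivity (cscal (Copp (Cinv (Cminus (cexp v) (cexp w))))
  (cscal (Cminus (cexp w) (cexp v)) (bddop_comp (logres v) (logres w)))).
{ rewrite E2; mring BX. }
mreduce BX; Cnorm; field; exact N'.
Qed.

End Resolvents.

(** * Integrals over a horizontal line *)

Section LineIntegrals.
Context {V : CompleteNormedModule C_AbsRing}.
Implicit Types (G : R -> V) (L : V).

(** The two ends go to infinity independently, as in the improper integral that defines
    [ray_int]. *)
Definition is_line G L : Prop :=
  forall e, 0 < e -> exists M0, forall a b, M0 <= a -> M0 <= b ->
    norm (minus (RI G (- a) b) L) <= e.

Definition exp_decay G : Prop :=
  exists c k, 0 < c /\ 0 < k /\ forall s, norm (G s) <= c * exp (- (k * Rabs s)).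

Lemma cont_everywhere G a b : (forall s, continuous G s) -> cont_on G a b.
Proof. intros H s _; apply H. Qed.

Lemma tail_right G c k u v : (forall s, continuous G s) -> 0 < c -> 0 < k ->
  (forall s, norm (G s) <= c * exp (- (k * Rabs s))) -> 0 <= u <= v ->
  norm (RI G u v) <= c / k * exp (- (k * u)).
Proof.
intros HG Hc Hk Hb Huv.
assert (I : is_RInt (fun s => c * exp (- (k * s))) u v
  (minus (- (c / k) * exp (- (k * v))) (- (c / k) * exp (- (k * u))))).
{ apply (is_RInt_derive (fun s => - (c / k) * exp (- (k * s)))).
  - intros s _; auto_derive; [exact I|field; lra].
  - intros s _; apply: ex_derive_continuous; auto_derive; exact I. }
eapply Rle_trans.
{ apply (RI_norm_fun G (fun s => c * exp (- (k * s)))); [lra|apply cont_everywhere, HG| |].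
  - intros s Hs; eapply Rle_trans; [apply Hb|]; rewrite Rabs_pos_eq; lra.
  - eexists; exact I. }
rewrite (is_RInt_unique _ _ _ _ I).
unfold minus, plus, opp; simpl.
assert (Hq : 0 < c / k) by (apply Rdiv_lt_0_compat; assumption).
assert (H := exp_pos (- (k * v))); nra.
Qed.

Lemma tail_left G c k u v : (forall s, continuous G s) -> 0 < c -> 0 < k ->
  (forall s, norm (G s) <= c * exp (- (k * Rabs s))) -> 0 <= u <= v ->
  norm (RI G (- v) (- u)) <= c / k * exp (- (k * u)).
Proof.
intros HG Hc Hk Hb Huv.
assert (I : is_RInt (fun s => c * exp (k * s)) (- v) (- u)
  (minus (c / k * exp (k * - u)) (c / k * exp (k * - v)))).
{ apply (is_RInt_derive (fun s => c / k * exp (k * s))).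
  - intros s _; auto_derive; [exact I|field; lra].
  - intros s _; apply: ex_derive_continuous; auto_derive; exact I. }
eapply Rle_trans.
{ apply (RI_norm_fun G (fun s => c * exp (k * s))); [lra|apply cont_everywhere, HG| |].
  - intros s Hs; eapply Rle_trans; [apply Hb|]; rewrite Rabs_left1; [|lra].
    right; f_equal; f_equal; ring.
  - eexists; exact I. }
rewrite (is_RInt_unique _ _ _ _ I).
unfold minus, plus, opp; simpl.
assert (Hq : 0 < c / k) by (apply Rdiv_lt_0_compat; assumption).
assert (H := exp_pos (k * - v)); replace (- (k * u)) with (k * - u) by ring; nra.
Qed.

Lemma exp_tail_small (c k e : R) : 0 < c -> 0 < k -> 0 < e ->
  exists M0, 0 <= M0 /\ forall u, M0 <= u -> c / k * exp (- (k * u)) <= e.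
Proof.
intros Hc Hk He.
assert (Hck : 0 < c / k) by (apply Rdiv_lt_0_compat; assumption).
assert (Hq : 0 < c / k / e) by (apply Rdiv_lt_0_compat; assumption).
(* Chosen so that k u >= c / (k e), which suffices because e^(k u) >= 1 + k u. *)
exists (c / k / e / k); split; [left; apply Rdiv_lt_0_compat; assumption|]; intros u Hu.
assert (H : c / k / e <= k * u).
{ apply (Rmult_le_compat_l k) in Hu; [|lra].
  replace (k * (c / k / e / k)) with (c / k / e) in Hu by (field; lra); exact Hu. }
assert (H1 := exp_ineq1_le (k * u)).
rewrite exp_Ropp; apply (Rmult_le_reg_r (exp (k * u))); [apply exp_pos|].
rewrite Rmult_assoc Rinv_l; [|apply Rgt_not_eq, exp_pos].
apply (Rmult_le_compat_l e) in H; [|lra].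
replace (e * (c / k / e)) with (c / k) in H by (field; lra).
assert (e * (k * u) <= e * exp (k * u)) by (apply Rmult_le_compat_l; lra); lra.
Qed.

Lemma tails_small G : (forall s, continuous G s) -> exp_decay G ->
  forall e, 0 < e -> exists M0, 0 <= M0 /\ forall u v, M0 <= u -> M0 <= v ->
    norm (RI G u v) <= e /\ norm (RI G (- u) (- v)) <= e.
Proof.
intros HG [c [k [Hc [Hk Hb]]]] e He.
destruct (exp_tail_small c k e Hc Hk He) as [M0 [HM0 HM]].
exists M0; split; [exact HM0|].
(* The tail estimates want ordered end points; reversing an integral only changes its sign. *)
assert (W : forall a b, norm (RI G a b) = norm (RI G b a)).
{ intros a b; rewrite -(norm_opp (RI G b a)); f_equal.
  assert (E := RI_Chasles G a b a (cont_everywhere _ _ _ HG) (cont_everywhere _ _ _ HG)).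
  rewrite RI_point in E.
  transitivity (minus (plus (RI G a b) (RI G b a)) (RI G b a)); [mring V|rewrite E; mring V]. }
intros u v Hu Hv; destruct (Rle_dec u v) as [Huv|Huv].
- split; [|rewrite W]; (eapply Rle_trans; [|apply (HM u Hu)]);
    [apply tail_right|apply tail_left]; try assumption; lra.
- split; [rewrite W|]; (eapply Rle_trans; [|apply (HM v Hv)]);
    [apply tail_right|apply tail_left]; try assumption; lra.
Qed.

Lemma line_exists G : (forall s, continuous G s) -> exp_decay G -> exists L, is_line G L.
Proof.
intros HG Hd.
pose (F := filter_prod (Rbar_locally p_infty) (Rbar_locally p_infty)).
assert (PF : ProperFilter F) by (unfold F; typeclasses eauto).
destruct (proj1 (filterlim_locally_cauchy (F := F) (fun ab : R * R => RI G (- fst ab) (snd ab) : V))) as [L HL].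
{ intros e.
  destruct (tails_small G HG Hd (e / 3)) as [M0 [_ HM]]; [assert (H := cond_pos e); lra|].
  exists (fun ab => M0 < fst ab /\ M0 < snd ab); split.
  - apply (Filter_prod _ _ _ (fun a => M0 < a) (fun b => M0 < b)); [exists M0; auto|exists M0; auto|].
    intros a b Ha Hb; split; assumption.
  - intros [a b] [a' b'] [Ha Hb] [Ha' Hb']; simpl in *; apply: norm_compat1.
    destruct (HM b b') as [H1 _]; [lra|lra|]; destruct (HM a a') as [_ H2]; [lra|lra|].
    assert (E1 := RI_Chasles G (- a) (- a') b' (cont_everywhere _ _ _ HG) (cont_everywhere _ _ _ HG)).
    assert (E2 := RI_Chasles G (- a) b b' (cont_everywhere _ _ _ HG) (cont_everywhere _ _ _ HG)).
    match goal with |- norm ?t < _ => replace t with (minus (RI G b b') (RI G (- a) (- a'))) end.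
    2:{ transitivity (minus (plus (RI G (- a) b) (RI G b b')) (plus (RI G (- a) b) (RI G (- a) (- a')))); [mring V|].
        rewrite E2 -E1.
        change (minus (plus (RI G (- a) (- a')) (RI G (- a') b')) (plus (RI G (- a) b) (RI G (- a) (- a')))
          = minus (RI G (- a') b') (RI G (- a) b)); mring V. }
    unfold minus; eapply Rle_lt_trans; [apply (norm_triangle (V := V))|]; rewrite (norm_opp (V := V)).
    assert (H := cond_pos e); apply Rle_lt_trans with (e / 3 + e / 3); [|lra].
    apply Rplus_le_compat; assumption. }
exists L; intros e He.
assert (Hf := @norm_factor_gt_0 _ V).
assert (He' : 0 < e / @norm_factor _ V) by (apply Rdiv_lt_0_compat; lra).
destruct (proj1 (filterlim_locally _ _) HL (mkposreal _ He')) as [Q1 Q2 [m1 H1] [m2 H2] H].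
exists (Rmax m1 m2 + 1); intros a b Ha Hb.
Rmax_bounds M1 M2 m1 m2.
specialize (H a b (H1 a ltac:(lra)) (H2 b ltac:(lra))).
left; eapply Rlt_le_trans; [apply (norm_compat2 _ _ _ H)|]; simpl; right; field; lra.
Qed.

Lemma is_line_ext G G' L : (forall s, G s = G' s) -> is_line G L -> is_line G' L.
Proof.
intros E H e He; destruct (H e He) as [M0 HM]; exists M0; intros a b Ha Hb.
rewrite -(RI_ext G); [apply HM; assumption|intros; apply E].
Qed.

Lemma is_line_plus G G' L L' : (forall s, continuous G s) -> (forall s, continuous G' s) ->
  is_line G L -> is_line G' L' -> is_line (fun s => plus (G s) (G' s)) (plus L L').
Proof.
intros HG HG' H H' e He.
destruct (H (e / 2)) as [M1 K1]; [lra|]; destruct (H' (e / 2)) as [M2 K2]; [lra|].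
exists (Rmax M1 M2); intros a b Ha Hb.
Rmax_bounds N1 N2 M1 M2.
specialize (K1 a b ltac:(lra) ltac:(lra)); specialize (K2 a b ltac:(lra) ltac:(lra)).
rewrite RI_plus; [|apply cont_everywhere, HG|apply cont_everywhere, HG'].
match goal with |- norm ?t <= _ => replace t with
  (plus (minus (RI G (- a) b) L) (minus (RI G' (- a) b) L')) by mring V end.
norm_split V; lra.
Qed.

Lemma is_line_scal (k : C) G L : (forall s, continuous G s) ->
  is_line G L -> is_line (fun s => cscal k (G s)) (cscal k L).
Proof.
intros HG H e He; assert (Hk := Cmod_ge_0 k).
destruct (H (e / (Cmod k + 1))) as [M1 K1]; [apply Rdiv_lt_0_compat; lra|].
exists M1; intros a b Ha Hb; specialize (K1 a b Ha Hb).
rewrite RI_scal; [|apply cont_everywhere, HG].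
match goal with |- norm ?t <= _ => replace t with
  (cscal k (minus (RI G (- a) b) L)) by mring V end.
rewrite (norm_scal_C (X := V)).
apply Rle_trans with ((Cmod k + 1) * (e / (Cmod k + 1))); [|right; field; lra].
apply Rmult_le_compat; [exact Hk|apply norm_ge_0|lra|exact K1].
Qed.

Lemma continuous_scalC (k : C) G s : continuous G s ->
  continuous (fun s => cscal k (G s)) s.
Proof.
intros H; apply continuous_norm; intros e He; assert (Hk := Cmod_ge_0 k).
destruct (norm_continuous G s H (e / (Cmod k + 1))) as [d [Hd H1]]; [apply Rdiv_lt_0_compat; lra|].
exists d; split; [exact Hd|]; intros y Hy; specialize (H1 y Hy).
match goal with |- norm ?t < _ => replace t with
  (cscal k (minus (G y) (G s))) by mring V end.
rewrite (norm_scal_C (X := V)).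
apply Rle_lt_trans with ((Cmod k) * (e / (Cmod k + 1))); [apply Rmult_le_compat_l; lra|].
apply Rlt_le_trans with ((Cmod k + 1) * (e / (Cmod k + 1))); [|right; field; lra].
apply Rmult_lt_compat_r; [apply Rdiv_lt_0_compat; lra|lra].
Qed.

Lemma continuous_plusV G G' s : continuous G s -> continuous G' s ->
  continuous (fun s => plus (G s) (G' s)) s.
Proof. intros H H'; apply (@continuous_plus _ R_AbsRing (toR V)); assumption. Qed.

(** The substitution r = e^s. Its Jacobian e^s and the factor [cis phi] of the ray combine into the
    factor [cexp (s, phi)] of [G], that is dz = e^w dw. *)
Lemma ray_int_line (phi : R) (g : C -> V) G L :
  (forall s, G s = cscal (cexp (s, phi)) (g (cexp (s, phi)))) ->
  (forall s, continuous G s) -> is_line G L -> ray_int phi g = L.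
Proof.
intros E HG HL; unfold ray_int.
apply (@is_RInt_gen_unique (toR V) (at_right 0) (Rbar_locally p_infty) _ _).
unfold is_RInt_gen, filterlimi, filter_le, filtermapi; intros Q [eps HQ].
destruct (HL (eps / 2)) as [M0 HM]; [assert (H := cond_pos eps); lra|].
apply (Filter_prod _ _ _ (fun a => 0 < a < exp (- M0)) (fun b => exp M0 < b)).
- exists (mkposreal _ (exp_pos (- M0))); intros y Hy Hy0; split; [exact Hy0|].
  change (Rabs (y - 0) < exp (- M0)) in Hy; rewrite Rabs_pos_eq in Hy; lra.
- exists (exp M0); auto.
- intros a b [Ha1 Ha2] Hb; simpl.
  assert (Hb0 : 0 < b) by (assert (H := exp_pos M0); lra).
  exists (RI G (ln a) (ln b)); split.
  + apply (@is_RInt_ext (toR V) (fun r => cscal (RtoC (/ r)) (G (ln r)))).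
    * intros r Hr.
      assert (Hr0 : 0 < r).
      { destruct Hr as [Hr _]; eapply Rlt_trans; [|exact Hr]; apply Rmin_pos; assumption. }
      rewrite E cexp_polar exp_ln; [|exact Hr0].
      assert (Hr' : RtoC r <> RtoC 0) by (intros H; injection H; lra).
      rewrite RtoC_inv; [|lra].
      set (v := g _); mreduce V; Cnorm; field; exact Hr'.
    * apply (@is_RInt_comp (toR V) G ln Rinv).
      -- intros x _; apply HG.
      -- intros x Hx; assert (Hx0 : 0 < x).
         { destruct Hx as [Hx _]; eapply Rlt_le_trans; [|exact Hx]; apply Rmin_pos; assumption. }
         split; [apply is_derive_ln, Hx0|].
         apply: continuous_Rinv; lra.
  + apply HQ; apply: norm_compat1.
    rewrite -(Ropp_involutive (ln a)).
    eapply Rle_lt_trans; [apply HM|assert (H := cond_pos eps); lra].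
    * apply Ropp_le_cancel; rewrite Ropp_involutive; left; rewrite -(ln_exp (- M0)).
      apply ln_increasing; assumption.
    * left; rewrite -(ln_exp M0); apply ln_increasing; [apply exp_pos|exact Hb].
Qed.

End LineIntegrals.

(** * Poisson kernels *)

Section CdiffAlgebra.
Context {V : CompleteNormedModule C_AbsRing}.

Lemma cdiff_plus (f g : C -> V) (w : C) (D E : V) : cdiff f w D -> cdiff g w E ->
  cdiff (fun z => plus (f z) (g z)) w (plus D E).
Proof.
intros Hf Hg e He.
destruct (Hf (e / 2)) as [d1 [Hd1 K1]]; [lra|]; destruct (Hg (e / 2)) as [d2 [Hd2 K2]]; [lra|].
exists (Rmin d1 d2); split; [apply Rmin_pos; assumption|]; intros u Hu.
Rmin_bounds M1 M2 d1 d2.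
specialize (K1 u ltac:(lra)); specialize (K2 u ltac:(lra)).
match goal with |- norm ?t <= _ => replace t with
  (plus (minus (minus (f (Cplus w u)) (f w)) (cscal u D))
        (minus (minus (g (Cplus w u)) (g w)) (cscal u E))) by mring V end.
norm_split V; lra.
Qed.

Lemma cdiff_scal (k : C) (f : C -> V) (w : C) (D : V) : cdiff f w D ->
  cdiff (fun z => cscal k (f z)) w (cscal k D).
Proof.
intros Hf e He; assert (Hk := Cmod_ge_0 k).
destruct (Hf (e / (Cmod k + 1))) as [d1 [Hd1 K1]]; [apply Rdiv_lt_0_compat; lra|].
exists d1; split; [exact Hd1|]; intros u Hu; specialize (K1 u Hu).
match goal with |- norm ?t <= _ => replace t with
  (cscal k (minus (minus (f (Cplus w u)) (f w)) (cscal u D)))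
  by mring V end.
rewrite (norm_scal_C (X := V)); assert (Hu0 := Cmod_ge_0 u).
apply Rle_trans with ((Cmod k + 1) * (e / (Cmod k + 1) * Cmod u)); [|right; field; lra].
apply Rmult_le_compat; [exact Hk|apply norm_ge_0|lra|exact K1].
Qed.

Lemma cdiff_ext (f g : C -> V) (w : C) (D E : V) :
  (forall z, f z = g z) -> D = E -> cdiff f w D -> cdiff g w E.
Proof.
intros Hfg <- Hf e He; destruct (Hf e He) as [d [Hd K]]; exists d; split; [exact Hd|].
intros u Hu; rewrite -!Hfg; apply K, Hu.
Qed.

(** For vertical sides on which the integrand tends to a nonzero operator: such a side leaves its
    length times the limit. *)
Lemma RI_near_const (f : R -> V) (D : V) (a b M : R) : a <= b -> cont_on f a b ->
  (forall x, a <= x <= b -> norm (minus (f x) D) <= M) ->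
  norm (minus (RI f a b) (cscal (RtoC (b - a)) D)) <= M * (b - a).
Proof.
intros Hab Hf HM.
assert (Hc : cont_on (fun _ => opp D) a b) by (intros x _; apply continuous_const).
assert (E := RI_plus f (fun _ => opp D) a b Hf Hc); rewrite RI_const in E.
match goal with |- norm ?t <= _ => replace t with (RI (fun x => plus (f x) (opp D)) a b) end.
2:{ rewrite E; mring V. }
apply RI_norm_const; [exact Hab| |exact HM].
intros x Hx; apply continuous_plusV; [apply Hf, Hx|apply continuous_const].
Qed.

End CdiffAlgebra.

(** The scalar l (l - z)^(-1) with l = e^v and z = e^w, that is, [logres v] with A replaced by the
    number z. It tends to 0 as the real part of [w] goes to infinity and to 1 as it goes to minus
    infinity. *)
Definition pole_quot (v w : C) : C := Cdiv (cexp v) (Cminus (cexp v) (cexp w)).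

Lemma exp_1_ge_2 : 2 <= exp 1.
Proof. assert (H := exp_ineq1_le 1); lra. Qed.

Lemma cexp_gap (a b : C) : fst a + 1 <= fst b ->
  exp (fst b) / 2 <= Cmod (Cminus (cexp a) (cexp b)).
Proof.
intros H.
assert (Hb : 2 * exp (fst a) <= exp (fst b)).
{ apply Rle_trans with (exp (fst a + 1)).
  - rewrite exp_plus; assert (H1 := exp_1_ge_2); assert (H2 := exp_pos (fst a)); nra.
  - destruct H as [H|<-]; [left; apply exp_increasing, H|right; reflexivity]. }
assert (Hp := exp_pos (fst a)).
assert (T := Cmod_reverse_triangle (cexp a) (cexp b)); rewrite !Cmod_cexp in T.
apply Rabs_le_between in T; lra.
Qed.

Lemma Cmod_Cdiv_le (a b : C) (m : R) : 0 < m -> m <= Cmod b -> Cmod (Cdiv a b) <= Cmod a / m.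
Proof.
intros Hm Hb.
rewrite Cmod_div; [|apply Cmod_gt_0; lra].
apply Rmult_le_compat_l; [apply Cmod_ge_0|apply Rinv_le_contravar; assumption].
Qed.

Lemma pole_quot_right (v w : C) : fst v + 1 <= fst w ->
  Cmod (pole_quot v w) <= 2 * exp (- (fst w - fst v)).
Proof.
intros H; assert (Hg := cexp_gap v w H); assert (Hp := exp_pos (fst w)).
eapply Rle_trans; [apply (Cmod_Cdiv_le _ _ (exp (fst w) / 2)); lra|].
rewrite Cmod_cexp; replace (- (fst w - fst v)) with (fst v + - fst w) by ring.
rewrite exp_plus exp_Ropp; right; field; lra.
Qed.

Lemma pole_quot_left (v w : C) : fst w + 1 <= fst v ->
  Cmod (Cminus (pole_quot v w) (RtoC 1)) <= 2 * exp (- (fst v - fst w)).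
Proof.
intros H; assert (Hg := cexp_gap w v H); assert (Hp := exp_pos (fst v)).
assert (Hn : Cminus (cexp v) (cexp w) <> RtoC 0).
{ intros E; replace (Cminus (cexp w) (cexp v)) with (Copp (Cminus (cexp v) (cexp w))) in Hg by ring.
  rewrite Cmod_opp E Cmod_0 in Hg; lra. }
assert (Hn' : Cminus (cexp w) (cexp v) <> RtoC 0).
{ intros E; rewrite E Cmod_0 in Hg; lra. }
replace (Cminus (pole_quot v w) (RtoC 1)) with (Copp (Cdiv (cexp w) (Cminus (cexp w) (cexp v)))).
2:{ unfold pole_quot; field; split; assumption. }
rewrite Cmod_opp.
eapply Rle_trans; [apply (Cmod_Cdiv_le _ _ (exp (fst v) / 2)); lra|].
rewrite Cmod_cexp; replace (- (fst v - fst w)) with (fst w + - fst v) by ring.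
rewrite exp_plus exp_Ropp; right; field; lra.
Qed.

Lemma exp_small (e : R) : 0 < e -> exists M0, forall M, M0 <= M -> 2 * exp (- M) <= e.
Proof.
intros He; destruct (exp_tail_small 2 1 e) as [M0 [_ H]]; [lra|lra|exact He|].
exists M0; intros M HM; specialize (H M HM); rewrite Rmult_1_l in H; lra.
Qed.

Section PoleOperators.
Context {X : CompleteNormedModule C_AbsRing}.
Notation BX := (bddop_CompleteNormedModule X).

Lemma is_linear_id_fun : is_linear (fun x : X => x).
Proof. apply is_linear_id. Qed.
Definition bddop_id : bddop X := BddOp is_linear_id_fun.

Lemma comp_id_l (T : bddop X) : bddop_comp bddop_id T = T.
Proof. apply bddop_ext; intros x; reflexivity. Qed.

Lemma norm_bddop_id : norm bddop_id <= 1.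
Proof. apply opnorm_le; [lra|]; intros x; simpl; lra. Qed.

(** The function 1 - [pole_quot v] is z |-> e^z (e^z - a)^(-1) with a = e^v, so its multiple of the
    identity satisfies the criterion [cdiff_resolvent_family]; composition with [T] then gives the
    operator coefficient. *)
Lemma cdiff_pole (T : bddop X) (v w : C) : cexp w <> cexp v ->
  exists D, cdiff (fun z => cscal (Cminus (pole_quot v z) (RtoC 1)) T : BX) w D.
Proof.
intros Hne.
set (m := Cmod (Cminus (cexp w) (cexp v))).
assert (Hm : 0 < m).
{ apply Cmod_gt_0, Cminus_eq_contra, Hne. }
pose (G := fun z => cscal (Cminus (RtoC 1) (pole_quot v z)) bddop_id : bddop X).
assert (Hp := exp_pos (fst w)).
(* Since |e^u - 1| <= 4 |u|, the second term keeps e^(w + u) within m / 2 of e^w, and the first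
   gives |e^(w + u)| <= 3 |e^w|. *)
set (d := Rmin (/ 2) (m / (8 * exp (fst w)))).
assert (Hd : 0 < d) by (apply Rmin_pos; [lra|apply Rdiv_lt_0_compat; lra]).
assert (Hclose : forall u, Cmod u < d -> m / 2 <= Cmod (Cminus (cexp (Cplus w u)) (cexp v))
  /\ Cmod (cexp (Cplus w u)) <= 3 * exp (fst w)).
{ intros u Hu; Rmin_bounds D1 D2 (/ 2) (m / (8 * exp (fst w))); fold d in D1, D2.
  assert (E1 := cexp_minus_1 u ltac:(lra)).
  assert (Hu0 := Cmod_ge_0 u).
  assert (E2 : Cmod (Cminus (cexp (Cplus w u)) (cexp w)) <= 4 * exp (fst w) * Cmod u).
  { rewrite cexp_plus.
    replace (Cminus (Cmult (cexp w) (cexp u)) (cexp w)) with (Cmult (cexp w) (Cminus (cexp u) (RtoC 1))) by ring.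
    rewrite Cmod_mult Cmod_cexp; nra. }
  assert (E3 : exp (fst w) * Cmod u <= m / 8).
  { apply Rle_trans with (exp (fst w) * (m / (8 * exp (fst w)))); [|right; field; lra].
    apply Rmult_le_compat_l; lra. }
  split.
  - assert (T1 := Cmod_triangle (Copp (Cminus (cexp (Cplus w u)) (cexp w))) (Cminus (cexp (Cplus w u)) (cexp v))).
    rewrite Cmod_opp in T1.
    replace (Cplus (Copp (Cminus (cexp (Cplus w u)) (cexp w))) (Cminus (cexp (Cplus w u)) (cexp v)))
      with (Cminus (cexp w) (cexp v)) in T1 by ring.
    fold m in T1; lra.
  - assert (T1 := Cmod_triangle (Cminus (cexp (Cplus w u)) (cexp w)) (cexp w)).
    replace (Cplus (Cminus (cexp (Cplus w u)) (cexp w)) (cexp w)) with (cexp (Cplus w u)) in T1 by ring.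
    rewrite (Cmod_cexp w) in T1; nra. }
assert (Hnz : forall z : C, 0 < Cmod (Cminus (cexp z) (cexp v)) -> Cminus (cexp v) (cexp z) <> RtoC 0).
{ intros z Hz E; replace (Cminus (cexp z) (cexp v)) with (Copp (Cminus (cexp v) (cexp z))) in Hz by ring.
  rewrite Cmod_opp E Cmod_0 in Hz; lra. }
assert (HG : exists D, cdiff (G : C -> BX) w D).
{ eexists; apply (cdiff_resolvent_family G w d (3 * exp (fst w) / (m / 2) * 1) Hd).
  - intros u Hu; destruct (Hclose u Hu) as [H1 H2]; unfold G.
    rewrite (norm_scal_C (X := BX)).
    assert (Hz := Hnz (Cplus w u) ltac:(lra)).
    replace (Cminus (RtoC 1) (pole_quot v (Cplus w u)))
      with (Cdiv (cexp (Cplus w u)) (Cminus (cexp (Cplus w u)) (cexp v))).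
    2:{ unfold pole_quot; field; split; [exact Hz|apply Cmod_gt_0; lra]. }
    apply Rmult_le_compat; [apply Cmod_ge_0|apply (norm_ge_0 (V := BX))| |apply norm_bddop_id].
    eapply Rle_trans; [apply (Cmod_Cdiv_le _ _ (m / 2)); lra|].
    apply Rmult_le_compat_r; [left; apply Rinv_0_lt_compat; lra|exact H2].
  - intros u Hu; destruct (Hclose u Hu) as [H1 H2]; unfold G.
    assert (Hz := Hnz (Cplus w u) ltac:(lra)); assert (Hz' := Hnz w Hm).
    rewrite !comp_expand; rewrite comp_id_l.
    unfold pole_quot; rewrite cexp_plus in Hz |- *.
    mreduce BX; Cnorm; field; split; assumption. }
destruct HG as [D HD].
exists (cscal (RtoC (-1)) (plus (bddop_comp D T) (bddop_comp (G w) zero))).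
apply (cdiff_ext (fun z => cscal (RtoC (-1)) (bddop_comp (G z) T : BX))) with
  (D := cscal (RtoC (-1)) (plus (bddop_comp D T) (bddop_comp (G w) zero) : BX)).
- intros z; unfold G; rewrite comp_scal_l; rewrite comp_id_l; mring BX.
- reflexivity.
- apply cdiff_scal, (cdiff_comp G (fun _ => T)); [exact HD|apply cdiff_const].
Qed.

End PoleOperators.

(** e^u + e^(-u) - 2 is the square of e^(u/2) - e^(-u/2), and the latter is at least |u| in modulus
    because its derivative with respect to u / 2 is at least 2. *)
Lemma exp_sum_ge (u : R) : 2 + u ^ 2 <= exp u + exp (- u).
Proof.
destruct (MVT_gen (fun t => exp t - exp (- t)) 0 (u / 2) (fun t => exp t + exp (- t))) as [t [_ Ht]].
- intros y _; auto_derive; [exact I|ring].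
- intros y _; apply: derivable_continuous_pt; eexists.
  apply is_derive_Reals; auto_derive; [exact I|reflexivity].
- rewrite Ropp_0 exp_0 in Ht.
  assert (E1 : exp (u / 2) * exp (u / 2) = exp u) by (rewrite -exp_plus; f_equal; field).
  assert (E2 : exp (- (u / 2)) * exp (- (u / 2)) = exp (- u)) by (rewrite -exp_plus; f_equal; field).
  assert (E3 : exp (u / 2) * exp (- (u / 2)) = 1) by (rewrite -exp_plus Rplus_opp_r exp_0; reflexivity).
  assert (E4 : exp t * exp (- t) = 1) by (rewrite -exp_plus Rplus_opp_r exp_0; reflexivity).
  assert (P1 := exp_pos t); assert (P2 := exp_pos (- t)).
  set (d := exp (u / 2) - exp (- (u / 2))) in *.
  assert (Hd : d ^ 2 = exp u + exp (- u) - 2) by (unfold d; nra).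
  set (f := exp t + exp (- t)) in *.
  assert (Hf : 2 <= f).
  { assert (Q := pow2_ge_0 (exp t - exp (- t))); apply Rnot_lt_le; intros Hlt.
    assert (f * f = (exp t - exp (- t)) ^ 2 + 4) by (unfold f; nra).
    assert (0 < f) by (unfold f; lra); nra. }
  assert (Hd' : d = f * (u / 2)) by lra.
  assert (4 * (u / 2) ^ 2 <= d ^ 2).
  { rewrite Hd'; replace ((f * (u / 2)) ^ 2) with (f ^ 2 * (u / 2) ^ 2) by ring.
    apply Rmult_le_compat_r; [apply pow2_ge_0|nra]. }
  lra.
Qed.

(** At z = e^w this is sin g / (2 pi (cosh (w - s) - cos g)), the Poisson kernel of a strip of width
    pi at distance [g] from its boundary. The form as a difference of simple poles is the one into
    which A can be inserted. *)
Definition poisson (g s : R) (z : C) : C :=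
  Cmult inv_2ipi (Cminus (Cdiv (cexp (s, - g)) (Cminus (cexp (s, - g)) z))
                         (Cdiv (cexp (s, g)) (Cminus (cexp (s, g)) z))).

Lemma inv_2ipi_neq : Cmult (RtoC (2 * PI)) Ci <> RtoC 0.
Proof.
unfold Cmult, RtoC, Ci; simpl; intros H; injection H; assert (HP := PI_RGT_0); lra.
Qed.

Lemma poisson_denominator (g u y : R) : 0 < g <= 1 -> Rabs y <= g / 2 ->
  (u ^ 2 + g ^ 2) / 8 <= (exp u + exp (- u)) * cos y - 2 * cos g.
Proof.
intros Hg Hy.
assert (HP := PI_4); assert (H2 := PI2_1).
assert (Hu := exp_sum_ge u).
assert (Hc : cos (g / 2) <= cos y).
{ rewrite (cos_Rabs y).
  assert (H0 := Rabs_pos y); apply cos_decr_1; lra. }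
assert (Hq := cos_quadratic (g / 2)).
assert (E1 : cos g = 2 * cos (g / 2) * cos (g / 2) - 1).
{ rewrite -cos_2a_cos; f_equal; field. }
assert (E2 : cos (g / 2) = 1 - 2 * sin (g / 4) * sin (g / 4)).
{ rewrite -cos_2a_sin; f_equal; field. }
assert (Hs := sin_quadratic (g / 4)).
assert (Hs' : Rabs (sin (g / 4) - g / 4) <= (g / 4) ^ 2 / 2) by (apply Hs; rewrite Rabs_pos_eq; lra).
apply Rabs_le_between in Hs'.
set (s := sin (g / 4)) in *; set (c := cos (g / 2)) in *.
assert (Hs1 : g / 8 <= s) by nra.
assert (Hc1 : g ^ 2 / 32 <= 1 - c) by nra.
assert (Hc2 : 7 / 8 <= c) by nra.
assert (Hu2 := pow2_ge_0 u).
(* With c = cos (g / 2) this equals u^2 c + 2 (1 - c) (1 + 2 c), and 1 - c = 2 sin (g / 4)^2 is of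
   order g^2. *)
apply Rle_trans with ((2 + u ^ 2) * c - 2 * cos g).
- rewrite E1; nra.
- assert (0 <= exp u + exp (- u)) by lra.
  apply Rplus_le_compat_r; apply Rmult_le_compat; lra.
Qed.

Lemma cexp_neq_of_cos (v w : C) : cos (snd v) <> cos (snd w) -> cexp v <> cexp w.
Proof.
intros Hc E.
assert (Em : exp (fst v) = exp (fst w)) by (rewrite -!Cmod_cexp E; reflexivity).
apply Hc; assert (E1 := f_equal fst E); unfold cexp in E1; simpl in E1; rewrite Em in E1.
assert (Hp := exp_pos (fst w)); nra.
Qed.

Lemma cos_lt_of_Rabs (g y : R) : g <= 1 -> Rabs y < g -> cos g < cos y.
Proof.
intros Hg Hy; assert (HP := PI2_1); assert (H0 := Rabs_pos y).
rewrite (cos_Rabs y); apply cos_decreasing_1; lra.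
Qed.

Lemma poisson_poles (g s : R) (w : C) : g <= 1 -> Rabs (snd w) < g ->
  Cminus (cexp (s, - g)) (cexp w) <> RtoC 0 /\ Cminus (cexp (s, g)) (cexp w) <> RtoC 0.
Proof.
intros Hg Hw; assert (Hc := cos_lt_of_Rabs g (snd w) Hg Hw).
split; apply Cminus_eq_contra, cexp_neq_of_cos; simpl; rewrite ?cos_neg; lra.
Qed.

(** Half of the width is given away so that the denominator stays of size (x - s)^2 + g^2, away from
    the poles at height g and -g. The constant is 8 = (1 / 2) * 2 * 8, from 1 / (2 pi) <= 1 / 2, 2
    sin g <= 2 g and [poisson_denominator]. *)
Lemma poisson_bound (g s : R) (w : C) : 0 < g <= 1 -> Rabs (snd w) <= g / 2 ->
  Cmod (poisson g s (cexp w)) <= 8 * g / ((fst w - s) ^ 2 + g ^ 2).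
Proof.
intros Hg Hw; destruct w as [x y]; simpl in Hw.
assert (Hden := poisson_denominator g (x - s) y Hg Hw).
set (N := Cminus (Cplus (cexp (s - x, - y)) (cexp (x - s, y))) (RtoC (2 * cos g))).
assert (Hre : fst N = (exp (x - s) + exp (- (x - s))) * cos y - 2 * cos g).
{ unfold N, Cminus, Cplus, Copp, RtoC, cexp; simpl; rewrite cos_neg.
  replace (s - x) with (- (x - s)) by ring; ring. }
assert (Hp : 0 < (x - s) ^ 2 + g ^ 2) by (assert (H1 := pow2_ge_0 (x - s)); assert (H2 := pow_lt g 2); lra).
assert (HN : ((x - s) ^ 2 + g ^ 2) / 8 <= Cmod N).
{ eapply Rle_trans; [exact Hden|]; rewrite -Hre.
  eapply Rle_trans; [apply Rle_abs|]; eapply Rle_trans; [|apply Rmax_Cmod]; apply Rmax_l. }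
assert (HN0 : N <> RtoC 0) by (apply Cmod_gt_0; lra).
assert (HPI := PI_4); assert (HPI2 := PI2_1).
destruct (poisson_poles g s (x, y)) as [N1 N2]; [lra|simpl; lra|].
assert (E : poisson g s (cexp (x, y)) = Cmult inv_2ipi (Cdiv (0, 2 * sin g) N)).
{ unfold poisson; f_equal.
  assert (Ea : cexp (s, - g) = Cmult (cexp (s, 0)) (cexp (0, - g))).
  { rewrite -cexp_plus; f_equal; unfold Cplus; simpl; f_equal; ring. }
  assert (Eb : cexp (s, g) = Cmult (cexp (s, 0)) (cexp (0, g))).
  { rewrite -cexp_plus; f_equal; unfold Cplus; simpl; f_equal; ring. }
  assert (Ec : Cmult (cexp (0, g)) (cexp (0, - g)) = RtoC 1).
  { rewrite -cexp_plus -cexp_0; f_equal; unfold Cplus, RtoC; simpl; f_equal; ring. }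
  assert (Ed : Cminus (cexp (0, g)) (cexp (0, - g)) = (0, 2 * sin g)).
  { unfold cexp, Cminus, Cplus, Copp; simpl; rewrite exp_0 cos_neg sin_neg; f_equal; ring. }
  assert (Ee : Cplus (cexp (0, g)) (cexp (0, - g)) = RtoC (2 * cos g)).
  { unfold cexp, Cplus, RtoC; simpl; rewrite exp_0 cos_neg sin_neg; f_equal; ring. }
  assert (Ef : Cmult (cexp (s - x, - y)) (cexp (x, y)) = cexp (s, 0)).
  { rewrite -cexp_plus; f_equal; unfold Cplus; simpl; f_equal; ring. }
  assert (Eg : Cmult (cexp (x - s, y)) (cexp (s, 0)) = cexp (x, y)).
  { rewrite -cexp_plus; f_equal; unfold Cplus; simpl; f_equal; ring. }
  rewrite -Ed; unfold N in *; rewrite -Ee in HN0 |- *.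
  rewrite Ea in N1 |- *; rewrite Eb in N2 |- *.
  set (z := cexp (x, y)) in *; set (S := cexp (s, 0)) in *.
  set (p := cexp (0, g)) in *; set (q := cexp (0, - g)) in *.
  set (a := cexp (s - x, - y)) in *; set (b := cexp (x - s, y)) in *.
  (* The product of the two poles' denominators is S z N: here p q = 1, and a z = S, b S = z express
     e^(s - w) and e^(w - s) through S and z. *)
  assert (Enum : Cmult (Cmult (Cminus (Cmult S q) z) (Cminus (Cmult S p) z)) (RtoC 1)
     = Cmult (Cmult S z) (Cminus (Cplus a b) (Cplus p q))).
  { replace (Cmult (Cmult S z) (Cminus (Cplus a b) (Cplus p q))) with
      (Cminus (Cplus (Cmult S (Cmult a z)) (Cmult z (Cmult b S))) (Cmult (Cmult S z) (Cplus p q))) by ring.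
    rewrite Ef Eg.
    replace (Cmult (Cmult (Cminus (Cmult S q) z) (Cminus (Cmult S p) z)) (RtoC 1)) with
      (Cminus (Cplus (Cmult (Cmult S S) (Cmult p q)) (Cmult z z)) (Cmult (Cmult S z) (Cplus p q))) by ring.
    rewrite Ec; ring. }
  transitivity (Cdiv (Cmult (Cmult S z) (Cminus p q)) (Cmult (Cmult (Cminus (Cmult S q) z) (Cminus (Cmult S p) z)) (RtoC 1))).
  - field; split; assumption.
  - rewrite Enum; field; repeat split; try assumption; apply cexp_neq_0. }
rewrite E Cmod_mult.
assert (Hinv : Cmod inv_2ipi = / (2 * PI)).
{ unfold inv_2ipi; rewrite Cmod_inv; [|apply inv_2ipi_neq].
  rewrite Cmod_mult Cmod_R Rabs_pos_eq; [|lra].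
  rewrite Cmod_Ci Rmult_1_r; reflexivity. }
rewrite Hinv.
assert (Hsin : Cmod (0, 2 * sin g) <= 2 * g).
{ eapply Rle_trans; [apply Cmod_le_sum|]; rewrite Rabs_R0 Rabs_mult (Rabs_pos_eq 2); [|lra].
  assert (H := Rabs_sin_le g); rewrite (Rabs_pos_eq g) in H; lra. }
assert (H1 : Cmod (Cdiv (0, 2 * sin g) N) <= 2 * g / (((x - s) ^ 2 + g ^ 2) / 8)).
{ eapply Rle_trans; [apply (Cmod_Cdiv_le _ _ (((x - s) ^ 2 + g ^ 2) / 8)); [lra|exact HN]|].
  apply Rmult_le_compat_r; [left; apply Rinv_0_lt_compat; lra|exact Hsin]. }
simpl fst.
apply Rle_trans with (/ 2 * (2 * g / (((x - s) ^ 2 + g ^ 2) / 8))).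
- apply Rmult_le_compat; [left; apply Rinv_0_lt_compat; lra|apply Cmod_ge_0| |exact H1].
  apply Rinv_le_contravar; lra.
- right; field; lra.
Qed.

Lemma comp_minus_r {X : CompleteNormedModule C_AbsRing} (S T U : bddop X) :
  bddop_comp S (minus T U) = minus (bddop_comp S T) (bddop_comp S U).
Proof. unfold minus; rewrite comp_plus_r comp_opp_r; reflexivity. Qed.

Lemma cos_le_of_between (t y : R) : 0 <= t <= PI -> t <= y <= 2 * PI - t -> cos y <= cos t.
Proof.
intros Ht Hy; destruct (Rle_dec y PI) as [Hyp|Hyp]; [apply cos_decr_1; lra|].
rewrite -(cos_neg y) -(cos_period (- y) 1); simpl INR; apply cos_decr_1; lra.
Qed.

(** * The functional calculus of one Poisson kernel *)

Section PoissonCalculus.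
Context {X : CompleteNormedModule C_AbsRing}.
Variable A : operator X.
Hypothesis hA0 : omega_of A = Finite 0.
Notation BX := (bddop_CompleteNormedModule X).
Notation S := (logres A).

Lemma logres_pole (v w : C) : cexp v <> cexp w ->
  resolvent_set A (cexp w) -> resolvent_set A (cexp v) ->
  bddop_comp (S w) (S v) = minus (cscal (pole_quot v w) (S w))
    (cscal (Cminus (pole_quot v w) (RtoC 1)) (S v)).
Proof.
intros Hne Hw Hv.
assert (Hn : Cminus (cexp v) (cexp w) <> RtoC 0).
{ apply Cminus_eq_contra, Hne. }
assert (E := logres_product A w v Hw Hv).
transitivity (cscal (Cinv (Cminus (cexp v) (cexp w)))
  (cscal (Cminus (cexp v) (cexp w)) (bddop_comp (S w) (S v)))).
{ mreduce BX; Cnorm; field; exact Hn. }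
rewrite E; unfold pole_quot; mreduce BX; Cnorm; field; exact Hn.
Qed.

Variables (g s0 : R).
Hypothesis Hg : 0 < g <= 1.

Definition poisson_op : bddop X :=
  cscal inv_2ipi (minus (S (s0, - g)) (S (s0, g))).

Let Sm := S (s0, - g).
Let Sp := S (s0, g).
Let D := minus Sm Sp.
(** Partial fractions split the integrand p(e^w) S(w) into [Z] and [Q], up to the factor 1 / (2 i
    pi). [Z] contains S(w) but not the kernel, and is analytic off the axis; [Q] contains S only at
    the two fixed points, and is analytic for |Im w| < g. *)
Let Z (w : C) : BX := bddop_comp (S w) D.
Let Q (w : C) : BX := minus (cscal (Cminus (pole_quot (s0, - g) w) (RtoC 1)) Sm)
  (cscal (Cminus (pole_quot (s0, g) w) (RtoC 1)) Sp).

Let Hgpi : g < PI / 2.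
Proof. assert (H := PI2_1); lra. Qed.

Let cosg : cos g < 1.
Proof. rewrite -cos_0; apply cos_decreasing_1; lra. Qed.

Let rsp : resolvent_set A (cexp (s0, g)).
Proof. apply off_axis_resolvent_set; try assumption; exact cosg. Qed.

Let rsm : resolvent_set A (cexp (s0, - g)).
Proof. apply off_axis_resolvent_set; try assumption; simpl; rewrite cos_neg; exact cosg. Qed.

Let Z_eq (w : C) : cos (snd w) < 1 -> cexp (s0, - g) <> cexp w -> cexp (s0, g) <> cexp w ->
  Z w = minus (cscal (Cminus (pole_quot (s0, - g) w) (pole_quot (s0, g) w)) (S w)) (Q w).
Proof.
intros Hw H1 H2; assert (Hr := off_axis_resolvent_set A hA0 w Hw).
unfold Z, Q, D; rewrite comp_minus_r; unfold Sm, Sp.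
rewrite (logres_pole (s0, - g) w) // (logres_pole (s0, g) w) //.
mring BX.
Qed.

Let inner_neq (w : C) : Rabs (snd w) < g ->
  cexp (s0, - g) <> cexp w /\ cexp (s0, g) <> cexp w.
Proof.
intros Hw.
assert (Hc := cos_lt_of_Rabs g (snd w) (proj2 Hg) Hw).
split; apply cexp_neq_of_cos; simpl; rewrite ?cos_neg; lra.
Qed.

Let cdiff_Z (w : C) : cos (snd w) < 1 -> exists E, cdiff Z w E.
Proof.
intros Hw; eexists; apply (cdiff_comp S (fun _ => D)); [|apply cdiff_const].
apply cdiff_logres; assumption.
Qed.

Let cdiff_Q (w : C) : Rabs (snd w) < g -> exists E, cdiff Q w E.
Proof.
intros Hw; destruct (inner_neq w Hw) as [H1 H2].
destruct (cdiff_pole Sm (s0, - g) w) as [D1 HD1]; [congruence|].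
destruct (cdiff_pole Sp (s0, g) w) as [D2 HD2]; [congruence|].
exists (plus D1 (cscal (RtoC (-1)) D2)).
apply (cdiff_ext (fun z => plus (cscal (Cminus (pole_quot (s0, - g) z) (RtoC 1)) Sm : BX)
  (cscal (RtoC (-1)) (cscal (Cminus (pole_quot (s0, g) z) (RtoC 1)) Sp : BX))))
  with (D := plus D1 (cscal (RtoC (-1)) D2)).
- intros z; unfold Q; mring BX.
- reflexivity.
- apply cdiff_plus; [exact HD1|apply cdiff_scal; exact HD2].
Qed.

Definition poisson_line (t s : R) : BX :=
  cscal (poisson g s0 (cexp (s, t))) (S (s, t)).

Let poisson_line_eq (t s : R) : 0 < Rabs t < g ->
  poisson_line t s = cscal inv_2ipi (plus (Z (s, t)) (Q (s, t))).
Proof.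
intros Ht; destruct (inner_neq (s, t)) as [H1 H2]; [simpl; lra|].
assert (Hw : cos t < 1).
{ rewrite (cos_Rabs t).
  rewrite -cos_0; apply cos_decreasing_1; lra. }
rewrite Z_eq //; unfold poisson_line, poisson, pole_quot.
mring BX.
Qed.

Let off_axis (t : R) : 0 < Rabs t < g -> cos t < 1.
Proof. intros Ht; rewrite cos_Rabs -cos_0; apply cos_decreasing_1; lra. Qed.

Let Z_cont (t s : R) : 0 < Rabs t < g -> continuous (fun s => Z (s, t)) s.
Proof.
intros Ht; apply ccont_horizontal; destruct (cdiff_Z (s, t)) as [E HE]; [apply off_axis, Ht|].
apply (cdiff_ccont _ _ _ HE).
Qed.

Let Q_cont (t s : R) : Rabs t < g -> continuous (fun s => Q (s, t)) s.
Proof.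
intros Ht; apply ccont_horizontal; destruct (cdiff_Q (s, t)) as [E HE]; [exact Ht|].
apply (cdiff_ccont _ _ _ HE).
Qed.

Lemma continuous_poisson_line (t s : R) : 0 < Rabs t < g -> continuous (poisson_line t) s.
Proof.
intros Ht.
apply (continuous_ext (fun s => cscal inv_2ipi (plus (Z (s, t)) (Q (s, t))))).
{ intros x; symmetry; apply poisson_line_eq, Ht. }
apply continuous_scalC, continuous_plusV; [apply Z_cont, Ht|apply Q_cont; lra].
Qed.

Lemma poisson_decay : exists c, 0 < c /\ forall w, Rabs (snd w) <= g / 2 ->
  Cmod (poisson g s0 (cexp w)) <= c * exp (- Rabs (fst w)).
Proof.
(* The first term serves where |u| >= 1, by the limits 0 and 1 of the two pole quotients, which
   cancel in the difference. The second serves where |u| <= 1, since there e * e^(-|u|) >= 1. *)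
pose (c0 := 4 * Cmod inv_2ipi + 8 / g * exp 1).
assert (Hc0 : 0 < 8 / g * exp 1) by (apply Rmult_lt_0_compat; [apply Rdiv_lt_0_compat; lra|apply exp_pos]).
assert (Hi := Cmod_ge_0 inv_2ipi).
assert (K : forall w, Rabs (snd w) <= g / 2 ->
  Cmod (poisson g s0 (cexp w)) <= c0 * exp (- Rabs (fst w - s0))).
{ intros w Hw; set (u := fst w - s0).
  assert (He := exp_pos (- Rabs u)).
  destruct (Rle_dec 1 u) as [H1|H1]; [|destruct (Rle_dec u (-1)) as [H2|H2]].
  - assert (R1 := pole_quot_right (s0, - g) w); assert (R2 := pole_quot_right (s0, g) w).
    simpl in R1, R2; unfold u in *.
    specialize (R1 ltac:(lra)); specialize (R2 ltac:(lra)).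
    unfold poisson; rewrite Cmod_mult.
    fold (pole_quot (s0, - g) w) (pole_quot (s0, g) w).
    assert (T : Cmod (Cminus (pole_quot (s0, - g) w) (pole_quot (s0, g) w)) <= 4 * exp (- (fst w - s0))).
    { eapply Rle_trans; [apply Cmod_triangle|]; rewrite Cmod_opp; lra. }
    rewrite (Rabs_pos_eq (fst w - s0)) in He |- *; [|lra].
    apply Rle_trans with (Cmod inv_2ipi * (4 * exp (- (fst w - s0)))).
    + apply Rmult_le_compat_l; assumption.
    + unfold c0; nra.
  - assert (R1 := pole_quot_left (s0, - g) w); assert (R2 := pole_quot_left (s0, g) w).
    simpl in R1, R2; unfold u in *.
    specialize (R1 ltac:(lra)); specialize (R2 ltac:(lra)).
    unfold poisson; rewrite Cmod_mult.
    fold (pole_quot (s0, - g) w) (pole_quot (s0, g) w).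
    assert (T : Cmod (Cminus (pole_quot (s0, - g) w) (pole_quot (s0, g) w)) <= 4 * exp (- (s0 - fst w))).
    { replace (Cminus (pole_quot (s0, - g) w) (pole_quot (s0, g) w)) with
        (Cminus (Cminus (pole_quot (s0, - g) w) (RtoC 1)) (Cminus (pole_quot (s0, g) w) (RtoC 1))) by ring.
      eapply Rle_trans; [apply Cmod_triangle|]; rewrite Cmod_opp; lra. }
    rewrite (Rabs_left1 (fst w - s0)) in He |- *; [|lra].
    replace (- - (fst w - s0)) with (- (s0 - fst w)) in He |- * by ring.
    apply Rle_trans with (Cmod inv_2ipi * (4 * exp (- (s0 - fst w)))).
    + apply Rmult_le_compat_l; assumption.
    + unfold c0; nra.
  - assert (B := poisson_bound g s0 w Hg Hw); fold u in B.
    assert (Hu : Rabs u <= 1) by (apply Rabs_le; lra).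
    assert (B2 : 8 * g / (u ^ 2 + g ^ 2) <= 8 / g).
    { apply Rle_trans with (8 * g / g ^ 2); [|right; field; lra].
      apply Rmult_le_compat_l; [lra|]; apply Rinv_le_contravar; [apply pow_lt; lra|].
      assert (H := pow2_ge_0 u); lra. }
    assert (B3 : 1 <= exp 1 * exp (- Rabs u)).
    { rewrite -exp_plus; apply Rle_trans with (exp 0); [rewrite exp_0; lra|].
      destruct Hu as [Hu|Hu]; [left; apply exp_increasing; lra|right; f_equal; lra]. }
    assert (H8 : 0 < 8 / g) by (apply Rdiv_lt_0_compat; lra).
    apply Rle_trans with (8 / g * (exp 1 * exp (- Rabs u))); [nra|].
    unfold c0; nra. }
exists (c0 * exp (Rabs s0)); split.
{ apply Rmult_lt_0_compat; [unfold c0; lra|apply exp_pos]. }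
intros w Hw; eapply Rle_trans; [apply K, Hw|].
rewrite Rmult_assoc -exp_plus.
apply Rmult_le_compat_l; [unfold c0; lra|].
assert (T := Rabs_triang (fst w - s0) s0); replace (fst w - s0 + s0) with (fst w) in T by ring.
destruct (Req_dec (- Rabs (fst w - s0)) (Rabs s0 + - Rabs (fst w))) as [->|Hne]; [lra|].
left; apply exp_increasing; lra.
Qed.

Lemma poisson_line_decay (t : R) : 0 < Rabs t <= g / 2 -> exp_decay (poisson_line t).
Proof.
intros Ht; destruct poisson_decay as [c [Hc Hp]].
destruct (logres_bounded A hA0 (Rabs t)) as [K [HK Hb]]; [lra|].
exists (c * K), 1; repeat split; [apply Rmult_lt_0_compat; assumption|lra|]; intros s.
unfold poisson_line; rewrite (norm_scal_C (X := BX)).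
assert (H1 := Hp (s, t) (proj2 Ht)); simpl in H1.
destruct (Hb (s, t)) as [_ H2]; [simpl; rewrite cos_Rabs; lra|].
replace (c * K * exp (- (1 * Rabs s))) with (c * exp (- Rabs s) * K) by (rewrite Rmult_1_l; ring).
apply Rmult_le_compat; [apply Cmod_ge_0|apply (norm_ge_0 (V := BX))|exact H1|exact H2].
Qed.

(** Both functions are combinations of S(w) and the two fixed operators with pole quotients as
    coefficients. The limits of these quotients give the limits D and -D on the right and 0 on the
    left. *)
Let vertical_small (t : R) : 0 < t < g -> forall e, 0 < e ->
  exists M0, 0 <= M0 /\ forall M, M0 <= M ->
  (forall y, t <= y <= 2 * PI - t ->
     norm (minus (Z (M, y)) D) <= e /\ norm (Z (- M, y)) <= e) /\
  (forall y, norm (plus (Q (M, y)) D) <= e /\ norm (Q (- M, y)) <= e).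
Proof.
intros Ht e He.
destruct (logres_bounded A hA0 t) as [K [HK Hb]]; [lra|].
assert (Nm := norm_ge_0 (V := BX) Sm); assert (Np := norm_ge_0 (V := BX) Sp).
set (nm := @norm _ BX Sm) in *; set (np := @norm _ BX Sp) in *.
(* The differences estimated below have coefficients of size at most 2 h, h, h on operators bounded
   by K, [nm], [np]. *)
set (B := 2 * K + nm + np).
assert (HB : 0 < B) by (unfold B; lra).
destruct (exp_small (e / B)) as [M1 HM1]; [apply Rdiv_lt_0_compat; lra|].
set (h := e / B) in *.
assert (Hh : 0 < h) by (apply Rdiv_lt_0_compat; lra).
assert (HhB : h * B = e) by (unfold h; field; lra).
exists (Rmax 0 (Rmax 1 M1) + Rabs s0); split.
{ assert (H1 := Rmax_l 0 (Rmax 1 M1)); assert (H2 := Rabs_pos s0); lra. }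
intros M HM.
assert (H1 := Rmax_r 0 (Rmax 1 M1)); Rmax_bounds H2 H3 1 M1.
assert (H4 := Rle_abs s0); assert (H5 := Rle_abs (- s0)); rewrite Rabs_Ropp in H5.
assert (QR : forall y sg, Cmod (pole_quot (s0, sg) (M, y)) <= h).
{ intros y sg; eapply Rle_trans; [apply pole_quot_right; simpl; lra|]; simpl; apply HM1; lra. }
assert (QL : forall y sg, Cmod (Cminus (pole_quot (s0, sg) (- M, y)) (RtoC 1)) <= h).
{ intros y sg; eapply Rle_trans; [apply pole_quot_left; simpl; lra|]; simpl; apply HM1; lra. }
assert (NZ : forall y sg, cexp (s0, sg) <> cexp (M, y) /\ cexp (s0, sg) <> cexp (- M, y)).
{ intros y sg; split; intros E; assert (E' := f_equal Cmod E); rewrite !Cmod_cexp in E'; simpl in E';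
    apply exp_inv in E'; lra. }
assert (T3 : forall (a b c : C) (U V W : BX) (n1 n2 n3 : R), Cmod a <= n1 -> Cmod b <= n2 -> Cmod c <= n3 ->
  norm (plus (cscal a U) (plus (cscal b V) (cscal c W)))
  <= n1 * norm U + (n2 * norm V + n3 * norm W)).
{ intros a b c U V W n1 n2 n3 Ha Hb' Hc.
  norm_split BX; apply Rplus_le_compat.
  - rewrite (norm_scal_C (X := BX)); apply Rmult_le_compat_r; [apply norm_ge_0|exact Ha].
  - norm_split BX; apply Rplus_le_compat;
      rewrite (norm_scal_C (X := BX)); apply Rmult_le_compat_r; (try apply norm_ge_0); assumption. }
split.
- intros y Hy.
  assert (Hcy : cos y <= cos t).
  { apply cos_le_of_between; lra. }
  assert (Hc1 : cos t < 1) by (rewrite -cos_0; apply cos_decreasing_1; lra).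
  split.
  + destruct (Hb (M, y) Hcy) as [_ HS]; change (@norm _ BX (S (M, y)) <= K) in HS.
    match goal with |- norm ?x <= _ => replace x with
      (plus (cscal (Cminus (pole_quot (s0, - g) (M, y)) (pole_quot (s0, g) (M, y))) (S (M, y)))
         (plus (cscal (Copp (pole_quot (s0, - g) (M, y))) Sm)
               (cscal (pole_quot (s0, g) (M, y)) Sp))) end.
    2:{ rewrite Z_eq; [|simpl; lra|apply NZ|apply NZ]; unfold Q, D; mring BX. }
    eapply Rle_trans.
    { apply T3 with (n1 := h + h) (n2 := h) (n3 := h).
      - eapply Rle_trans; [apply Cmod_triangle|]; rewrite Cmod_opp; apply Rplus_le_compat; apply QR.
      - rewrite Cmod_opp; apply QR.
      - apply QR. }
    fold nm np; rewrite -HhB; unfold B; nra.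
  + destruct (Hb (- M, y) Hcy) as [_ HS]; change (@norm _ BX (S (- M, y)) <= K) in HS.
    match goal with |- norm ?x <= _ => replace x with
      (plus (cscal (Cminus (Cminus (pole_quot (s0, - g) (- M, y)) (RtoC 1)) (Cminus (pole_quot (s0, g) (- M, y)) (RtoC 1))) (S (- M, y)))
         (plus (cscal (Copp (Cminus (pole_quot (s0, - g) (- M, y)) (RtoC 1))) Sm)
               (cscal (Cminus (pole_quot (s0, g) (- M, y)) (RtoC 1)) Sp))) end.
    2:{ rewrite Z_eq; [|simpl; lra|apply NZ|apply NZ]; unfold Q, D; mring BX. }
    eapply Rle_trans.
    { apply T3 with (n1 := h + h) (n2 := h) (n3 := h).
      - eapply Rle_trans; [apply Cmod_triangle|]; rewrite Cmod_opp; apply Rplus_le_compat; apply QL.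
      - rewrite Cmod_opp; apply QL.
      - apply QL. }
    fold nm np; rewrite -HhB; unfold B; nra.
- intros y; split.
  + match goal with |- norm ?x <= _ => replace x with
      (plus (cscal (RtoC 0) Sm)
         (plus (cscal (pole_quot (s0, - g) (M, y)) Sm)
               (cscal (Copp (pole_quot (s0, g) (M, y))) Sp))) end.
    2:{ unfold Q, D; mring BX. }
    eapply Rle_trans.
    { apply T3 with (n1 := 0) (n2 := h) (n3 := h); [rewrite Cmod_0; lra|apply QR|rewrite Cmod_opp; apply QR]. }
    fold nm np; rewrite -HhB; unfold B; nra.
  + match goal with |- norm ?x <= _ => replace x with
      (plus (cscal (RtoC 0) Sm)
         (plus (cscal (Cminus (pole_quot (s0, - g) (- M, y)) (RtoC 1)) Sm)
               (cscal (Copp (Cminus (pole_quot (s0, g) (- M, y)) (RtoC 1))) Sp))) end.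
    2:{ unfold Q, D; mring BX. }
    eapply Rle_trans.
    { apply T3 with (n1 := 0) (n2 := h) (n3 := h); [rewrite Cmod_0; lra|apply QL|rewrite Cmod_opp; apply QL]. }
    fold nm np; rewrite -HhB; unfold B; nra.
Qed.

(* The contour integral of [p S] is computed by closing the contour for [Z]
   around the negative axis, where it has no pole, and for [Q] inside the sector. *)
Lemma poisson_lines_difference (t : R) (Lm Lp : BX) : 0 < t <= g / 2 ->
  is_line (poisson_line (- t)) Lm -> is_line (poisson_line t) Lp -> minus Lm Lp = minus (S (s0, - g)) (S (s0, g)).
Proof.
intros Ht HLm HLp; change (minus Lm Lp = D).
apply minus_eq_0, (norm_eq_zero (V := BX)), Rle_antisym; [|apply norm_ge_0].
apply le_epsilon; intros e He; rewrite Rplus_0_l.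
assert (HP := PI_RGT_0).
assert (Hi : 0 <= Cmod inv_2ipi) by apply Cmod_ge_0.
(* The vertical sides have total length 2 (2 pi - 2 t) + 2 (2 t) = 4 pi. *)
set (h := e / 2 / (Cmod inv_2ipi * (4 * PI) + 1)).
assert (Hq : 0 < Cmod inv_2ipi * (4 * PI) + 1).
{ assert (0 <= Cmod inv_2ipi * (4 * PI)) by (apply Rmult_le_pos; lra); lra. }
assert (Hh : 0 < h) by (apply Rdiv_lt_0_compat; lra).
destruct (vertical_small t ltac:(lra) h Hh) as [M1 [HM1 Hv]].
destruct (HLm (e / 4) ltac:(lra)) as [M2 H2]; destruct (HLp (e / 4) ltac:(lra)) as [M3 H3].
set (M := Rmax M1 (Rmax M2 M3)).
Rmax_bounds N1 N2 M1 (Rmax M2 M3).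
Rmax_bounds N3 N4 M2 M3; fold M in N1, N2.
specialize (H2 M M ltac:(lra) ltac:(lra)); specialize (H3 M M ltac:(lra) ltac:(lra)).
destruct (Hv M N1) as [HZ HQ].
assert (Hta : Rabs t = t) by (apply Rabs_pos_eq; lra).
assert (Htn : Rabs (- t) = t) by (rewrite Rabs_Ropp; exact Hta).
assert (CZm := fun s => Z_cont (- t) s ltac:(lra)).
assert (CZp := fun s => Z_cont t s ltac:(lra)).
assert (CQm := fun s => Q_cont (- t) s ltac:(lra)).
assert (CQp := fun s => Q_cont t s ltac:(lra)).
assert (Split : forall t', 0 < Rabs t' < g ->
  RI (poisson_line t') (- M) M = cscal inv_2ipi
    (plus (RI (fun s => Z (s, t')) (- M) M) (RI (fun s => Q (s, t')) (- M) M))).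
{ intros t' Ht'.
  assert (C1 := fun s => Z_cont t' s Ht'); assert (C2 := fun s => Q_cont t' s (proj2 Ht')).
  rewrite (RI_ext _ (fun s => cscal inv_2ipi (plus (Z (s, t')) (Q (s, t'))))).
  2:{ intros s _; apply poisson_line_eq, Ht'. }
  rewrite RI_scal; [rewrite RI_plus; [reflexivity| |]|]; intros s _;
    [apply C1|apply C2|apply continuous_plusV; [apply C1|apply C2]]. }
rewrite Split in H2; [|lra]; rewrite Split in H3; [|lra].
assert (cosy : forall y, t <= y <= 2 * PI - t -> cos y < 1).
{ intros y Hy; apply Rle_lt_trans with (cos t).
  - apply cos_le_of_between; lra.
  - rewrite -cos_0; apply cos_decreasing_1; lra. }
assert (GZ := goursat Z (- M) M t (2 * PI - t)).
assert (GQ := goursat Q (- M) M (- t) t).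
specialize (GZ ltac:(lra) ltac:(lra)); specialize (GQ ltac:(lra) ltac:(lra)).
specialize (GZ (fun x y _ Hy => cdiff_Z (x, y) (cosy y Hy))).
specialize (GQ (fun x y _ Hy => cdiff_Q (x, y) (Rle_lt_trans (Rabs y) t g (Rabs_le _ _ Hy) ltac:(lra)))).
unfold boundary_int in GZ, GQ.
(* The upper side of the rectangle for [Z] is the lower line again, so both rectangles compare the
   same two lines, but with opposite orientations. *)
assert (EZ : RI (fun x => Z (x, 2 * PI - t)) (- M) M = RI (fun x => Z (x, - t)) (- M) M).
{ apply RI_ext; intros x _; unfold Z; f_equal.
  replace (2 * PI - t) with (- t + 2 * PI) by ring; apply logres_periodic. }
rewrite EZ in GZ.
assert (VC : forall (f : C -> BX) x y, (exists E, cdiff f (x, y) E) -> continuous (fun y => f (x, y)) y).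
{ intros f x y [E HE]; apply ccont_vertical, (cdiff_ccont _ _ _ HE). }
assert (cZ : forall x, cont_on (fun y => Z (x, y)) t (2 * PI - t)).
{ intros x y Hy; rewrite Rmin_left in Hy; [|lra]; rewrite Rmax_right in Hy; [|lra].
  apply VC, cdiff_Z, cosy, Hy. }
assert (cQ : forall x, cont_on (fun y => Q (x, y)) (- t) t).
{ intros x y Hy; rewrite Rmin_left in Hy; [|lra]; rewrite Rmax_right in Hy; [|lra].
  apply VC, cdiff_Q; simpl; apply Rle_lt_trans with t; [apply Rabs_le, Hy|lra]. }
assert (V1 := RI_near_const (fun y => Z (M, y)) D t (2 * PI - t) h ltac:(lra) (cZ M) (fun y Hy => proj1 (HZ y Hy))).
assert (V2 := RI_norm_const (fun y => Z (- M, y)) h t (2 * PI - t) ltac:(lra) (cZ (- M)) (fun y Hy => proj2 (HZ y Hy))).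
assert (V4 := RI_norm_const (fun y => Q (- M, y)) h (- t) t ltac:(lra) (cQ (- M)) (fun y Hy => proj2 (HQ y))).
assert (V3 : norm (minus (RI (fun y => Q (M, y)) (- t) t) (cscal (RtoC (t - - t)) (opp D))) <= h * (t - - t)).
{ apply (RI_near_const (V := BX) (fun y => Q (M, y)) (opp D)); [lra|apply cQ|]; intros y _.
  match goal with |- norm ?x <= _ => replace x with (plus (Q (M, y)) D : BX) by mring BX end.
  exact (proj1 (HQ y)). }
set (zm := RI (fun x => Z (x, - t)) (- M) M) in *; set (zp := RI (fun x => Z (x, t)) (- M) M) in *.
set (qm := RI (fun x => Q (x, - t)) (- M) M) in *; set (qp := RI (fun x => Q (x, t)) (- M) M) in *.
set (z1 := RI (fun y => Z (M, y)) t (2 * PI - t)) in *; set (z2 := RI (fun y => Z (- M, y)) t (2 * PI - t)) in *.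
set (q1 := RI (fun y => Q (M, y)) (- t) t) in *; set (q2 := RI (fun y => Q (- M, y)) (- t) t) in *.
set (x1 := minus z1 (cscal (RtoC (2 * PI - t - t)) D)) in *.
set (x3 := minus q1 (cscal (RtoC (t - - t)) (opp D))) in *.
assert (Ez : minus zm zp = cscal Ci (minus z1 z2)).
{ transitivity (minus (cscal Ci (minus z1 z2)) (plus (minus zp zm) (cscal Ci (minus z1 z2)))); [mring BX|].
  rewrite GZ; mring BX. }
assert (Eq : minus qm qp = cscal (Copp Ci) (minus q1 q2)).
{ transitivity (plus (cscal (Copp Ci) (minus q1 q2)) (plus (minus qm qp) (cscal Ci (minus q1 q2)))); [mring BX|].
  rewrite GQ; mring BX. }
set (am := cscal inv_2ipi (plus zm qm)) in *.
set (ap := cscal inv_2ipi (plus zp qp)) in *.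
(* The right sides contribute i (2 pi - 2 t) D from [Z] and (-i) (2 t) (-D) from [Q]. The sum 2 i pi
   D no longer depends on [t]; only the errors of the four sides remain. *)
assert (Emain : minus (minus am ap) D = cscal (Cmult inv_2ipi Ci)
  (minus (minus x1 z2) (minus x3 q2))).
{ transitivity (minus (cscal inv_2ipi (plus (minus zm zp) (minus qm qp))) D).
  { unfold am, ap; mring BX. }
  rewrite Ez Eq; unfold x1, x3.
  transitivity (minus (cscal inv_2ipi (plus (cscal Ci (minus z1 z2)) (cscal (Copp Ci) (minus q1 q2))))
    (cscal (Cmult inv_2ipi (Cmult (RtoC (2 * PI)) Ci)) D)).
  { unfold inv_2ipi; rewrite Cinv_l; [|apply inv_2ipi_neq]; mring BX. }
  replace (2 * PI - t - t) with (2 * PI + - (2 * t)) by ring.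
  replace (t - - t) with (2 * t) by ring.
  rewrite RtoC_plus RtoC_opp; mring BX. }
assert (Efin : minus (minus Lm Lp) D = plus (minus (minus am ap) D) (minus (minus ap Lp) (minus am Lm))) by mring BX.
rewrite Efin.
norm_split BX.
assert (F1 : norm (minus (minus ap Lp) (minus am Lm)) <= e / 4 + e / 4).
{ unfold minus at 1; norm_split BX.
  rewrite (norm_opp (V := BX)); apply Rplus_le_compat; assumption. }
assert (F2 : norm (minus (minus am ap) D) <= e / 2).
{ rewrite Emain (norm_scal_C (X := BX)) Cmod_mult.
  rewrite Cmod_Ci. assert (G1 : norm (minus (minus x1 z2) (minus x3 q2)) <= h * (4 * PI)).
  { assert (Tm : forall a b : BX, norm (minus a b) <= norm a + norm b).
    { intros a b; unfold minus; norm_split BX.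
      rewrite (norm_opp (V := BX)); apply Rle_refl. }
    eapply Rle_trans; [apply Tm|].
    assert (T1 := Tm x1 z2); assert (T2 := Tm x3 q2).
    assert (norm x1 <= h * (2 * PI - t - t)) by exact V1.
    assert (norm z2 <= h * (2 * PI - t - t)) by exact V2.
    assert (norm x3 <= h * (t - - t)) by exact V3.
    assert (norm q2 <= h * (t - - t)) by exact V4.
    lra. }
  rewrite Rmult_1_r.
  apply Rle_trans with (h * (Cmod inv_2ipi * (4 * PI) + 1)); [|right; unfold h; field; lra].
  apply Rle_trans with (Cmod inv_2ipi * (h * (4 * PI))); [apply Rmult_le_compat_l; assumption|].
  nra. }
lra.
Qed.

End PoissonCalculus.

(** * Derivatives in the sector and in the exponential coordinate *)

Section DerivativeTranslation.
Context {V : CompleteNormedModule C_AbsRing}.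

Lemma cdiff_is_derive (f : C -> V) (z : C) (D : V) :
  cdiff f z D -> is_derive (K := C_AbsRing) (V := V) f z D.
Proof.
intros H; split; [apply (is_linear_scal_l (K := C_AbsRing) (V := V))|].
intros x Hx.
apply (is_filter_lim_locally_unique (K := C_AbsRing) (V := AbsRing_NormedModule C_AbsRing)) in Hx.
subst x; intros e; destruct (H e (cond_pos e)) as [d [Hd Hu]].
exists (mkposreal d Hd); intros y Hy.
change (Cmod (Cminus y z) < d) in Hy.
specialize (Hu (Cminus y z) Hy).
assert (E : Cplus z (Cminus y z) = y :> C) by ring.
rewrite E in Hu; exact Hu.
Qed.

Lemma is_derive_cdiff (f : C -> V) (z : C) (D : V) :
  is_derive (K := C_AbsRing) (V := V) f z D -> cdiff f z D.
Proof.
intros [_ H] e He.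
destruct (H z (fun P HP => HP) (mkposreal e He)) as [d Hd].
exists d; split; [apply cond_pos|]; intros u Hu.
specialize (Hd (Cplus z u)).
assert (E : minus (Cplus z u : C_AbsRing) z = u).
{ change (Cminus (Cplus z u) z = u :> C); ring. }
rewrite E in Hd; apply Hd.
change (Cmod (Cminus (Cplus z u) z) < d).
replace (Cminus (Cplus z u) z) with u by ring; exact Hu.
Qed.

Lemma cdiff_comp_cexp (f : C -> V) (w : C) (D : V) : cdiff f (cexp w) D ->
  cdiff (fun z => f (cexp z)) w (cscal (cexp w) D).
Proof.
intros H e He.
set (m := exp (fst w)); assert (Hm : 0 < m) by apply exp_pos.
assert (HD := norm_ge_0 D).
destruct (H (e / 2 / (4 * m))) as [d [Hd Hf]]; [apply Rdiv_lt_0_compat; lra|].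
assert (Hq : 0 < 12 * m * (norm D + 1)) by (apply Rmult_lt_0_compat; lra).
set (d' := Rmin (/ 2) (Rmin (d / (4 * m)) (e / (12 * m * (norm D + 1))))).
exists d'; split.
{ repeat apply Rmin_pos; [lra|apply Rdiv_lt_0_compat; lra|apply Rdiv_lt_0_compat; lra]. }
intros u Hu.
Rmin_bounds M1 M2 (/ 2) (Rmin (d / (4 * m)) (e / (12 * m * (norm D + 1)))).
Rmin_bounds M3 M4 (d / (4 * m)) (e / (12 * m * (norm D + 1))).
fold d' in M1, M2.
assert (Hu0 := Cmod_ge_0 u).
assert (E1 := cexp_minus_1 u ltac:(lra)); assert (E2 := cexp_quadratic u ltac:(lra)).
pose (v := Cmult (cexp w) (Cminus (cexp u) (RtoC 1))).
assert (Ev : cexp (Cplus w u) = Cplus (cexp w) v).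
{ rewrite cexp_plus; unfold v; ring. }
assert (Hv : Cmod v <= 4 * m * Cmod u).
{ unfold v; rewrite Cmod_mult Cmod_cexp; fold m; nra. }
assert (Hvd : Cmod v < d).
{ eapply Rle_lt_trans; [exact Hv|]; apply Rlt_le_trans with (4 * m * (d / (4 * m))).
  - apply Rmult_lt_compat_l; lra.
  - right; field; lra. }
specialize (Hf v Hvd); rewrite Ev.
match goal with |- norm ?t <= _ => replace t with
  (plus (minus (minus (f (Cplus (cexp w) v)) (f (cexp w))) (cscal v D))
        (cscal (Cmult (cexp w) (Cminus (Cminus (cexp u) (RtoC 1)) u)) D)) end.
2:{ unfold v; mring V. }
norm_split V.
rewrite (norm_scal_C (X := V)) Cmod_mult Cmod_cexp; fold m.
replace (e * Cmod u) with (e / 2 * Cmod u + e / 2 * Cmod u) by field.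
apply Rplus_le_compat.
- eapply Rle_trans; [exact Hf|].
  apply Rle_trans with (e / 2 / (4 * m) * (4 * m * Cmod u)); [|right; field; lra].
  apply Rmult_le_compat_l; [left; apply Rdiv_lt_0_compat; lra|exact Hv].
- apply Rle_trans with (m * (6 * Cmod u ^ 2) * (norm D + 1)).
  + apply Rmult_le_compat; [apply Rmult_le_pos; [lra|apply Cmod_ge_0]|exact HD| |lra].
    apply Rmult_le_compat_l; lra.
  + apply Rle_trans with (6 * m * (norm D + 1) * Cmod u * (e / (12 * m * (norm D + 1)))).
    * replace (m * (6 * Cmod u ^ 2) * (norm D + 1)) with (6 * m * (norm D + 1) * Cmod u * Cmod u) by ring.
      apply Rmult_le_compat_l; [|lra].
      apply Rmult_le_pos; [|exact Hu0]; lra.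
    * right; field; lra.
Qed.

End DerivativeTranslation.

Lemma ex_derive_simple_pole (a z : C) : Cminus a z <> RtoC 0 ->
  ex_derive (K := C_AbsRing) (V := C_NormedModule) (fun z => Cdiv a (Cminus a z)) z.
Proof.
intros Hn.
exists (Cdiv a (Cmult (Cminus a z) (Cminus a z))).
apply (cdiff_is_derive (V := C_CompleteNormedModule)); intros e He.
set (m := Cmod (Cminus a z)); assert (Hm : 0 < m) by (apply Cmod_gt_0, Hn).
assert (Ha := Cmod_ge_0 a).
(* The remainder is exactly a u^2 / ((a - z - u) (a - z)^2), with denominator at least m^3 / 2; the
   1 covers a = 0. *)
set (k := 2 * (Cmod a + 1) / m ^ 3).
assert (Hm3 : 0 < m ^ 3) by (apply pow_lt, Hm).
assert (Hk : 0 < k) by (apply Rdiv_lt_0_compat; lra).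
exists (Rmin (m / 2) (e / k)); split.
{ apply Rmin_pos; [lra|apply Rdiv_lt_0_compat; assumption]. }
intros u Hu.
Rmin_bounds M1 M2 (m / 2) (e / k).
assert (Hu0 := Cmod_ge_0 u).
assert (Hlow : m / 2 <= Cmod (Cminus a (Cplus z u))).
{ assert (T := Cmod_triangle (Cminus a (Cplus z u)) u).
  replace (Cplus (Cminus a (Cplus z u)) u) with (Cminus a z) in T by ring; fold m in T; lra. }
assert (Hn' : Cminus a (Cplus z u) <> RtoC 0) by (apply Cmod_gt_0; lra).
match goal with |- norm ?t <= _ => change (Cmod t <= e * Cmod u) end.
match goal with |- Cmod ?t <= _ => replace t with
  (Cdiv (Cmult a (Cmult u u)) (Cmult (Cminus a (Cplus z u)) (Cmult (Cminus a z) (Cminus a z)))) end.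
2:{ Cnorm; change (cscal u (Cdiv a (Cmult (Cminus a z) (Cminus a z)))) with
      (Cmult u (Cdiv a (Cmult (Cminus a z) (Cminus a z)))); field; split; assumption. }
eapply Rle_trans; [apply (Cmod_Cdiv_le _ _ (m ^ 3 / 2)); [lra|]|].
{ rewrite !Cmod_mult; fold m; nra. }
rewrite !Cmod_mult.
apply Rle_trans with (k * Cmod u * Cmod u).
{ unfold k; replace (Cmod a * (Cmod u * Cmod u) / (m ^ 3 / 2)) with (2 * Cmod a / m ^ 3 * Cmod u * Cmod u) by (field; lra).
  repeat apply Rmult_le_compat_r; try assumption; [left; apply Rinv_0_lt_compat; assumption|lra]. }
apply Rmult_le_compat_r; [exact Hu0|].
apply Rle_trans with (k * (e / k)); [apply Rmult_le_compat_l; lra|right; field; lra].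
Qed.

(** An integral comparison over an interval of length 1 centred at [y], in a form that telescopes
    along the lattice. *)
Lemma atan_step (y : R) : / (y ^ 2 + 1) <= 2 * (atan (y + / 2) - atan (y - / 2)).
Proof.
destruct (MVT_gen atan (y - / 2) (y + / 2) (fun x => / (1 + x ^ 2))) as [x [Hx E]].
- intros x _; apply is_derive_Reals.
  apply derivable_pt_lim_atan.
- intros x _; apply derivable_continuous_pt, derivable_pt_atan.
- rewrite Rmin_left in Hx; [|lra]; rewrite Rmax_right in Hx; [|lra].
  rewrite E; replace (y + / 2 - (y - / 2)) with 1 by lra; rewrite Rmult_1_r.
  assert (Hy := pow2_ge_0 y); assert (Hx2 := pow2_ge_0 x).
  apply (Rmult_le_reg_r (y ^ 2 + 1)); [lra|]; rewrite Rinv_l; [|lra].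
  apply (Rmult_le_reg_r (1 + x ^ 2)); [lra|].
  replace (2 * / (1 + x ^ 2) * (y ^ 2 + 1) * (1 + x ^ 2)) with (2 * (y ^ 2 + 1)) by (field; lra).
  (* x^2 - 2 y^2 = 2 (x - y)^2 - (x - 2 y)^2 <= 1 / 2, whence 1 + x^2 <= 2 (y^2 + 1). *)
  assert (Hd : (x - y) ^ 2 <= / 4) by nra.
  assert (Hs := pow2_ge_0 (x - 2 * y)); lra.
Qed.

Lemma lattice_sum_bound (y : R) (n : nat) :
  sum_n (fun j => / ((y - INR j) ^ 2 + 1)) n <= 2 * PI.
Proof.
assert (H : sum_n (fun j => / ((y - INR j) ^ 2 + 1)) n
  <= 2 * (atan (y + / 2) - atan (y - INR n - / 2))).
{ induction n as [|n IH].
  - rewrite sum_O; simpl INR; rewrite !Rminus_0_r; apply atan_step.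
  - rewrite sum_Sn; assert (T := atan_step (y - INR (S n))).
    change (plus ?a ?b) with (a + b).
    replace (y - INR (S n) + / 2) with (y - INR n - / 2) in T by (rewrite S_INR; field).
    lra. }
assert (B1 := atan_bound (y + / 2)); assert (B2 := atan_bound (y - INR n - / 2)); lra.
Qed.

Lemma sector_cexp (theta : R) (z : C) : sector theta z ->
  exists w, z = cexp w /\ Rabs (snd w) < theta.
Proof.
intros [r [phi [Hr [Hphi ->]]]]; exists (ln r, phi); split; [|exact Hphi].
rewrite cexp_polar exp_ln; [reflexivity|exact Hr].
Qed.

Lemma cexp_sector (theta : R) (w : C) : Rabs (snd w) < theta -> sector theta (cexp w).
Proof.
intros Hw; destruct w as [s phi]; exists (exp s), phi; repeat split; [apply exp_pos|exact Hw|].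
apply cexp_polar.
Qed.

Lemma sum_n_Rle (u v : nat -> R) (n : nat) : (forall k, u k <= v k) -> sum_n u n <= sum_n v n.
Proof.
intros H; induction n as [|n IH]; [rewrite !sum_O; apply H|rewrite !sum_Sn; apply Rplus_le_compat; [exact IH|apply H]].
Qed.

Lemma norm_sum_n_le {V : NormedModule C_AbsRing} (u : nat -> V) (n : nat) :
  norm (sum_n u n) <= sum_n (fun k => norm (u k)) n.
Proof.
induction n as [|n IH]; [rewrite !sum_O; apply Rle_refl|rewrite !sum_Sn].
eapply Rle_trans; [apply norm_triangle|]; apply Rplus_le_compat; [exact IH|apply Rle_refl].
Qed.

Lemma exp_Rabs_Rmin (k s : R) : 0 < k ->
  exp (- (k * Rabs s)) = Rmin (Rpower (exp s) k) (Rpower (exp s) (- k)).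
Proof.
intros Hk; unfold Rpower; rewrite ln_exp.
unfold Rabs; destruct (Rcase_abs s) as [H|H].
- rewrite Rmin_left; [f_equal; ring|left; apply exp_increasing; nra].
- rewrite Rmin_right; [f_equal; ring|].
  destruct H as [H| ->]; [left; apply exp_increasing; nra|right; f_equal; ring].
Qed.

(** * Signed sums of Poisson kernels *)

Section PoissonSums.
Context {X : CompleteNormedModule C_AbsRing}.
Variable A : operator X.
Hypothesis hA0 : omega_of A = Finite 0.
Notation BX := (bddop_CompleteNormedModule X).
Variables (g a : R) (sg : nat -> R).
Hypotheses (Hg : 0 < g <= 1) (Hsg : forall j, Rabs (sg j) <= 1).

Definition poisson_sum (n : nat) (z : C) : C_NormedModule :=
  sum_n (fun j => cscal (RtoC (sg j)) (poisson g (a + INR j * g) z : C_NormedModule)) n.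

Let PI4 : 1 < PI / 2.
Proof. apply PI2_1. Qed.

Lemma ex_derive_poisson (s : R) (w : C) : Rabs (snd w) < g ->
  ex_derive (K := C_AbsRing) (V := C_NormedModule) (poisson g s) (cexp w).
Proof.
intros Hw.
destruct (poisson_poles g s w) as [N1 N2]; [lra|exact Hw|].
destruct (ex_derive_simple_pole _ _ N1) as [d1 H1].
destruct (ex_derive_simple_pole _ _ N2) as [d2 H2].
apply (is_derive_cdiff (V := C_CompleteNormedModule)) in H1.
apply (is_derive_cdiff (V := C_CompleteNormedModule)) in H2.
eexists; apply (cdiff_is_derive (V := C_CompleteNormedModule)).
eapply (cdiff_ext (V := C_CompleteNormedModule) (fun z => cscal inv_2ipi
  (plus (Cdiv (cexp (s, - g)) (Cminus (cexp (s, - g)) z) : C_CompleteNormedModule)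
   (cscal (RtoC (-1)) (Cdiv (cexp (s, g)) (Cminus (cexp (s, g)) z) : C_CompleteNormedModule)))));
  [|reflexivity|apply cdiff_scal, cdiff_plus; [exact H1|apply cdiff_scal; exact H2]].
intros z; unfold poisson.
match goal with |- scal ?k (plus ?x (scal ?l ?y)) = _ =>
  change (Cmult k (Cplus x (Cmult l y)) = Cmult inv_2ipi (Cminus x y)) end.
rewrite RtoC_m1.
ring.
Qed.

(** As the spacing equals the width, rescaling by [g] reduces to the lattice sum, uniformly in the
    signs, the offset and the number of terms; 16 pi = 8 * 2 pi. *)
Lemma norm_poisson_sum (n : nat) (w : C) : Rabs (snd w) <= g / 2 ->
  Cmod (poisson_sum n (cexp w)) <= 16 * PI / g.
Proof.
intros Hw.
eapply Rle_trans; [apply (norm_sum_n_le (V := C_NormedModule))|].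
apply Rle_trans with (sum_n (fun j => scal (8 / g) (/ (((fst w - a) / g - INR j) ^ 2 + 1))) n).
{ apply sum_n_Rle; intros j.
  eapply Rle_trans; [apply (norm_scal (K := C_AbsRing) (V := C_NormedModule))|].
  change (Cmod (RtoC (sg j)) * Cmod (poisson g (a + INR j * g) (cexp w))
    <= 8 / g * / (((fst w - a) / g - INR j) ^ 2 + 1)).
  assert (B := poisson_bound g (a + INR j * g) w Hg Hw).
  assert (H0 := Cmod_ge_0 (poisson g (a + INR j * g) (cexp w))).
  assert (H1 := Rabs_pos (sg j)).
  rewrite Cmod_R; apply Rle_trans with (1 * (8 * g / ((fst w - (a + INR j * g)) ^ 2 + g ^ 2))).
  - apply Rmult_le_compat; try assumption; apply Hsg.
  - right; field.
    assert (P1 := pow_lt g 2 (proj1 Hg)).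
    assert (P2 := pow2_ge_0 (fst w - (a + INR j * g))).
    assert (P3 := pow2_ge_0 (fst w - a - INR j * g)).
    repeat split; try lra. }
rewrite sum_n_scal_l.
change (8 / g * sum_n (fun j => / (((fst w - a) / g - INR j) ^ 2 + 1)) n <= 16 * PI / g).
assert (H := lattice_sum_bound ((fst w - a) / g) n).
assert (H8 : 0 < 8 / g) by (apply Rdiv_lt_0_compat; lra).
replace (16 * PI / g) with (8 / g * (2 * PI)) by (field; lra).
apply Rmult_le_compat_l; lra.
Qed.

Lemma H0inf_poisson_sum (n : nat) : H0inf (V := C_NormedModule) (g / 2) (poisson_sum n).
Proof.
split; [|split].
- intros z Hz; destruct (sector_cexp _ _ Hz) as [w [-> Hw]].
  unfold poisson_sum.
  apply (ex_derive_sum_n (K := C_AbsRing) (V := C_NormedModule)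
    (fun j z => cscal (RtoC (sg j)) (poisson g (a + INR j * g) z : C_NormedModule))).
  intros j _.
  destruct (ex_derive_poisson (a + INR j * g) w ltac:(lra)) as [D HD].
  apply (is_derive_cdiff (V := C_CompleteNormedModule)) in HD.
  eexists; apply (cdiff_is_derive (V := C_CompleteNormedModule)).
  exact (cdiff_scal (V := C_CompleteNormedModule) (RtoC (sg j)) (poisson g (a + INR j * g)) (cexp w) D HD).
- exists (16 * PI / g); intros z Hz; destruct (sector_cexp _ _ Hz) as [w [-> Hw]].
  apply norm_poisson_sum; lra.
(* This constant grows with [n], which is harmless: decay only gives membership in the function
   class, and the estimate of the calculus sees the sup norm. *)
- assert (K : exists c, 0 < c /\ forall w, Rabs (snd w) <= g / 2 ->
    Cmod (poisson_sum n (cexp w)) <= c * exp (- Rabs (fst w))).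
  { induction n as [|m [c1 [Hc1 K1]]].
    - destruct (poisson_decay g (a + INR O * g) Hg) as [c [Hc K]].
      exists c; split; [exact Hc|]; intros w Hw.
      unfold poisson_sum; rewrite sum_O.
      eapply Rle_trans; [apply (norm_scal (K := C_AbsRing) (V := C_NormedModule))|].
      change (Cmod (RtoC (sg O)) * Cmod (poisson g (a + INR O * g) (cexp w)) <= c * exp (- Rabs (fst w))).
      rewrite Cmod_R; specialize (K w Hw).
      assert (H0 := Cmod_ge_0 (poisson g (a + INR O * g) (cexp w))).
      assert (H1 := Hsg O); assert (H2 := Rabs_pos (sg O)); nra.
    - destruct (poisson_decay g (a + INR m.+1 * g) Hg) as [c [Hc K]].
      exists (c1 + c); split; [lra|]; intros w Hw.
      unfold poisson_sum; rewrite sum_Sn.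
      norm_split C_NormedModule.
      rewrite Rmult_plus_distr_r; apply Rplus_le_compat; [apply K1, Hw|].
      eapply Rle_trans; [apply (norm_scal (K := C_AbsRing) (V := C_NormedModule))|].
      change (Cmod (RtoC (sg m.+1)) * Cmod (poisson g (a + INR m.+1 * g) (cexp w)) <= c * exp (- Rabs (fst w))).
      rewrite Cmod_R; specialize (K w Hw).
      assert (H0 := Cmod_ge_0 (poisson g (a + INR m.+1 * g) (cexp w))).
      assert (H1 := Hsg m.+1); assert (H2 := Rabs_pos (sg m.+1)); nra. }
  destruct K as [c [Hc K]]; exists 1, c; repeat split; [lra|exact Hc|].
  intros z Hz; destruct (sector_cexp _ _ Hz) as [w [-> Hw]].
  rewrite Cmod_cexp -exp_Rabs_Rmin; [|lra]; rewrite Rmult_1_l; apply K; lra.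
Qed.

Lemma supnorm_poisson_sum (n : nat) : supnorm (g / 2) (poisson_sum n) <= 16 * PI / g.
Proof.
unfold supnorm.
destruct (Lub_Rbar_correct (fun r => exists z, sector (g / 2) z /\ r = Cmod (poisson_sum n z))) as [U L].
set (E := fun r : R => exists z, sector (g / 2) z /\ r = Cmod (poisson_sum n z)) in *.
assert (B : Rbar_le (Lub_Rbar E) (16 * PI / g)).
{ apply L; intros r [z [Hz ->]]; destruct (sector_cexp _ _ Hz) as [w [-> Hw]].
  apply norm_poisson_sum; lra. }
assert (HP := PI_RGT_0).
(* [Rbar.real] reads an infinite supremum as 0. The value [p_infty] is excluded by [B], and for
   [m_infty] positivity of the bound is what remains. *)
assert (0 < 16 * PI / g) by (apply Rdiv_lt_0_compat; lra).
destruct (Lub_Rbar E); simpl in *; try lra; contradiction.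
Qed.

Lemma poisson_sum_lines (t : R) (n : nat) : 0 < Rabs t <= g / 2 ->
  forall L : nat -> BX, (forall j, is_line (poisson_line A g (a + INR j * g) t) (L j)) ->
  is_line (fun s => cscal (poisson_sum n (cexp (s, t))) (logres A (s, t)) : BX)
    (sum_n (fun j => cscal (RtoC (sg j)) (L j)) n)
  /\ forall s, continuous (fun s => cscal (poisson_sum n (cexp (s, t))) (logres A (s, t)) : BX) s.
Proof.
intros Ht L HL.
assert (Cj : forall j s, continuous (fun s => cscal (RtoC (sg j)) (poisson_line A g (a + INR j * g) t s)) s).
{ intros j s; apply continuous_scalC, continuous_poisson_line; [exact hA0|exact Hg|lra]. }
assert (Ej : forall j s, cscal (RtoC (sg j)) (poisson_line A g (a + INR j * g) t s)
  = cscal (Cmult (RtoC (sg j)) (poisson g (a + INR j * g) (cexp (s, t)))) (logres A (s, t) : BX)).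
{ intros j s; unfold poisson_line; mring BX. }
assert (Lj : forall j, is_line (fun s => cscal (RtoC (sg j)) (poisson_line A g (a + INR j * g) t s))
  (cscal (RtoC (sg j)) (L j))).
{ intros j; apply is_line_scal; [|apply HL].
  intros s; apply continuous_poisson_line; [exact hA0|exact Hg|lra]. }
induction n as [|n [IH1 IH2]].
- rewrite sum_O.
  assert (E : forall s, cscal (RtoC (sg O)) (poisson_line A g (a + INR O * g) t s)
    = (cscal (poisson_sum 0 (cexp (s, t))) (logres A (s, t)) : BX)).
  { intros s; unfold poisson_sum; rewrite sum_O; apply Ej. }
  split; [apply (is_line_ext _ _ _ E), Lj|].
  intros s; apply (continuous_ext _ _ s E), Cj.
- rewrite sum_Sn.
  assert (E : forall s, plus (cscal (poisson_sum n (cexp (s, t))) (logres A (s, t)) : BX)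
      (cscal (RtoC (sg n.+1)) (poisson_line A g (a + INR n.+1 * g) t s))
    = (cscal (poisson_sum n.+1 (cexp (s, t))) (logres A (s, t)) : BX)).
  { intros s; unfold poisson_sum; rewrite sum_Sn Ej.
    symmetry; exact (scal_distr_r (K := C_AbsRing) (V := BX) _ _ (logres A (s, t) : BX)). }
  split; [apply (is_line_ext _ _ _ E), is_line_plus; [exact IH2|apply Cj|exact IH1|apply Lj]|].
  intros s; apply (continuous_ext _ _ s E), continuous_plusV; [apply IH2|apply Cj].
Qed.

Lemma sum_n_minus_scal {V : ModuleSpace C_AbsRing} (k : nat -> C) (u v : nat -> V) (n : nat) :
  minus (sum_n (fun j => cscal (k j) (u j)) n) (sum_n (fun j => cscal (k j) (v j)) n)
  = sum_n (fun j => cscal (k j) (minus (u j) (v j))) n.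
Proof.
induction n as [|n IH]; [rewrite !sum_O; mring V|rewrite !sum_Sn -IH; mring V].
Qed.

Lemma scal_swap {V : ModuleSpace C_AbsRing} (k l : C) (v : V) :
  cscal k (cscal l v) = cscal l (cscal k v).
Proof. mring V. Qed.

(** The residue computation [poisson_lines_difference], term by term. The contour has angle g / 4 to
    lie strictly inside the sector of angle g / 2 on which the kernels are bounded. *)
Lemma fcalc_poisson_sum (n : nat) :
  fcalc A (g / 4) (poisson_sum n)
  = sum_n (fun j => cscal (RtoC (sg j)) (poisson_op A g (a + INR j * g))) n.
Proof.
assert (T1 : Rabs (g / 4) = g / 4) by (apply Rabs_pos_eq; lra).
assert (T2 : Rabs (- (g / 4)) = g / 4) by (rewrite Rabs_Ropp; exact T1).
assert (HL : forall t, 0 < Rabs t <= g / 2 -> exists L : nat -> BX,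
  forall j, is_line (poisson_line A g (a + INR j * g) t) (L j)).
{ intros t Ht.
  assert (H : forall j, {L : BX | is_line (poisson_line A g (a + INR j * g) t) L}).
  { intros j; apply constructive_indefinite_description, line_exists.
    - intros s; apply continuous_poisson_line; [exact hA0|exact Hg|lra].
    - apply poisson_line_decay; [exact hA0|exact Hg|exact Ht]. }
  exists (fun j => proj1_sig (H j)); intros j; exact (proj2_sig (H j)). }
destruct (HL (- (g / 4)) ltac:(lra)) as [Lm HLm]; destruct (HL (g / 4) ltac:(lra)) as [Lp HLp].
destruct (poisson_sum_lines (- (g / 4)) n ltac:(lra) Lm HLm) as [Im Cm].
destruct (poisson_sum_lines (g / 4) n ltac:(lra) Lp HLp) as [Ip Cp].
unfold fcalc, contour_int.
rewrite (ray_int_line (- (g / 4)) _ _ _ (fun s => _) Cm Im).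
rewrite (ray_int_line (g / 4) _ _ _ (fun s => _) Cp Ip).
- rewrite (sum_n_minus_scal (V := BX)).
  assert (E : forall j, minus (Lm j) (Lp j) = minus (logres A (a + INR j * g, - g)) (logres A (a + INR j * g, g))).
  { intros j; apply (poisson_lines_difference A hA0 g _ Hg (g / 4)); [lra|apply HLm|apply HLp]. }
  rewrite -(sum_n_scal_l (K := C_AbsRing) (V := BX)).
  apply sum_n_ext; intros j; rewrite E; unfold poisson_op; mring BX.
- intros s; exact (scal_swap (V := BX) _ _ _).
- intros s; exact (scal_swap (V := BX) _ _ _).
Qed.

End PoissonSums.

(** The point where the hypothesis on A acts: the calculus is applied at angle g / 2, which will
    tend to 0, with a constant that does not change. *)
Lemma norm_poisson_op_sum {X : CompleteNormedModule C_AbsRing} (A : operator X) (c : R) :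
  omega_of A = Finite 0 -> 0 < c ->
  (forall theta, 0 < theta < PI ->
    forall f : C -> C, H0inf (V := C_NormedModule) theta f ->
    forall gamma : R, Rbar_lt (omega_of A) gamma -> gamma < theta ->
      norm (fcalc A gamma f) <= c * supnorm theta f) ->
  forall g a sg n, 0 < g <= 1 -> (forall j, Rabs (sg j) <= 1) ->
  norm (sum_n (fun j => cscal (RtoC (sg j)) (poisson_op A g (a + INR j * g))) n)
  <= c * (16 * PI / g).
Proof.
intros hA0 Hc Hcalc g a sg n Hg Hsg.
assert (HP := PI2_1).
rewrite -fcalc_poisson_sum; try assumption.
eapply Rle_trans.
- apply (Hcalc (g / 2)); [lra|apply H0inf_poisson_sum; assumption|rewrite hA0; simpl; lra|lra].
- apply Rmult_le_compat_l; [lra|apply supnorm_poisson_sum; assumption].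
Qed.

(** * Rademacher averages *)

Section RademacherAverage.
Import Order.TTheory GRing.Theory Num.Theory HBSimple HBNNSimple.
Local Open Scope ring_scope.
Context (K : realType) (d : measure_display) (Omega : measurableType d)
  (P : probability Omega K) (eps : nat -> {RV P >-> K}).
Hypothesis heps : rademacher eps.

Definition sign_set (sg : nat -> K) (m : nat) (v : K) : nat -> K :=
  fun j => if j == m then v else sg j.

Fixpoint sign_avg (m : nat) (G : (nat -> K) -> K) (sg : nat -> K) : K :=
  match m with
  | O => G sg
  | S m' => (sign_avg m' G (sign_set sg m' 1) + sign_avg m' G (sign_set sg m' (-1))) / 2
  end.

Variables (N : nat) (G : (nat -> K) -> K).
Hypothesis G_ge0 : forall sg, 0 <= G sg.
Hypothesis G_ext : forall sg sg', (forall j, (j < N)%nat -> sg j = sg' j) -> G sg = G sg'.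

Let is_sign (sg : nat -> K) := forall j, sg j = 1 \/ sg j = -1.

Let cell (sg : nat -> K) : set Omega :=
  (\bigcap_(j in [set` seq.iota O N]) (eps j @^-1` [set sg j]))%classic.

Let measurable_level (j : nat) (v : K) : measurable (eps j @^-1` [set v])%classic.
Proof. by rewrite -[X in measurable X]setTI; apply: measurable_funPT. Qed.

Let measurable_cell sg : measurable (cell sg).
Proof.
apply: fin_bigcap_measurable; first exact: finite_seq.
by move=> j _; apply: measurable_level.
Qed.

Let cell_prob sg : is_sign sg -> P (cell sg) = ((2^-1) ^+ N)%:E.
Proof.
move=> hs; rewrite /cell (heps.1 (seq.iota O N) (fun j => [set sg j]%classic)) ?iota_uniq //.
have -> : (\prod_(j <- seq.iota O N) P (eps j @^-1` [set sg j])%classic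
   = \prod_(j <- seq.iota O N) (2^-1 : K)%:E)%E.
  apply: eq_bigr => j _.
  by case: (hs j) => ->; [exact: (heps.2 j).1|exact: (heps.2 j).2].
have prodE n a : (\prod_(j <- seq.iota a n) (2^-1 : K)%:E = ((2^-1) ^+ n)%:E)%E.
  elim: n a => [|n IH] a; first by rewrite big_nil expr0.
  by rewrite /= big_cons IH exprS EFinM.
exact: prodE.
Qed.

(** The simple function that equals [G] on each cell of prescribed signs. The recursion follows
    [sign_avg] without the halving, which the probability of a cell supplies. *)
Let Fixpoint phi (m : nat) (sg : nat -> K) (w : Omega) : K :=
  match m with
  | O => G sg * \1_(cell sg) w
  | S m' => phi m' (sign_set sg m' 1) w + phi m' (sign_set sg m' (-1)) w
  end.

Let phi_ge0 m sg w : 0 <= phi m sg w.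
Proof.
elim: m sg => [|m IH] sg /=; first by rewrite mulr_ge0.
by rewrite addr_ge0.
Qed.

Let measurable_phi m sg : measurable_fun setT (phi m sg).
Proof.
elim: m sg => [|m IH] sg /=.
  by apply: measurable_realfun.measurable_funM => //; apply: measurable_realfun.measurable_indic; apply: measurable_cell.
by apply: measurable_realfun.measurable_funD.
Qed.

Let is_sign_set sg m v : is_sign sg -> v = 1 \/ v = -1 -> is_sign (sign_set sg m v).
Proof. by move=> hs hv j; rewrite /sign_set; case: ifP. Qed.

Let integral_phi m sg : is_sign sg ->
  (\int[P]_w (phi m sg w)%:E = ((2^-1) ^+ N * 2 ^+ m * sign_avg m G sg)%:E)%E.
Proof.
elim: m sg => [|m IH] sg hs /=.
  under eq_integral do rewrite EFinM.
  rewrite ge0_integralZl_EFin //; last first.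
    by apply/measurable_realfun.measurable_EFinP; apply: measurable_realfun.measurable_indic; apply: measurable_cell.
  rewrite integral_indic ?setIT //.
  transitivity ((G sg)%:E * ((2^-1) ^+ N)%:E)%E.
    by congr (_ * _)%E; exact: cell_prob.
  by rewrite -EFinM expr0 mulr1 mulrC.
under eq_integral do rewrite EFinD.
rewrite ge0_integralD //.
- rewrite !IH; [|by apply: is_sign_set; auto..].
  rewrite -EFinD; congr (_%:E).
  rewrite exprS -mulrDr -!mulrA; congr (_ * _).
  rewrite [RHS]mulrCA; congr (_ * _).
  by rewrite mulrC divfK // pnatr_eq0.
- by move=> w _; rewrite lee_fin phi_ge0.
- by apply/measurable_realfun.measurable_EFinP; apply: measurable_phi.
- by move=> w _; rewrite lee_fin phi_ge0.
- by apply/measurable_realfun.measurable_EFinP; apply: measurable_phi.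
Qed.

(** The union of the cells over which [phi m sg] sums: signs below [m] are free, those from [m] on
    are prescribed. *)
Let matches (m : nat) (sg : nat -> K) (w : Omega) : Prop :=
  forall j, (j < N)%nat ->
    ((m <= j)%nat -> eps j w = sg j) /\ ((j < m)%nat -> eps j w = 1 \/ eps j w = -1).

Let one_neq : (1 : K) <> -1.
Proof.
move=> h; have : (1 + 1 : K) != 0 by rewrite (pnatr_eq0 K 2).
by rewrite {2}h subrr eqxx.
Qed.

Let phi_matches m sg w : (m <= N)%nat ->
  (matches m sg w -> phi m sg w = G (fun j => eps j w)) /\
  (~ matches m sg w -> phi m sg w = 0).
Proof.
elim: m sg => [|m IH] sg hm /=.
  have cellE : matches O sg w <-> cell sg w.
    split=> [h j /=|h j hj].
      by rewrite mem_iota add0n => /andP[_ hj]; apply: (h j hj).1.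
    by split=> // _; apply: (h j); rewrite /= mem_iota.
  split=> [h|h].
    rewrite indicE mem_set ?mulr1; last exact/cellE.
    by apply: G_ext => j hj; rewrite (h j hj).1.
  rewrite indicE memNset ?mulr0 //.
  by move=> /cellE.
have hm' : (m <= N)%nat by apply: ltnW.
have [p1 p0] := IH (sign_set sg m 1) hm'.
have [q1 q0] := IH (sign_set sg m (-1)) hm'.
have stepE v : v = 1 \/ v = -1 -> matches m.+1 sg w -> eps m w = v -> matches m (sign_set sg m v) w.
  move=> hv h he j hj; split=> [hmj|hjm].
    rewrite /sign_set; case: eqP => [->//|/eqP hne].
    by apply: (h j hj).1; rewrite ltn_neqAle eq_sym hne.
  by apply: (h j hj).2; rewrite ltnS ltnW.
have backE v : v = 1 \/ v = -1 -> matches m (sign_set sg m v) w -> matches m.+1 sg w /\ eps m w = v.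
  move=> hv h; have hemv : eps m w = v.
    by have := (h m hm).1 (leqnn m); rewrite /sign_set eqxx.
  split=> // j hj; split=> [hmj|hjm].
    have := (h j hj).1 (ltnW hmj); rewrite /sign_set gtn_eqF //.
  move: hjm; rewrite ltnS leq_eqVlt => /orP[/eqP ->|hjm]; first by rewrite hemv.
  exact: (h j hj).2.
split=> h.
- case: ((h m hm).2 (ltnSn m)) => hv.
    rewrite p1; last by apply: stepE => //; left.
    rewrite q0 ?addr0 // => /(backE _ (or_intror erefl)) [_ hv'].
    exact: (one_neq (etrans (esym hv) hv')).
  rewrite q1; last by apply: stepE => //; right.
  rewrite p0 ?add0r // => /(backE _ (or_introl erefl)) [_ hv'].
  exact: (one_neq (etrans (esym hv') hv)).
- rewrite p0 ?q0 ?addr0 //.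
    by move=> /(backE _ (or_intror erefl)) [].
  by move=> /(backE _ (or_introl erefl)) [].
Qed.

(** The two values have total probability 1, so other values of [eps j] are possible on a null set.
    There [phi] may vanish while [G] does not. *)
Let ae_sign : {ae P, forall w, forall j, eps j w = 1 \/ eps j w = -1}.
Proof.
apply: ae_foralln => j.
set A := (eps j @^-1` [set 1] `|` eps j @^-1` [set -1])%classic.
have mA : measurable A by apply: measurableU; apply: measurable_level.
have pA : P A = 1%E.
  have disj : (eps j @^-1` [set 1] `&` eps j @^-1` [set -1] = set0)%classic.
    apply/seteqP; split=> w //= [h1 h2]; apply: one_neq.
    exact: etrans (esym h1) h2.
  have -> : (1 = (2^-1 : K)%:E + (2^-1 : K)%:E)%E.
    by rewrite -EFinD -[X in (X + _)%:E]mul1r -[X in (_ + X)%:E]mul1r -splitr.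
  rewrite -{1}(heps.2 j).1 -(heps.2 j).2.
  exact: (measureU P (measurable_level j 1) (measurable_level j (-1)) disj).
have pC : P (~` A)%classic = 0%E by rewrite probability_setC // pA subee.
exists (~` A)%classic; split; [exact: measurableC|exact: pC|].
by move=> w /= h h'; apply: h.
Qed.

(* [G] is not assumed measurable: the integrand agrees almost everywhere with
   a simple function below it, which determines its integral. *)
Lemma integral_rademacher :
  (\int[P]_w (G (fun j => eps j w))%:E = (sign_avg N G (fun _ => 1))%:E)%E.
Proof.
have hs : is_sign (fun _ => 1) by move=> j; left.
have E := integral_phi N (fun _ => 1) hs.
rewrite -exprMn mulVf ?expr1n ?mul1r in E; last by rewrite pnatr_eq0.
rewrite -E; apply/eqP; rewrite eq_le; apply/andP; split.
- rewrite ge0_integralTE; last by move=> w; rewrite lee_fin.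
  apply: ge_ereal_sup => _ [h hle <-].
  rewrite -integralT_nnsfun.
  apply: ae_ge0_le_integral => //.
  + by move=> w _; rewrite lee_fin; exact: fun_ge0.
  + by apply/measurable_realfun.measurable_EFinP; exact: measurable_funPT.
  + by move=> w _; rewrite lee_fin phi_ge0.
  + by apply/measurable_realfun.measurable_EFinP; apply: measurable_phi.
  + apply: filterS ae_sign => w hw _.
    have [h1 _] := phi_matches N (fun _ => 1) w (leqnn N).
    rewrite h1; first exact: hle.
    by move=> j hj; split=> // hNj; move: hj; rewrite ltnNge hNj.
(* [phi] is [G] or 0 at every point, so each simple function below [phi] is also below [G]. *)
- rewrite ge0_integralTE; last by move=> w; rewrite lee_fin phi_ge0.
  rewrite ge0_integralTE; last by move=> w; rewrite lee_fin.
  apply: le_ereal_sup => _ [h hle <-]; exists h => //= w.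
  apply: le_trans (hle w) _; rewrite lee_fin.
  have [h1 h0] := phi_matches N (fun _ => 1) w (leqnn N).
  by case: (pselect (matches N (fun _ => 1) w)) => [/h1 ->|/h0 ->].
Qed.

End RademacherAverage.

(** * Averages over finitely many signs *)

Definition sign_update (sg : nat -> R) (m : nat) (v : R) : nat -> R := sign_set realR sg m v.

Fixpoint ravg (m : nat) (G : (nat -> R) -> R) (sg : nat -> R) : R :=
  match m with
  | O => G sg
  | S m' => (ravg m' G (sign_update sg m' 1) + ravg m' G (sign_update sg m' (-1))) / 2
  end.

Lemma sign_avg_R m G (sg : nat -> R) : sign_avg realR m G sg = ravg m G sg.
Proof.
by elim: m sg => [|m IH] sg //=.
Qed.

Definition sign_fun (sg : nat -> R) : Prop := forall j, sg j = 1 \/ sg j = -1.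

Lemma sign_fun_set (sg : nat -> R) (m : nat) (v : R) : sign_fun sg -> v = 1 \/ v = -1 -> sign_fun (sign_update sg m v).
Proof. by move=> hs hv j; rewrite /sign_update /sign_set; case: ifP. Qed.

Lemma ravg_le m (G G' : (nat -> R) -> R) sg : sign_fun sg ->
  (forall sg', sign_fun sg' -> G sg' <= G' sg') -> ravg m G sg <= ravg m G' sg.
Proof.
intros Hs H; revert sg Hs; induction m as [|m IH]; intros sg Hs; [apply H, Hs|cbn [ravg]].
assert (H1 := IH _ (sign_fun_set sg m 1 Hs (or_introl erefl))).
assert (H2 := IH _ (sign_fun_set sg m (-1) Hs (or_intror erefl))).
lra.
Qed.

Lemma ravg_const m (c : R) sg : ravg m (fun _ => c) sg = c.
Proof. revert sg; induction m as [|m IH]; intros sg; [reflexivity|cbn [ravg]]; rewrite !IH; field. Qed.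

Lemma ravg_scal m (c : R) G sg : ravg m (fun s => c * G s) sg = c * ravg m G sg.
Proof. revert sg; induction m as [|m IH]; intros sg; [reflexivity|cbn [ravg]]; rewrite !IH; field. Qed.

(** Jensen's inequality: convexity of the square, applied once for each sign. *)
Lemma ravg_square m G sg : ravg m G sg ^ 2 <= ravg m (fun s => G s ^ 2) sg.
Proof.
revert sg; induction m as [|m IH]; intros sg; [apply Rle_refl|].
change (((ravg m G (sign_update sg m 1) + ravg m G (sign_update sg m (-1))) / 2) ^ 2
  <= (ravg m (fun s => G s ^ 2) (sign_update sg m 1)
      + ravg m (fun s => G s ^ 2) (sign_update sg m (-1))) / 2).
assert (H1 := IH (sign_update sg m 1)); assert (H2 := IH (sign_update sg m (-1))).
assert (H3 := pow2_ge_0 (ravg m G (sign_update sg m 1) - ravg m G (sign_update sg m (-1)))).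
nra.
Qed.

(** Averaging overwrites only the signs below [m]; the two functions may therefore be compared with
    the higher signs known, in particular with one that has just been set. *)
Lemma ravg_ext m G G' sg :
  (forall sg', (forall j, (m <= j)%coq_nat -> sg' j = sg j) -> G sg' = G' sg') ->
  ravg m G sg = ravg m G' sg.
Proof.
revert sg; induction m as [|m IH]; intros sg H; cbn [ravg].
{ apply H; reflexivity. }
rewrite (IH (sign_update sg m 1)) ?(IH (sign_update sg m (-1))) //.
- intros sg' H'; apply H; intros j Hj; rewrite H'; [|lia].
  rewrite /sign_update /sign_set; case: eqP => // E; lia.
- intros sg' H'; apply H; intros j Hj; rewrite H'; [|lia].
  rewrite /sign_update /sign_set; case: eqP => // E; lia.
Qed.

(** Starts from the empty sum, unlike [sum_n], so that an induction over the signs has a trivial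
    base case. *)
Fixpoint lsum {G : AbelianMonoid} (u : nat -> G) (m : nat) : G :=
  match m with O => zero | S m' => plus (lsum u m') (u m') end.

Lemma sum_n_lsum {G : AbelianMonoid} (u : nat -> G) n : sum_n u n = lsum u (S n).
Proof.
induction n as [|n IH]; [rewrite sum_O; simpl; symmetry; apply plus_zero_l|].
rewrite sum_Sn IH; reflexivity.
Qed.

(** * Rademacher bounds for sums of operators *)

Section RademacherBounds.
Context {d : measure_display} {Omega : measurableType d} {P : probability Omega realR}
  (eps : nat -> {RV P >-> realR}) (heps : rademacher eps).
Context {X : CompleteNormedModule C_AbsRing}.
Notation BX := (bddop_CompleteNormedModule X).

Definition signed_sum {V : ModuleSpace C_AbsRing} (x : nat -> V) (n : nat) (sg : nat -> R) : V :=
  sum_n (fun k => cscal (RtoC (sg k)) (x k)) n.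

Lemma rad_norm_avg (n : nat) (x : nat -> X) :
  rad_norm eps n x = sqrt (ravg (S n) (fun sg => norm (signed_sum x n sg) ^ 2) (fun _ => 1)).
Proof.
unfold rad_norm; f_equal.
rewrite (integral_rademacher realR d Omega P eps heps (S n) (fun sg => norm (signed_sum x n sg) ^ 2)).
- rewrite sign_avg_R; reflexivity.
- intros sg; apply/RleP; apply pow2_ge_0.
- intros sg sg' H; f_equal; f_equal; unfold signed_sum.
  apply sum_n_ext_loc; intros k Hk; rewrite H //; apply/ltP; lia.
Qed.

Lemma rad_norm_le (n : nat) (x : nat -> X) (B : R) : 0 <= B ->
  (forall sg, sign_fun sg -> norm (signed_sum x n sg) <= B) -> rad_norm eps n x <= B.
Proof.
intros HB H; rewrite rad_norm_avg -(sqrt_pow2 B HB); apply sqrt_le_1_alt.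
rewrite -(ravg_const (S n) (B ^ 2) (fun _ => 1)); apply ravg_le.
- intros j; left; reflexivity.
- intros sg Hs; apply pow_incr; split; [apply norm_ge_0|apply H, Hs].
Qed.

(* Averaging over one more sign cancels the cross terms. *)
Lemma diagonal_average (T : nat -> bddop X) (y : nat -> X) (m : nat) (sg : nat -> R)
    (Y : bddop X) (W : X) :
  norm (plus (lsum (fun k => T k (y k)) m) (Y W)) <=
  ravg m (fun s => norm (bddop_plus Y (lsum (fun k => cscal (RtoC (s k)) (T k)) m)
    (plus W (lsum (fun k => cscal (RtoC (s k)) (y k)) m)))) sg.
Proof.
(* [Y] and [W] collect the operator and vector terms whose signs are already fixed; they change from
   one sign to the next. *)
revert sg Y W; induction m as [|m IH]; intros sg Y W.
{ cbn [lsum ravg].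
  change (norm (plus zero (Y W)) <= norm (plus (Y (plus W zero)) zero)).
  rewrite plus_zero_l !plus_zero_r; apply Rle_refl. }
cbn [ravg].
assert (Hv : forall v : R, v = 1 \/ v = -1 ->
  ravg m (fun s => norm (bddop_plus Y (lsum (fun k => cscal (RtoC (s k)) (T k)) (S m))
    (plus W (lsum (fun k => cscal (RtoC (s k)) (y k)) (S m))))) (sign_update sg m v)
  = ravg m (fun s => norm (bddop_plus (bddop_plus Y (cscal (RtoC v) (T m)))
      (lsum (fun k => cscal (RtoC (s k)) (T k)) m)
    (plus (plus W (cscal (RtoC v) (y m))) (lsum (fun k => cscal (RtoC (s k)) (y k)) m))))
    (sign_update sg m v)).
{ intros v _; apply ravg_ext; intros s Hs.
  assert (Em : s m = v) by (rewrite Hs // /sign_update /sign_set eqxx; reflexivity).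
  cbn [lsum]; rewrite Em; f_equal.
  set (S1 := lsum _ m); set (w1 := lsum _ m).
  assert (Ew : plus W (plus w1 (cscal (RtoC v) (y m)))
    = plus (plus W (cscal (RtoC v) (y m))) w1) by mring X.
  rewrite Ew; set (w2 := plus (plus W _) w1).
  change (plus (Y w2) (plus (S1 w2) (cscal (RtoC v) (T m w2)))
    = plus (plus (Y w2) (cscal (RtoC v) (T m w2))) (S1 w2)).
  mring X. }
rewrite (Hv 1 (or_introl erefl)) (Hv (-1) (or_intror erefl)).
assert (H1 := IH (sign_update sg m 1) (bddop_plus Y (cscal (RtoC 1) (T m)))
  (plus W (cscal (RtoC 1) (y m)))).
assert (H2 := IH (sign_update sg m (-1)) (bddop_plus Y (cscal (RtoC (-1)) (T m)))
  (plus W (cscal (RtoC (-1)) (y m)))).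
set (r1 := ravg m _ _) in H1 |- *; set (r2 := ravg m _ _) in H2 |- *.
cbn [lsum].
set (p := lsum (fun k => T k (y k)) m) in *.
assert (E : forall v : R, v * v = 1 -> bddop_plus Y (cscal (RtoC v) (T m))
  (plus W (cscal (RtoC v) (y m))) =
  plus (plus (Y W) (T m (y m))) (cscal (RtoC v) (plus (Y (y m)) (T m W)))).
{ intros v Hv2.
  change (plus (Y (plus W (cscal (RtoC v) (y m))))
    (cscal (RtoC v) (T m (plus W (cscal (RtoC v) (y m)))))
    = plus (plus (Y W) (T m (y m))) (cscal (RtoC v) (plus (Y (y m)) (T m W)))).
  rewrite (linear_plus _ (bddop_linear Y)) (linear_plus _ (bddop_linear (T m)))
    (linear_scal _ (bddop_linear Y)) (linear_scal _ (bddop_linear (T m))).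
  assert (Hc : Cmult (RtoC v) (RtoC v) = RtoC 1) by (rewrite -RtoC_mult Hv2; reflexivity).
  mreduce X; Cnorm; try ring.
  all: ring_simplify; rewrite ?Hc; try ring.
  all: transitivity (Cmult (RtoC v) (RtoC v)); [ring|rewrite Hc; ring]. }
rewrite E in H1; [|ring]; rewrite E in H2; [|ring].
set (a := plus (Y W) (T m (y m))) in *; set (b := plus (Y (y m)) (T m W)) in *.
assert (Eab : plus (plus p (T m (y m))) (Y W) = plus p a) by (unfold a; mring X).
rewrite Eab.
assert (Eh : plus p a = cscal (RtoC (/ 2))
  (plus (plus p (plus a (cscal (RtoC 1) b))) (plus p (plus a (cscal (RtoC (-1)) b))))).
{ assert (H2c : RtoC (/ 2) = Cinv (RtoC 2)) by (apply RtoC_inv; lra).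
  assert (Hm1 : RtoC (-1) = Copp (RtoC 1)) by (exact RtoC_m1).
  assert (H2' : RtoC 2 = Cplus (RtoC 1) (RtoC 1)) by (unfold Cplus, RtoC; simpl; f_equal; ring).
  assert (Hn : Cplus (RtoC 1) (RtoC 1) <> RtoC 0) by (rewrite -H2'; intros E0; injection E0; lra).
  rewrite H2c Hm1 H2'; mreduce X; Cnorm; field; exact Hn. }
rewrite Eh (norm_scal_C (X := X)) Cmod_R Rabs_pos_eq; [|lra].
assert (Tr := norm_triangle (V := X) (plus p (plus a (cscal (RtoC 1) b)))
  (plus p (plus a (cscal (RtoC (-1)) b)))).
lra.
Qed.

Lemma rademacher_diagonal (T : nat -> bddop X) (y : nat -> X) (n : nat) (B : R) :
  (forall sg, sign_fun sg -> norm (signed_sum T n sg) <= B) ->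
  norm (sum_n (fun k => T k (y k)) n) <= B * rad_norm eps n y.
Proof.
intros HB.
assert (HB0 : 0 <= B).
{ eapply Rle_trans; [|apply (HB (fun _ => 1))]; [apply norm_ge_0|intros j; left; reflexivity]. }
assert (H := diagonal_average T y (S n) (fun _ => 1) bddop_zero zero).
rewrite -(sum_n_lsum (fun k => T k (y k))) in H.
match type of H with norm (plus ?u ?v) <= _ =>
  assert (E : plus u v = u) by apply plus_zero_r; rewrite E in H; clear E end.
eapply Rle_trans; [exact H|].
rewrite rad_norm_avg.
apply Rle_trans with (ravg (S n) (fun s => B * norm (signed_sum y n s)) (fun _ => 1)).
- apply ravg_le; [intros j; left; reflexivity|]; intros s Hs.
  rewrite -(sum_n_lsum (fun k => cscal (RtoC (s k)) (T k)))
          -(sum_n_lsum (fun k => cscal (RtoC (s k)) (y k))).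
  rewrite plus_zero_l.
  change (norm (plus (zero : X) (signed_sum T n s (signed_sum y n s))) <= B * norm (signed_sum y n s)).
  rewrite plus_zero_l.
  eapply Rle_trans; [apply norm_bddop_le|].
  apply Rmult_le_compat_r; [apply norm_ge_0|apply HB, Hs].
(* From the mean of the norm to the quadratic mean of which [rad_norm] consists, by Jensen's
   inequality. *)
- rewrite ravg_scal; apply Rmult_le_compat_l; [exact HB0|].
  apply Rle_trans with (Rabs (ravg (S n) (fun s => norm (signed_sum y n s)) (fun _ => 1))); [apply Rle_abs|].
  rewrite -sqrt_Rsqr_abs Rsqr_pow2; apply sqrt_le_1_alt, ravg_square.
Qed.

(** Commutation writes T Q^2 as Q T Q. The left factor is removed by [rademacher_diagonal], the
    middle one by the R-bound, and the right one by the bound for every choice of signs, whence [B]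
    twice and [r] once. *)
Lemma rademacher_square_sum (Q T : nat -> bddop X) (n : nat) (B r : R) :
  0 <= r ->
  (forall sg, sign_fun sg -> norm (signed_sum Q n sg) <= B) ->
  (forall k, bddop_comp (T k) (Q k) = bddop_comp (Q k) (T k)) ->
  (forall x : nat -> X, rad_norm eps n (fun k => T k (x k)) <= r * rad_norm eps n x) ->
  norm (sum_n (fun k => bddop_comp (T k) (bddop_comp (Q k) (Q k))) n) <= B * (r * B).
Proof.
intros Hr HB Hcomm HT.
assert (HB0 : 0 <= B).
{ eapply Rle_trans; [|apply (HB (fun _ => 1))]; [apply norm_ge_0|intros j; left; reflexivity]. }
apply opnorm_le.
{ apply Rmult_le_pos; [|apply Rmult_le_pos]; assumption. }
intros x.
assert (E : forall (U : nat -> bddop X), (sum_n U n : bddop X) x = sum_n (fun k => U k x) n).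
{ intros U; rewrite !sum_n_lsum; generalize (S n) as m; induction m as [|m IH]; [reflexivity|].
  cbn [lsum]; rewrite -IH; reflexivity. }
rewrite E.
rewrite (sum_n_ext _ (fun k => Q k (T k (Q k x)))).
2:{ intros k; change (bddop_comp (T k) (bddop_comp (Q k) (Q k)) x = bddop_comp (Q k) (T k) (Q k x)).
    rewrite -Hcomm; reflexivity. }
eapply Rle_trans; [apply (rademacher_diagonal Q (fun k => T k (Q k x)) n B HB)|].
rewrite Rmult_assoc; apply Rmult_le_compat_l; [exact HB0|].
eapply Rle_trans; [apply HT|].
rewrite Rmult_assoc; apply Rmult_le_compat_l; [exact Hr|].
apply rad_norm_le.
{ apply Rmult_le_pos; [exact HB0|apply norm_ge_0]. }
intros sg Hs.
apply Rle_trans with (norm ((signed_sum Q n sg : bddop X) x)).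
{ right; f_equal; symmetry; exact (E (fun k => cscal (RtoC (sg k)) (Q k))). }
eapply Rle_trans; [apply norm_bddop_le|].
apply Rmult_le_compat_r; [apply norm_ge_0|apply HB, Hs].
Qed.

End RademacherBounds.

(** * Shifting the contour *)

Section ContourShift.
Context {V : CompleteNormedModule C_AbsRing}.

Lemma norm_minus_sym (u v : V) : norm (minus u v) = norm (minus v u).
Proof. rewrite -(norm_opp (minus v u)); f_equal; mring V. Qed.

Lemma norm_minus_le (u v : V) : norm (minus u v) <= norm u + norm v.
Proof.
unfold minus; norm_split V.
rewrite (norm_opp (V := V)); apply Rle_refl.
Qed.

(** The heights are not ordered because the contour is moved up for one ray and down for the
    other. *)
Lemma horizontal_shift (f : C -> V) (M c d B : R) : 0 <= M ->
  (forall x y, - M <= x <= M -> Rmin c d <= y <= Rmax c d -> exists D, cdiff f (x, y) D) ->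
  (forall y, Rmin c d <= y <= Rmax c d -> norm (f (M, y)) <= B /\ norm (f (- M, y)) <= B) ->
  norm (minus (RI (fun x => f (x, c)) (- M) M) (RI (fun x => f (x, d)) (- M) M))
    <= 2 * B * Rabs (d - c).
Proof.
intros HM.
assert (W : forall c d, c <= d ->
  (forall x y, - M <= x <= M -> c <= y <= d -> exists D, cdiff f (x, y) D) ->
  (forall y, c <= y <= d -> norm (f (M, y)) <= B /\ norm (f (- M, y)) <= B) ->
  norm (minus (RI (fun x => f (x, c)) (- M) M) (RI (fun x => f (x, d)) (- M) M))
    <= 2 * B * (d - c)).
{ clear c d; intros c d Hcd Hf HB.
  assert (G := goursat f (- M) M c d ltac:(lra) Hcd Hf); unfold boundary_int in G.
  assert (CV : forall x, - M <= x <= M -> cont_on (fun y => f (x, y)) c d).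
  { intros x Hx y Hy; rewrite Rmin_left in Hy; [|lra]; rewrite Rmax_right in Hy; [|lra].
    destruct (Hf x y Hx Hy) as [D HD]; apply ccont_vertical, (cdiff_ccont _ _ _ HD). }
  assert (V1 := RI_norm_const (fun y => f (M, y)) B c d Hcd (CV M ltac:(lra)) (fun y Hy => proj1 (HB y Hy))).
  assert (V2 := RI_norm_const (fun y => f (- M, y)) B c d Hcd (CV (- M) ltac:(lra)) (fun y Hy => proj2 (HB y Hy))).
  set (r1 := RI (fun y => f (M, y)) c d) in *; set (r2 := RI (fun y => f (- M, y)) c d) in *.
  match goal with |- norm (minus ?a ?b) <= _ => set (p := a) in *; set (q := b) in * end.
  replace (minus p q) with (cscal (Copp Ci) (minus r1 r2)).
  2:{ transitivity (plus (cscal (Copp Ci) (minus r1 r2)) (plus (minus p q) (cscal Ci (minus r1 r2)))).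
      - rewrite G; mring V.
      - mring V. }
  rewrite (norm_scal_C (X := V)) Cmod_opp.
  rewrite Cmod_Ci. assert (T := norm_minus_le r1 r2); lra. }
intros Hf HB; destruct (Rle_dec c d) as [Hcd|Hcd].
- rewrite Rmin_left // in Hf HB; rewrite Rmax_right // in Hf HB.
  rewrite Rabs_pos_eq; [|lra]; apply W; assumption.
- assert (Hdc : d <= c) by lra.
  rewrite Rmin_right // in Hf HB; rewrite Rmax_left // in Hf HB.
  rewrite norm_minus_sym Rabs_left1; [|lra].
  replace (- (d - c)) with (c - d) by ring; apply W; assumption.
Qed.

Lemma segment_uniform_continuity (f : C -> V) (t0 M : R) : 0 <= M ->
  (forall x, - M <= x <= M -> ccont f (x, t0)) ->
  forall e, 0 < e -> exists d, 0 < d /\ forall t x, Rabs t < d -> - M <= x <= M ->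
    norm (minus (f (x, t0 - t)) (f (x, t0))) <= e.
Proof.
intros HM Hf e He.
(* The radius is doubled so that one disc around [y] admits both a horizontal offset, from [y] to
   the nearby [x], and a vertical one. *)
assert (H : forall x, {d : posreal | - M <= x <= M -> forall u : C, Cmod u < 2 * d ->
  norm (minus (f (Cplus (x, t0) u)) (f (x, t0))) < e / 2}).
{ intros x; apply constructive_indefinite_description.
  destruct (classic (- M <= x <= M)) as [Hx|Hx].
  - destruct (Hf x Hx (e / 2)) as [d [Hd H]]; [lra|].
    exists (mkposreal (d / 2) ltac:(lra)); intros _ u Hu; apply H; simpl in Hu; lra.
  - exists (mkposreal 1 Rlt_0_1); intros H; contradiction. }
destruct (compactness_value_1d (- M) M (fun x => proj1_sig (H x))) as [d Hd].
exists d; split; [apply cond_pos|]; intros t x Ht Hx.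
apply Rnot_lt_le; intros Hlt; apply (Hd x Hx); intros [y [Hy [Hxy Hdy]]].
assert (HH := proj2_sig (H y) Hy); set (r := proj1_sig (H y)) in *.
assert (Hr := cond_pos r); assert (H1 := HH (x - y, - t)); assert (H2 := HH (x - y, 0)).
assert (E1 : Cplus (y, t0) (x - y, - t) = (x, t0 - t)) by (unfold Cplus; simpl; f_equal; ring).
assert (E2 : Cplus (y, t0) (x - y, 0) = (x, t0)) by (unfold Cplus; simpl; f_equal; ring).
rewrite E1 in H1; rewrite E2 in H2.
assert (B1 : norm (minus (f (x, t0 - t)) (f (y, t0))) < e / 2).
{ apply H1; eapply Rle_lt_trans; [apply Cmod_le_sum|]; rewrite Rabs_Ropp; lra. }
assert (B2 : norm (minus (f (x, t0)) (f (y, t0))) < e / 2).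
{ apply H2; eapply Rle_lt_trans; [apply Cmod_le_sum|]; rewrite Rabs_R0; lra. }
apply (Rlt_not_le _ _ Hlt).
replace (minus (f (x, t0 - t)) (f (x, t0))) with
  (minus (minus (f (x, t0 - t)) (f (y, t0))) (minus (f (x, t0)) (f (y, t0)))) by mring V.
eapply Rle_trans; [apply norm_minus_le|]; lra.
Qed.

Lemma RI_fold (f : R -> V) (a g : R) (n : nat) : (forall s, continuous f s) ->
  RI f a (a + INR (S n) * g) = RI (fun t => sum_n (fun j => f (a + t + INR j * g)) n) 0 g
  /\ forall t, continuous (fun t => sum_n (fun j => f (a + t + INR j * g)) n : V) t.
Proof.
intros Hf.
assert (Cs : forall k t, continuous (fun t => f (a + t + k)) t).
{ intros k t; apply (continuous_comp (fun t => a + t + k) f); [|apply Hf].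
  apply: ex_derive_continuous; auto_derive; exact I. }
assert (Sh : forall k, RI f (a + k) (a + k + g) = RI (fun t => f (a + t + k)) 0 g).
{ intros k; symmetry; apply RI_unique.
  apply (@is_RInt_ext (toR V) (fun t => cscal (RtoC 1) (f (1 * t + (a + k))))).
  { intros t _; rewrite Rmult_1_l; replace (t + (a + k)) with (a + t + k) by ring.
    apply: scal_one. }
  apply (@is_RInt_comp_lin (toR V) f 1 (a + k) 0 g).
  replace (1 * 0 + (a + k)) with (a + k) by ring.
  replace (1 * g + (a + k)) with (a + k + g) by ring.
  apply RI_correct, cont_everywhere, Hf. }
induction n as [|n [IH1 IH2]].
- assert (E : forall t, f (a + t + INR 0 * g) = sum_n (fun j => f (a + t + INR j * g)) 0).
  { intros t; rewrite sum_O; reflexivity. }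
  split.
  + transitivity (RI (fun t => f (a + t + INR 0 * g)) 0 g); [|apply RI_ext; intros t _; apply E].
    rewrite -Sh; f_equal; simpl; ring.
  + intros t; apply (continuous_ext _ _ t E), Cs.
- assert (E : forall t, plus (sum_n (fun j => f (a + t + INR j * g)) n) (f (a + t + INR (S n) * g))
    = sum_n (fun j => f (a + t + INR j * g)) (S n)).
  { intros t; rewrite sum_Sn; reflexivity. }
  split.
  + transitivity (RI (fun t => plus (sum_n (fun j => f (a + t + INR j * g)) n) (f (a + t + INR (S n) * g))) 0 g);
      [|apply RI_ext; intros t _; apply E].
    rewrite RI_plus; [|intros t _; apply IH2|intros t _; apply Cs].
    rewrite -IH1 -Sh.
    rewrite RI_Chasles; [|apply cont_everywhere, Hf|apply cont_everywhere, Hf].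
    f_equal; rewrite (S_INR (S n)); ring.
  + intros t; apply (continuous_ext _ _ t E), continuous_plusV; [apply IH2|apply Cs].
Qed.

End ContourShift.

Lemma inv_2ipi_eq : inv_2ipi = Cmult (RtoC (/ (2 * PI))) (Copp Ci).
Proof.
assert (HP := PI_RGT_0).
assert (Hi : Cmult Ci (Copp Ci) = RtoC 1) by (unfold Cmult, Ci, Copp, RtoC; simpl; f_equal; ring).
assert (Hr : Cmult (RtoC (2 * PI)) (RtoC (/ (2 * PI))) = RtoC 1).
{ rewrite -RtoC_mult Rinv_r; [reflexivity|lra]. }
unfold inv_2ipi.
transitivity (Cmult (Cinv (Cmult (RtoC (2 * PI)) Ci))
  (Cmult (Cmult (RtoC (2 * PI)) (RtoC (/ (2 * PI)))) (Cmult Ci (Copp Ci)))).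
{ rewrite Hi Hr; ring. }
transitivity (Cmult (Cmult (Cinv (Cmult (RtoC (2 * PI)) Ci)) (Cmult (RtoC (2 * PI)) Ci))
  (Cmult (RtoC (/ (2 * PI))) (Copp Ci))); [ring|].
rewrite Cinv_l; [ring|apply inv_2ipi_neq].
Qed.

Lemma pair_shift (x y t z : R) : y + t = z -> Cplus (x, y) (0, t) = (x, z).
Proof. intros <-; unfold Cplus; simpl; f_equal; ring. Qed.

(** * From the Poisson average on the axis to the contour integral *)

Section OperatorCalculus.
Context {X : CompleteNormedModule C_AbsRing}.
Variable A : operator X.
Hypothesis hA0 : omega_of A = Finite 0.
Notation BX := (bddop_CompleteNormedModule X).
Notation S := (logres A).

(* [S - S^2] is the derivative of [S], so this is the first order expansion of
   [S (w - i t)]. *)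
Definition shifted_logres (t : R) (w : C) : bddop X :=
  minus (S w) (cscal (Cmult Ci (RtoC t)) (minus (S w) (bddop_comp (S w) (S w)))).

Lemma tan_bound (g : R) : 0 < g <= 1 -> 0 < tan g <= 2 * g.
Proof.
intros Hg; assert (HP := PI2_1).
assert (Hs := Rabs_sin_le g); rewrite (Rabs_pos_eq g) in Hs; [|lra].
assert (Hs1 : 0 < sin g) by (apply sin_gt_0; lra).
rewrite Rabs_pos_eq in Hs; [|lra].
assert (Hc := cos_quadratic g).
assert (Hc1 : / 2 <= cos g) by nra.
unfold tan; split; [apply Rdiv_lt_0_compat; lra|].
apply (Rmult_le_reg_r (cos g)); [lra|].
replace (sin g / cos g * cos g) with (sin g) by (field; lra); nra.
Qed.

(* Squaring the Poisson kernel produces exactly the first order expansion: there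
   is no remainder in [g]. *)
Lemma poisson_op_square (g s : R) : 0 < g <= 1 ->
  cscal (RtoC (2 * PI * tan g)) (bddop_comp (poisson_op A g s) (poisson_op A g s))
  = cscal inv_2ipi
      (minus (shifted_logres (- tan g) (s, - g)) (shifted_logres (tan g) (s, g))).
Proof.
intros Hg; assert (HP := PI2_1).
assert (Hs1 : 0 < sin g) by (apply sin_gt_0; lra).
assert (Hc1 : 0 < cos g) by (apply cos_gt_0; lra).
assert (Hcos : cos g < 1) by (rewrite -cos_0; apply cos_decreasing_1; lra).
assert (Rp : resolvent_set A (cexp (s, g))) by (apply off_axis_resolvent_set; assumption).
assert (Rm : resolvent_set A (cexp (s, - g))).
{ apply off_axis_resolvent_set; [assumption|]; simpl; rewrite cos_neg; exact Hcos. }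
assert (Ep := logres_product A (s, - g) (s, g) Rm Rp).
assert (Ec : bddop_comp (S (s, g)) (S (s, - g)) = bddop_comp (S (s, - g)) (S (s, g))).
{ apply logres_commute; [assumption|exact Hcos|simpl; rewrite cos_neg; exact Hcos]. }
set (Sp := S (s, g)) in *; set (Sm := S (s, - g)) in *.
set (a := RtoC (exp s)); set (c := RtoC (cos g)); set (sn := RtoC (sin g)).
assert (Ha : a <> RtoC 0) by (intros H; injection H; assert (H' := exp_pos s); lra).
assert (Hc : c <> RtoC 0) by (intros H; injection H; lra).
assert (Hsn : sn <> RtoC 0) by (intros H; injection H; lra).
assert (Hi : Ci <> RtoC 0) by (intros H; injection H; lra).
assert (H2 : Cplus (RtoC 1) (RtoC 1) <> RtoC 0) by (intros H; injection H; lra).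
assert (E1 : cexp (s, g) = Cmult a (Cplus c (Cmult Ci sn))).
{ unfold cexp, a, c, sn, Cmult, Cplus, RtoC, Ci; simpl; f_equal; ring. }
assert (E2 : cexp (s, - g) = Cmult a (Cminus c (Cmult Ci sn))).
{ unfold cexp, a, c, sn, Cmult, Cplus, Cminus, Copp, RtoC, Ci; simpl; rewrite cos_neg sin_neg; f_equal; ring. }
assert (Et : RtoC (tan g) = Cdiv sn c) by (unfold tan; rewrite RtoC_div; [reflexivity|lra]).
assert (Hd : Cminus (cexp (s, g)) (cexp (s, - g)) <> RtoC 0).
{ rewrite E1 E2; replace (Cminus _ _) with (Cmult (Cplus (RtoC 1) (RtoC 1)) (Cmult a (Cmult Ci sn))) by ring.
  repeat apply Cmult_neq_0; assumption. }
(* As e^(i g) / (2 i sin g) = (1 - i cot g) / 2, this reads 2 Sm Sp = (Sm + Sp) - i cot g (Sm - Sp).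
   Multiplication of P^2 by tan g turns the last term into Sm - Sp and leaves the terms S - S^2 with
   weight tan g. *)
assert (Emix : bddop_comp Sm Sp = cscal (Cinv (Cminus (cexp (s, g)) (cexp (s, - g))))
  (minus (cscal (cexp (s, g)) Sm) (cscal (cexp (s, - g)) Sp))).
{ rewrite -Ep; mreduce BX; Cnorm; field; exact Hd. }
assert (Epp : bddop_comp (poisson_op A g s) (poisson_op A g s)
  = cscal (Cmult inv_2ipi inv_2ipi)
     (plus (plus (bddop_comp Sm Sm) (bddop_comp Sp Sp))
       (cscal (Copp (Cplus (RtoC 1) (RtoC 1))) (bddop_comp Sm Sp)))).
{ unfold poisson_op; fold Sp Sm; rewrite comp_scal_l comp_scal_r comp_minus_r.
  rewrite /minus !comp_plus_l !comp_opp_l Ec; mring BX. }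
rewrite Epp Emix; unfold shifted_logres; fold Sp Sm.
assert (Er : Cmult (RtoC (2 * PI * tan g)) inv_2ipi = Cmult (Copp Ci) (Cdiv sn c)).
{ rewrite inv_2ipi_eq -Et RtoC_mult.
  transitivity (Cmult (Cmult (RtoC (2 * PI)) (RtoC (/ (2 * PI)))) (Cmult (Copp Ci) (RtoC (tan g)))); [ring|].
  rewrite -RtoC_mult Rinv_r; [ring|lra]. }
transitivity (cscal (Cmult (Cmult (RtoC (2 * PI * tan g)) inv_2ipi) inv_2ipi)
   (plus (plus (bddop_comp Sm Sm) (bddop_comp Sp Sp))
       (cscal (Copp (Cplus (RtoC 1) (RtoC 1))) (cscal (Cinv (Cminus (cexp (s, g)) (cexp (s, - g))))
  (minus (cscal (cexp (s, g)) Sm) (cscal (cexp (s, - g)) Sp)))))).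
{ mring BX. }
rewrite Er RtoC_opp Et E1 E2.
rewrite E1 E2 in Hd.
mreduce BX; Cnorm; field; repeat split; assumption.
Qed.

Lemma cdiff_shifted_logres (t : R) (w : C) : cos (snd w) < 1 -> exists D, cdiff (shifted_logres t : C -> BX) w D.
Proof.
intros Hw; assert (H := cdiff_logres A hA0 w Hw).
assert (H2 := cdiff_comp _ _ _ _ _ H H).
assert (E : forall z, plus (S z : BX) (cscal (Copp (Cmult Ci (RtoC t)))
  (plus (S z : BX) (cscal (RtoC (-1)) (bddop_comp (S z) (S z) : BX)))) = shifted_logres t z).
{ intros z; unfold shifted_logres; rewrite RtoC_m1; mring BX. }
eexists; apply (cdiff_ext _ _ w _ _ E (erefl _)).
apply cdiff_plus; [exact H|apply cdiff_scal, cdiff_plus; [exact H|apply cdiff_scal; exact H2]].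
Qed.

Lemma norm_shifted_logres (t K : R) (w : C) : norm (S w) <= K ->
  norm (shifted_logres t w) <= K + Rabs t * (K + K ^ 2).
Proof.
intros HK; unfold shifted_logres.
assert (H0 := opnorm_ge_0 (S w)); change (0 <= norm (S w)) in H0.
eapply Rle_trans; [apply (norm_minus_le (V := BX))|]; apply Rplus_le_compat; [exact HK|].
rewrite (norm_scal_C (X := BX)) Cmod_mult Cmod_R.
rewrite Cmod_Ci. rewrite Rmult_1_l; apply Rmult_le_compat_l; [apply Rabs_pos|].
eapply Rle_trans; [apply (norm_minus_le (V := BX))|]; apply Rplus_le_compat; [exact HK|].
eapply Rle_trans; [apply norm_comp|].
simpl; rewrite Rmult_1_r; apply Rmult_le_compat; assumption.
Qed.

Variables (theta : R) (F : C -> bddop X).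
Hypotheses (Htheta : 0 < theta < PI) (HF : H0inf_commutant A theta F).

Let h (w : C) : bddop X := F (cexp w).

Let h_cdiff (w : C) : Rabs (snd w) < theta -> exists D, cdiff (h : C -> BX) w D.
Proof.
intros Hw; destruct (proj1 (proj1 HF) (cexp w) (cexp_sector _ _ Hw)) as [D HD].
exists (cscal (cexp w) D); apply (cdiff_comp_cexp (V := BX) F).
apply (is_derive_cdiff (V := BX)); exact HD.
Qed.

Let h_decay : exists c k, 0 < c /\ 0 < k /\
  forall w, Rabs (snd w) < theta -> norm (h w) <= c * exp (- (k * Rabs (fst w))).
Proof.
destruct (proj2 (proj2 (proj1 HF))) as [k [c [Hk [Hc H]]]].
exists c, k; repeat split; [exact Hc|exact Hk|]; intros w Hw.
rewrite exp_Rabs_Rmin; [|exact Hk]; rewrite -Cmod_cexp; apply H, cexp_sector, Hw.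
Qed.

Let cos_le (g t : R) : 0 < g <= Rabs t -> Rabs t <= PI -> cos t <= cos g.
Proof. intros H1 H2; rewrite (cos_Rabs t); apply cos_decr_1; lra. Qed.

Let cos_lt (t : R) : 0 < Rabs t <= PI -> cos t < 1.
Proof. intros H; rewrite cos_Rabs -cos_0; apply cos_decreasing_1; lra. Qed.

(** The increment is tan t and not t because this is the weight in [poisson_op_square]; F is
    evaluated on the positive axis only. *)
Definition shifted_line (t : R) (s : R) : BX :=
  bddop_comp (h (s, 0)) (shifted_logres (tan t) (s, t)).

(** The two factors are taken at points that differ by i t. Moving the contour moves both and keeps
    this gap. *)
Let product_cdiff (f : C -> bddop X) (t : R) (w : C) (D : BX) : Rabs (snd w) < theta ->
  cdiff (f : C -> BX) (Cplus w (0, t)) D ->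
  exists D', cdiff (fun w => bddop_comp (h w) (f (Cplus w (0, t))) : BX) w D'.
Proof.
intros Hw Hf; destruct (h_cdiff w Hw) as [D1 H1]; eexists.
apply (cdiff_comp h (fun w => f (Cplus w (0, t))) w D1 D); [exact H1|].
intros e He; destruct (Hf e He) as [d [Hd Hu]]; exists d; split; [exact Hd|]; intros u Hud.
replace (Cplus (Cplus w u) (0, t)) with (Cplus (Cplus w (0, t)) u) by ring; apply Hu, Hud.
Qed.

Lemma continuous_shifted_line (t s : R) : 0 < Rabs t <= PI -> continuous (shifted_line t) s.
Proof.
intros Ht.
destruct (cdiff_shifted_logres (tan t) (s, t)) as [D HD]; [apply cos_lt, Ht|].
destruct (product_cdiff (shifted_logres (tan t)) t (s, 0) D) as [D' HD'].
- simpl; rewrite Rabs_R0; lra.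
- rewrite (pair_shift s (0) (t) (t) ltac:(ring)); exact HD.
- apply (continuous_ext (fun s => bddop_comp (h (s, 0)) (shifted_logres (tan t) (Cplus (s, 0) (0, t))) : BX)).
  { intros x; unfold shifted_line.
    rewrite (pair_shift x (0) (t) (t) ltac:(ring)); reflexivity. }
  apply (ccont_horizontal (fun w => bddop_comp (h w) (shifted_logres (tan t) (Cplus w (0, t))) : BX)).
  apply (cdiff_ccont _ _ _ HD').
Qed.

Variables (g0 sgn : R).
Hypotheses (Hg0 : 0 < g0 < theta) (Hsgn : sgn = 1 \/ sgn = -1).

(** The sign selects one of the two rays of the contour, so that the limit is proved once for
    both. *)
Let t0 := sgn * g0.

Let Rabs_sgn (x : R) : 0 <= x -> Rabs (sgn * x) = x.
Proof.
intros Hx; rewrite Rabs_mult (Rabs_pos_eq x Hx); destruct Hsgn as [-> | ->].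
- rewrite Rabs_R1; ring.
- rewrite Rabs_Ropp Rabs_R1; ring.
Qed.

Definition contour_line (s : R) : BX := bddop_comp (h (s, t0)) (S (s, t0)).

Lemma continuous_contour_line s : continuous contour_line s.
Proof.
assert (E : Rabs t0 = g0) by (apply Rabs_sgn; lra).
apply (ccont_horizontal (fun w => bddop_comp (h w) (S w) : BX)).
destruct (h_cdiff (s, t0)) as [D HD]; [simpl; lra|].
assert (H := cdiff_logres A hA0 (s, t0) (cos_lt t0 ltac:(lra))).
apply (cdiff_ccont _ _ _ (cdiff_comp _ _ _ _ _ HD H)).
Qed.

Lemma contour_line_decay : exp_decay contour_line.
Proof.
assert (E : Rabs t0 = g0) by (apply Rabs_sgn; lra).
destruct h_decay as [c [k [Hc [Hk H]]]].
destruct (logres_bounded A hA0 g0) as [K [HK Hb]]; [lra|].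
exists (c * K), k; repeat split; [apply Rmult_lt_0_compat; assumption|exact Hk|]; intros s.
eapply Rle_trans; [apply norm_comp|].
replace (c * K * exp (- (k * Rabs s))) with (c * exp (- (k * Rabs s)) * K) by ring.
apply Rmult_le_compat; [apply (norm_ge_0 (V := BX))|apply (norm_ge_0 (V := BX))| |].
- apply (H (s, t0)); simpl; lra.
- apply Hb; simpl; apply cos_le; lra.
Qed.

(** [shifted_line] after translation by i sgn (g0 - g): the resolvent now sits on the fixed ray of
    angle g0, and the offset [g] has passed to F, which is continuous there. *)
Let target_line (g s : R) : BX :=
  bddop_comp (h (s, t0 - sgn * g)) (shifted_logres (tan (sgn * g)) (s, t0)).

Let continuous_target_line g s : 0 < g < g0 -> continuous (target_line g) s.
Proof.
intros Hg.
assert (E : Rabs t0 = g0) by (apply Rabs_sgn; lra).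
assert (E' : Rabs (t0 - sgn * g) = g0 - g).
{ unfold t0; replace (sgn * g0 - sgn * g) with (sgn * (g0 - g)) by ring; apply Rabs_sgn; lra. }
destruct (cdiff_shifted_logres (tan (sgn * g)) (s, t0)) as [D HD]; [apply (cos_lt t0); lra|].
destruct (product_cdiff (shifted_logres (tan (sgn * g))) (sgn * g) (s, t0 - sgn * g) D) as [D' HD'].
- simpl; lra.
- rewrite (pair_shift s (t0 - sgn * g) (sgn * g) (t0) ltac:(ring)); exact HD.
- apply (continuous_ext (fun s => bddop_comp (h (s, t0 - sgn * g)) (shifted_logres (tan (sgn * g)) (Cplus (s, t0 - sgn * g) (0, sgn * g))) : BX)).
  { intros x; unfold target_line.
    rewrite (pair_shift x (t0 - sgn * g) (sgn * g) (t0) ltac:(ring)); reflexivity. }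
  apply (ccont_horizontal (fun w => bddop_comp (h w) (shifted_logres (tan (sgn * g)) (Cplus w (0, sgn * g))) : BX)).
  apply (cdiff_ccont _ _ _ HD').
Qed.

(** Cauchy's theorem at fixed [g]: the bound of the resolvent may depend on [g], because the decay
    of F kills the vertical sides as M grows. *)
Let shift_small (g : R) : 0 < g < g0 -> forall e, 0 < e ->
  exists M0, forall M, M0 <= M ->
  norm (minus (RI (shifted_line (sgn * g)) (- M) M) (RI (target_line g) (- M) M)) <= e.
Proof.
intros Hg e He.
destruct h_decay as [c [k [Hc [Hk Hh]]]].
destruct (logres_bounded A hA0 g) as [K [HK Hb]]; [lra|].
set (K' := K + Rabs (tan (sgn * g)) * (K + K ^ 2)).
assert (HK' : 0 < K').
{ unfold K'; assert (H1 := Rabs_pos (tan (sgn * g))); assert (H2 := pow2_ge_0 K).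
  assert (0 <= Rabs (tan (sgn * g)) * (K + K ^ 2)) by (apply Rmult_le_pos; lra); lra. }
(* The last factor [k] cancels the division in [exp_tail_small]; 2 g0 dominates the factor 2 (g0 -
   g) of [horizontal_shift]. *)
destruct (exp_tail_small (c * K' * (2 * g0) * k) k e) as [M0 [HM0 HM]]; [|exact Hk|exact He|].
{ repeat apply Rmult_lt_0_compat; lra. }
exists M0; intros M HMM.
specialize (HM M HMM).
replace (c * K' * (2 * g0) * k / k) with (c * K' * (2 * g0)) in HM by (field; lra).
set (f := fun w => bddop_comp (h w) (shifted_logres (tan (sgn * g)) (Cplus w (0, sgn * g))) : BX).
(* During the shift the argument of F runs from 0 to g0 - g in modulus and that of the resolvent
   from [g] to [g0]: F stays in its sector and the resolvent off the axis. *)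
assert (Habs : forall y, Rmin 0 (t0 - sgn * g) <= y <= Rmax 0 (t0 - sgn * g) ->
  Rabs y <= g0 - g /\ g <= Rabs (y + sgn * g) <= g0).
{ intros y Hy; unfold t0 in Hy; destruct Hsgn as [E|E]; rewrite E in Hy |- *.
  - rewrite Rmin_left in Hy; [|lra]; rewrite Rmax_right in Hy; [|lra].
    rewrite !Rabs_pos_eq; lra.
  - rewrite Rmin_right in Hy; [|lra]; rewrite Rmax_left in Hy; [|lra].
    rewrite !Rabs_left1; lra. }
assert (E1 : RI (shifted_line (sgn * g)) (- M) M = RI (fun x => f (x, 0)) (- M) M).
{ apply RI_ext; intros x _; unfold f, shifted_line.
  rewrite (pair_shift x (0) (sgn * g) (sgn * g) ltac:(ring)); reflexivity. }
assert (E2 : RI (target_line g) (- M) M = RI (fun x => f (x, t0 - sgn * g)) (- M) M).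
{ apply RI_ext; intros x _; unfold f, target_line.
  rewrite (pair_shift x (t0 - sgn * g) (sgn * g) (t0) ltac:(ring)); reflexivity. }
rewrite E1 E2.
eapply Rle_trans.
{ apply (horizontal_shift f M 0 (t0 - sgn * g) (c * exp (- (k * M)) * K')); [lra| |].
  - intros x y _ Hy; destruct (Habs y Hy) as [A1 A2].
    destruct (cdiff_shifted_logres (tan (sgn * g)) (x, y + sgn * g)) as [D HD]; [apply (cos_lt (y + sgn * g)); lra|].
    apply (product_cdiff (shifted_logres (tan (sgn * g))) (sgn * g) (x, y) D); [simpl; lra|].
    rewrite (pair_shift x (y) (sgn * g) (y + sgn * g) ltac:(ring)); exact HD.
  - intros y Hy; destruct (Habs y Hy) as [A1 A2].
    assert (B : forall x, Rabs x = M -> norm (f (x, y)) <= c * exp (- (k * M)) * K').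
    { intros x Hx; unfold f.
      eapply Rle_trans; [apply norm_comp|].
      apply Rmult_le_compat; [apply (norm_ge_0 (V := BX))|apply (norm_ge_0 (V := BX))| |].
      - rewrite -Hx; apply (Hh (x, y)); simpl; lra.
      - apply norm_shifted_logres.
        rewrite (pair_shift x (y) (sgn * g) (y + sgn * g) ltac:(ring)).
        apply Hb; simpl; apply cos_le; lra. }
    split; apply B; [apply Rabs_pos_eq; lra|rewrite Rabs_Ropp; apply Rabs_pos_eq; lra]. }
eapply Rle_trans; [|exact HM].
replace (t0 - sgn * g - 0) with (sgn * (g0 - g)) by (unfold t0; ring).
rewrite Rabs_sgn; [|lra].
assert (He' := exp_pos (- (k * M))).
replace (2 * (c * exp (- (k * M)) * K') * (g0 - g)) with (c * K' * (2 * (g0 - g)) * exp (- (k * M))) by ring.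
apply Rmult_le_compat_r; [lra|]; apply Rmult_le_compat_l; [|lra].
left; apply Rmult_lt_0_compat; assumption.
Qed.

(** With the resolvent on the fixed ray all constants are independent of [g]. The tails are cut at
    an M0 chosen before [g], and on the remaining segment the two integrands converge uniformly. *)
Let target_close : forall e, 0 < e -> exists d, 0 < d /\ forall g, 0 < g < d ->
  exists M0, forall M, M0 <= M ->
  norm (minus (RI (target_line g) (- M) M) (RI contour_line (- M) M)) <= e.
Proof.
intros e He.
assert (Et0 : Rabs t0 = g0) by (apply Rabs_sgn; lra).
destruct h_decay as [c [k [Hc [Hk Hh]]]].
destruct (logres_bounded A hA0 g0) as [K [HK Hb]]; [lra|].
assert (HS : forall s, norm (S (s, t0)) <= K).
{ intros s; apply Hb; simpl; apply cos_le; lra. }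
set (K' := K + 2 * (K + K ^ 2)).
assert (HK2 := pow2_ge_0 K).
assert (HK' : 0 < K') by (unfold K'; lra).
set (C0 := c * (K + K')).
assert (HC0 : 0 < C0) by (apply Rmult_lt_0_compat; lra).
destruct (exp_tail_small C0 k (e / 4)) as [M0 [HM0 Htail]]; [exact HC0|exact Hk|lra|].
(* The middle segment has length 2 M0 and an integrand of size at most 2 e1, which gives at most e /
   2; the 1 covers M0 = 0. *)
set (e1 := e / 2 / (2 * M0 + 1) / 2).
assert (He1 : 0 < e1) by (unfold e1; repeat apply Rdiv_lt_0_compat; lra).
destruct (segment_uniform_continuity (V := BX) h t0 M0 HM0) with (e := e1 / K) as [d1 [Hd1 Huc]].
{ intros x _; destruct (h_cdiff (x, t0)) as [D HD]; [simpl; lra|]; apply (cdiff_ccont _ _ _ HD). }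
{ apply Rdiv_lt_0_compat; assumption. }
set (d2 := e1 / (2 * c * (K + K ^ 2))).
assert (Hq : 0 < 2 * c * (K + K ^ 2)) by (apply Rmult_lt_0_compat; lra).
assert (Hd2 : 0 < d2) by (apply Rdiv_lt_0_compat; lra).
exists (Rmin (Rmin d1 d2) (Rmin 1 g0)); split; [repeat apply Rmin_pos; lra|].
intros g [Hg Hgd].
Rmin_bounds N1 N2 (Rmin d1 d2) (Rmin 1 g0).
Rmin_bounds N3 N4 d1 d2.
Rmin_bounds N5 N6 1 g0.
assert (Etan : Rabs (tan (sgn * g)) <= 2 * g).
{ assert (T := tan_bound g ltac:(lra)).
  destruct Hsgn as [-> | ->].
  - rewrite Rmult_1_l Rabs_pos_eq; lra.
  - replace (-1 * g) with (- g) by ring; rewrite tan_neg Rabs_Ropp Rabs_pos_eq; lra. }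
assert (Eabs : Rabs (t0 - sgn * g) = g0 - g).
{ unfold t0; replace (sgn * g0 - sgn * g) with (sgn * (g0 - g)) by ring; apply Rabs_sgn; lra. }
set (df := fun s => plus (target_line g s) (cscal (RtoC (-1)) (contour_line s)) : BX).
assert (Cdf : forall s, continuous df s).
{ intros s; apply continuous_plusV; [apply continuous_target_line; lra|].
  apply continuous_scalC, continuous_contour_line. }
assert (Edf : forall M, minus (RI (target_line g) (- M) M) (RI contour_line (- M) M) = RI df (- M) M).
{ intros M; unfold df; rewrite RI_plus.
  - rewrite RI_scal; [rewrite RtoC_m1; mring BX|apply cont_everywhere, continuous_contour_line].
  - intros s _; apply continuous_target_line; lra.
  - intros s _; apply continuous_scalC, continuous_contour_line. }
assert (Bdecay : forall s, norm (df s) <= C0 * exp (- (k * Rabs s))).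
{ intros s; unfold df.
  norm_split BX.
  rewrite (norm_scal_C (X := BX)) Cmod_R Rabs_Ropp Rabs_R1 Rmult_1_l.
  assert (P1 : norm (target_line g s) <= c * exp (- (k * Rabs s)) * K').
  { eapply Rle_trans; [apply norm_comp|].
    apply Rmult_le_compat; [apply (norm_ge_0 (V := BX))|apply (norm_ge_0 (V := BX))| |].
    - apply (Hh (s, t0 - sgn * g)); simpl; lra.
    - eapply Rle_trans; [apply norm_shifted_logres, HS|].
      unfold K'; apply Rplus_le_compat_l, Rmult_le_compat_r; lra. }
  assert (P2 : norm (contour_line s) <= c * exp (- (k * Rabs s)) * K).
  { eapply Rle_trans; [apply norm_comp|].
    apply Rmult_le_compat; [apply (norm_ge_0 (V := BX))|apply (norm_ge_0 (V := BX))| |].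
    - apply (Hh (s, t0)); simpl; lra.
    - apply HS. }
  unfold C0; lra. }
assert (Bmid : forall s, - M0 <= s <= M0 -> norm (df s) <= 2 * e1).
{ intros s Hs; unfold df.
  (* Two errors: the displacement of F, small by uniform continuity on the segment, and the first
     order term of [shifted_logres], small like tan g. *)
  replace (plus (target_line g s) (cscal (RtoC (-1)) (contour_line s))) with
    (plus (bddop_comp (minus (h (s, t0 - sgn * g)) (h (s, t0))) (S (s, t0)))
      (cscal (Copp (Cmult Ci (RtoC (tan (sgn * g)))))
        (bddop_comp (h (s, t0 - sgn * g)) (minus (S (s, t0)) (bddop_comp (S (s, t0)) (S (s, t0)))))) : BX).
  2:{ unfold target_line, contour_line, shifted_logres; rewrite RtoC_m1 !comp_minus_r comp_scal_r comp_minus_r.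
      rewrite {1}/minus comp_plus_l comp_opp_l; mring BX. }
  norm_split BX.
  replace (2 * e1) with (e1 + e1) by ring; apply Rplus_le_compat.
  - eapply Rle_trans; [apply norm_comp|].
    replace e1 with (e1 / K * K) by (field; lra).
    apply Rmult_le_compat; [apply (norm_ge_0 (V := BX))|apply (norm_ge_0 (V := BX))| |apply HS].
    apply (Huc (sgn * g) s); [rewrite Rabs_sgn; lra|exact Hs].
  - rewrite (norm_scal_C (X := BX)) Cmod_opp Cmod_mult Cmod_R.
    rewrite Cmod_Ci. rewrite Rmult_1_l.
    assert (Q1 : norm (h (s, t0 - sgn * g)) <= c).
    { eapply Rle_trans; [apply (Hh (s, t0 - sgn * g)); simpl; lra|]; simpl.
      assert (exp (- (k * Rabs s)) <= 1).
      { rewrite -exp_0; assert (Hks : 0 <= k * Rabs s) by (apply Rmult_le_pos; [lra|apply Rabs_pos]).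
        destruct Hks as [Hks| <-]; [left; apply exp_increasing; lra|rewrite Ropp_0; apply Rle_refl]. }
      nra. }
    assert (Q2 : norm (minus (S (s, t0)) (bddop_comp (S (s, t0)) (S (s, t0)))) <= K + K ^ 2).
    { eapply Rle_trans; [apply (norm_minus_le (V := BX))|]; apply Rplus_le_compat; [apply HS|].
      eapply Rle_trans; [apply norm_comp|]; simpl; rewrite Rmult_1_r.
      apply Rmult_le_compat; try apply HS; apply (norm_ge_0 (V := BX)). }
    apply Rle_trans with (2 * g * (c * (K + K ^ 2))).
    + apply Rmult_le_compat; [apply Rabs_pos|apply (norm_ge_0 (V := BX))|exact Etan|].
      eapply Rle_trans; [apply norm_comp|].
      apply Rmult_le_compat; [apply (norm_ge_0 (V := BX))|apply (norm_ge_0 (V := BX))|exact Q1|exact Q2].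
    + apply Rle_trans with (d2 * (2 * c * (K + K ^ 2))); [|right; unfold d2; field; lra].
      replace (2 * g * (c * (K + K ^ 2))) with (g * (2 * c * (K + K ^ 2))) by ring.
      apply Rmult_le_compat_r; lra. }
exists M0; intros M HM; rewrite Edf.
rewrite -(RI_Chasles df (- M) (- M0) M); [|apply cont_everywhere, Cdf|apply cont_everywhere, Cdf].
rewrite -(RI_Chasles df (- M0) M0 M); [|apply cont_everywhere, Cdf|apply cont_everywhere, Cdf].
assert (T1 := tail_left df C0 k M0 M Cdf HC0 Hk Bdecay ltac:(lra)).
assert (T2 := tail_right df C0 k M0 M Cdf HC0 Hk Bdecay ltac:(lra)).
assert (T3 := RI_norm_const df (2 * e1) (- M0) M0 ltac:(lra) (cont_everywhere df _ _ Cdf) Bmid).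
assert (T4 := Htail M0 (Rle_refl _)).
assert (T5 : 2 * e1 * (M0 - - M0) <= e / 2).
{ apply Rle_trans with (e / 2 * ((2 * M0) / (2 * M0 + 1))).
  - right; unfold e1; field; lra.
  - rewrite -[X in _ <= X]Rmult_1_r; apply Rmult_le_compat_l; [lra|].
    apply (Rmult_le_reg_r (2 * M0 + 1)); [lra|].
    replace (2 * M0 / (2 * M0 + 1) * (2 * M0 + 1)) with (2 * M0) by (field; lra); lra. }
norm_split BX.
assert (T6 := norm_triangle (V := BX) (RI df (- M0) M0) (RI df M0 M)).
replace e with (e / 4 + (e / 2 + e / 4)) by field.
apply Rplus_le_compat; [exact (Rle_trans _ _ _ T1 T4)|].
eapply Rle_trans; [exact T6|].
apply Rplus_le_compat; [exact (Rle_trans _ _ _ T3 T5)|exact (Rle_trans _ _ _ T2 T4)].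
Qed.

Lemma contour_limit (L : BX) : is_line contour_line L ->
  forall e, 0 < e -> exists d, 0 < d /\ forall g, 0 < g < d ->
  exists M0, forall M, M0 <= M ->
  norm (minus (RI (shifted_line (sgn * g)) (- M) M) L) <= e.
Proof.
intros HL e He.
destruct (target_close (e / 3)) as [d [Hd Hc]]; [lra|].
exists (Rmin d g0); split; [apply Rmin_pos; lra|]; intros g [Hg Hgd].
Rmin_bounds N1 N2 d g0.
destruct (Hc g ltac:(lra)) as [M1 H1].
destruct (shift_small g ltac:(lra) (e / 3) ltac:(lra)) as [M2 H2].
destruct (HL (e / 3) ltac:(lra)) as [M3 H3].
exists (Rmax M1 (Rmax M2 M3)); intros M HM.
Rmax_bounds N3 N4 M1 (Rmax M2 M3).
Rmax_bounds N5 N6 M2 M3.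
specialize (H1 M ltac:(lra)); specialize (H2 M ltac:(lra)).
specialize (H3 M M ltac:(lra) ltac:(lra)).
set (a := RI (shifted_line (sgn * g)) (- M) M) in *.
set (b := RI (target_line g) (- M) M) in *; set (b' := RI contour_line (- M) M) in *.
replace (minus a L) with (plus (minus a b) (plus (minus b b') (minus b' L))) by mring BX.
norm_split BX.
assert (T := norm_triangle (V := BX) (minus b b') (minus b' L)).
replace e with (e / 3 + (e / 3 + e / 3)) by field.
apply Rplus_le_compat; [exact H2|]; eapply Rle_trans; [exact T|].
apply Rplus_le_compat; assumption.
Qed.

End OperatorCalculus.

(** * The uniform bound *)

Lemma commutant_poisson_op {X : CompleteNormedModule C_AbsRing} (A : operator X) (g s : R) (T : bddop X) :
  omega_of A = Finite 0 -> 0 < g <= 1 -> commutant A T ->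
  bddop_comp T (poisson_op A g s) = bddop_comp (poisson_op A g s) T.
Proof.
intros hA0 Hg HT; assert (HP := PI2_1).
assert (Hc : cos g < 1) by (rewrite -cos_0; apply cos_decreasing_1; lra).
unfold poisson_op; rewrite comp_scal_r comp_scal_l comp_minus_r.
rewrite !(commutant_logres A hA0 T) //; [|simpl; rewrite cos_neg; exact Hc].
rewrite /minus comp_plus_l comp_opp_l; reflexivity.
Qed.

Section UniformBound.
Context {d : measure_display} {Omega : measurableType d} {P : probability Omega realR}
  (eps : nat -> {RV P >-> realR}) (heps : rademacher eps).
Context {X : CompleteNormedModule C_AbsRing}.
Variables (A : operator X) (c : R).
Hypotheses (hA0 : omega_of A = Finite 0) (Hc : 0 < c).
Hypothesis Hcalc : forall theta, 0 < theta < PI ->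
  forall f : C -> C, H0inf (V := C_NormedModule) theta f ->
  forall gamma : R, Rbar_lt (omega_of A) gamma -> gamma < theta ->
    norm (fcalc A gamma f) <= c * supnorm theta f.
Notation BX := (bddop_CompleteNormedModule X).

Variables (theta g0 r : R) (F : C -> bddop X).
Hypotheses (Htheta : 0 < theta < PI) (HF : H0inf_commutant A theta F) (Hg0 : 0 < g0 < theta).
Hypotheses (Hr : 0 <= r) (HR : forall (n : nat) (T : nat -> bddop X) (x : nat -> X),
  (forall k, (k <= n)%nat -> exists t : R, 0 < t /\ T k = F (RtoC t)) ->
  rad_norm eps n (fun k => T k (x k)) <= r * rad_norm eps n x).

Let square_line (g s : R) : BX :=
  bddop_comp (F (cexp (s, 0))) (bddop_comp (poisson_op A g s) (poisson_op A g s)).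

Lemma F_commutant (s : R) : commutant A (F (cexp (s, 0))).
Proof. apply (proj2 HF), cexp_sector; simpl; rewrite Rabs_R0; lra. Qed.

Lemma square_sum_bound (g a : R) (n : nat) : 0 < g <= 1 ->
  norm (sum_n (fun j => square_line g (a + INR j * g)) n)
  <= c * (16 * PI / g) * (r * (c * (16 * PI / g))).
Proof.
intros Hg.
apply (rademacher_square_sum eps heps (fun j => poisson_op A g (a + INR j * g))
  (fun j => F (cexp (a + INR j * g, 0)))).
- exact Hr.
- intros sg Hs.
  assert (Hs' : forall j, Rabs (sg j) <= 1).
  { intros j; destruct (Hs j) as [-> | ->]; [rewrite Rabs_R1|rewrite Rabs_Ropp Rabs_R1]; lra. }
  exact (norm_poisson_op_sum A c hA0 Hc Hcalc g a sg n Hg Hs').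
- intros k; apply commutant_poisson_op; [exact hA0|exact Hg|apply F_commutant].
- intros x; apply (HR n (fun j => F (cexp (a + INR j * g, 0)))).
  (* The sample points lie on the positive axis, where the R-bound is available. *)
  intros k _; exists (exp (a + INR k * g)); split; [apply exp_pos|].
  f_equal; apply cexp_real.
Qed.

Lemma shifted_lines_square (g s : R) : 0 < g <= 1 ->
  cscal (RtoC (2 * PI * tan g)) (square_line g s)
  = cscal inv_2ipi
      (plus (shifted_line A F (-1 * g) s) (cscal (RtoC (-1)) (shifted_line A F (1 * g) s))).
Proof.
intros Hg; unfold square_line, shifted_line.
rewrite -comp_scal_r (poisson_op_square A hA0 g s Hg).
replace (-1 * g) with (- g) by ring; rewrite tan_neg Rmult_1_l.
rewrite comp_scal_r comp_minus_r RtoC_m1; mring BX.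
Qed.

Lemma folded_bound (g : R) (n : nat) : 0 < g <= 1 ->
  norm (cscal inv_2ipi
    (minus (RI (shifted_line A F (-1 * g)) (- (INR (S n) * g)) (INR (S n) * g))
           (RI (shifted_line A F (1 * g)) (- (INR (S n) * g)) (INR (S n) * g))) : BX)
  <= 1024 * PI ^ 3 * c ^ 2 * r.
Proof.
intros Hg; set (M := INR (S n) * g); assert (HP := PI2_1).
assert (Ht := tan_bound g Hg).
set (K := 2 * PI * tan g); assert (HK : 0 < K) by (unfold K; nra).
assert (Hab1 : Rabs (-1 * g) = g) by (rewrite Rabs_mult Rabs_Ropp Rabs_R1 Rmult_1_l; apply Rabs_pos_eq; lra).
assert (Hab2 : Rabs (1 * g) = g) by (rewrite Rmult_1_l; apply Rabs_pos_eq; lra).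
assert (C1 : forall s, continuous (shifted_line A F (-1 * g)) s).
{ intros s; apply (continuous_shifted_line A hA0 theta F Htheta HF); lra. }
assert (C2 : forall s, continuous (shifted_line A F (1 * g)) s).
{ intros s; apply (continuous_shifted_line A hA0 theta F Htheta HF); lra. }
set (f1 := shifted_line A F (-1 * g)) in *; set (f2 := shifted_line A F (1 * g)) in *.
assert (Cs : forall s, continuous (fun s => plus (f1 s) (cscal (RtoC (-1)) (f2 s))) s).
{ intros s; apply continuous_plusV; [apply C1|apply continuous_scalC, C2]. }
assert (E : forall s, cscal (Cmult (RtoC (/ K)) inv_2ipi)
  (plus (f1 s) (cscal (RtoC (-1)) (f2 s))) = square_line g s).
{ intros s; transitivity (cscal (RtoC (/ K)) (cscal (RtoC K) (square_line g s))).
  - unfold K; rewrite shifted_lines_square; [fold f1 f2; mring BX|exact Hg].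
  - assert (E1 : Cmult (RtoC (/ K)) (RtoC K) = RtoC 1) by (rewrite -RtoC_mult Rinv_l; [reflexivity|lra]).
    transitivity (cscal (Cmult (RtoC (/ K)) (RtoC K)) (square_line g s)); [mring BX|].
    rewrite E1; mring BX. }
assert (Cq : forall s, continuous (square_line g) s).
{ intros s; apply (continuous_ext _ _ s E), continuous_scalC, Cs. }
assert (EI : cscal inv_2ipi (minus (RI f1 (- M) M) (RI f2 (- M) M))
  = cscal (RtoC K) (RI (square_line g) (- M) M)).
{ rewrite -(RI_ext _ _ _ _ (fun s _ => E s)).
  rewrite RI_scal; [|intros s _; apply Cs].
  rewrite RI_plus; [|intros s _; apply C1|intros s _; apply continuous_scalC, C2].
  rewrite RI_scal; [|intros s _; apply C2].
  assert (E1 : Cmult (RtoC K) (RtoC (/ K)) = RtoC 1) by (rewrite -RtoC_mult Rinv_r; [reflexivity|lra]).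
  transitivity (cscal (Cmult (Cmult (RtoC K) (RtoC (/ K))) inv_2ipi)
    (plus (RI f1 (- M) M) (cscal (RtoC (-1)) (RI f2 (- M) M)))); [rewrite E1 RtoC_m1; mring BX|mring BX]. }
rewrite EI (norm_scal_C (X := BX)) Cmod_R Rabs_pos_eq; [|lra].
(* The interval [-M, M] consists of 2 (n + 1) periods of length [g], and [sum_n] up to [k] has k + 1
   = 2 n + 2 terms, so nothing is left over. *)
set (k := S (Nat.add n n)).
assert (EM : M = - M + INR (S k) * g).
{ unfold M, k; rewrite !S_INR plus_INR; ring. }
destruct (RI_fold (square_line g) (- M) g k Cq) as [EF CF].
rewrite {2}EM EF.
assert (B := RI_norm_const _ (c * (16 * PI / g) * (r * (c * (16 * PI / g)))) 0 g ltac:(lra)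
  (cont_everywhere _ _ _ CF) (fun t _ => square_sum_bound g (- M + t) k Hg)).
apply Rle_trans with (K * (c * (16 * PI / g) * (r * (c * (16 * PI / g))) * (g - 0))).
{ apply Rmult_le_compat_l; [lra|exact B]. }
(* All powers of [g] cancel up to tan g / g, which is at most 2. *)
replace (K * (c * (16 * PI / g) * (r * (c * (16 * PI / g))) * (g - 0)))
  with (512 * PI ^ 3 * c ^ 2 * r * (tan g / g)) by (unfold K; field; lra).
replace (1024 * PI ^ 3 * c ^ 2 * r) with (512 * PI ^ 3 * c ^ 2 * r * 2) by ring.
apply Rmult_le_compat_l.
- assert (Q1 : 0 < PI ^ 3) by (apply pow_lt; lra); assert (Q2 : 0 < c ^ 2) by (apply pow_lt; lra).
  apply Rmult_le_pos; [apply Rmult_le_pos; [apply Rmult_le_pos|]|exact Hr]; lra.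
- apply (Rmult_le_reg_r g); [lra|]; replace (tan g / g * g) with (tan g) by (field; lra); lra.
Qed.

Lemma opcalc_bound : norm (opcalc A g0 F) <= 1024 * PI ^ 3 * c ^ 2 * r.
Proof.
assert (Sm : (-1 : R) = 1 \/ (-1 : R) = -1) by (right; reflexivity).
assert (Sp : (1 : R) = 1 \/ (1 : R) = -1) by (left; reflexivity).
assert (Cm := continuous_contour_line A hA0 theta F Htheta HF g0 (-1) Hg0 Sm).
assert (Cp := continuous_contour_line A hA0 theta F Htheta HF g0 1 Hg0 Sp).
destruct (line_exists _ Cm (contour_line_decay A hA0 theta F Htheta HF g0 (-1) Hg0 Sm)) as [Lm HLm].
destruct (line_exists _ Cp (contour_line_decay A hA0 theta F Htheta HF g0 1 Hg0 Sp)) as [Lp HLp].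
assert (E : opcalc A g0 F = cscal inv_2ipi (minus Lm Lp)).
{ unfold opcalc, contour_int.
  rewrite (ray_int_line (- g0) _ _ _ (fun s => _) Cm HLm).
  - rewrite (ray_int_line g0 _ _ _ (fun s => _) Cp HLp); [reflexivity|].
    intros s; unfold contour_line, logres; rewrite Rmult_1_l; apply comp_scal_r.
  - intros s; unfold contour_line, logres; replace (-1 * g0) with (- g0) by ring; apply comp_scal_r. }
rewrite E; apply le_epsilon; intros e He.
assert (Hi := Cmod_ge_0 inv_2ipi).
set (e1 := e / 2 / (Cmod inv_2ipi + 1)).
assert (He1 : 0 < e1) by (apply Rdiv_lt_0_compat; lra).
destruct (contour_limit A hA0 theta F Htheta HF g0 (-1) Hg0 Sm Lm HLm e1 He1) as [d1 [Hd1 K1]].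
destruct (contour_limit A hA0 theta F Htheta HF g0 1 Hg0 Sp Lp HLp e1 He1) as [d2 [Hd2 K2]].
(* A common width for both rays; halving makes the inequalities strict. *)
set (g := Rmin (Rmin d1 d2) 1 / 2).
Rmin_bounds N1 N2 (Rmin d1 d2) 1.
Rmin_bounds N3 N4 d1 d2.
assert (Hm : 0 < Rmin (Rmin d1 d2) 1) by (repeat apply Rmin_pos; lra).
assert (Hg : 0 < g <= 1) by (unfold g; lra).
destruct (K1 g ltac:(unfold g; lra)) as [M1 H1]; destruct (K2 g ltac:(unfold g; lra)) as [M2 H2].
(* The cut-off is a multiple of [g], as the folding of the line requires. *)
assert (Hn : exists n, Rmax M1 M2 <= INR (S n) * g).
{ destruct (INR_unbounded (Rmax M1 M2 / g)) as [n Hn]; exists n.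
  apply (Rmult_lt_compat_r g) in Hn; [|lra].
  replace (Rmax M1 M2 / g * g) with (Rmax M1 M2) in Hn by (field; lra).
  rewrite S_INR; nra. }
destruct Hn as [n Hn].
Rmax_bounds N5 N6 M1 M2.
specialize (H1 (INR (S n) * g) ltac:(lra)); specialize (H2 (INR (S n) * g) ltac:(lra)).
assert (HB := folded_bound g n Hg).
set (a := RI (shifted_line A F (-1 * g)) _ _) in *; set (b := RI (shifted_line A F (1 * g)) _ _) in *.
replace (cscal inv_2ipi (minus Lm Lp)) with
  (minus (cscal inv_2ipi (minus a b)) (cscal inv_2ipi (minus (minus a Lm) (minus b Lp))) : BX)
  by mring BX.
eapply Rle_trans; [apply (norm_minus_le (V := BX))|].
apply Rplus_le_compat; [exact HB|].
rewrite (norm_scal_C (X := BX)).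
apply Rle_trans with ((Cmod inv_2ipi + 1) * (e1 + e1)); [|right; unfold e1; field; lra].
apply Rmult_le_compat; [exact Hi|apply (norm_ge_0 (V := BX))|lra|].
eapply Rle_trans; [apply (norm_minus_le (V := BX))|].
apply Rplus_le_compat; assumption.
Qed.

End UniformBound.

Theorem theorem3p6
  (d : measure_display) (Omega : measurableType d) (P : probability Omega realR)
  (eps : nat -> {RV P >-> realR}) (heps : rademacher eps)
  (X : CompleteNormedModule C_AbsRing) (A : operator X)
  (hA : sectorial A) (hA0 : omega_of A = Finite 0)
  (hcalc : unif_bounded_calculus A) :
  exists c : R, 0 < c /\
    forall theta : R, 0 < theta < PI ->
    forall F : C -> bddop X, H0inf_commutant A theta F ->
    forall gamma : R, Rbar_lt (omega_of A) (Finite gamma) -> gamma < theta ->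
      Rbar_le (Finite (norm (opcalc A gamma F)))
        (Rbar_mult (Finite c)
           (rbound eps (fun T : bddop X => exists t : R, 0 < t /\ T = F (RtoC t)))).
Proof.
destruct hcalc as [c [Hc Hcalc]].
set (k := 1024 * PI ^ 3 * c ^ 2).
assert (Hk : 0 < k).
{ assert (0 < PI ^ 3) by (apply pow_lt, PI_RGT_0); assert (0 < c ^ 2) by (apply pow_lt, Hc).
  unfold k; apply Rmult_lt_0_compat; [apply Rmult_lt_0_compat|]; lra. }
exists k; split; [exact Hk|].
intros theta Htheta F HF gamma Hgamma Hgt.
assert (Hg0 : 0 < gamma < theta) by (rewrite hA0 in Hgamma; simpl in Hgamma; lra).
unfold rbound.
match goal with |- context [Glb_Rbar ?S] => set (E := S) end.
assert (HE : forall r, E r -> norm (opcalc A gamma F) <= k * r).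
{ intros r [Hr HR].
  apply (opcalc_bound eps heps A c hA0 Hc Hcalc theta gamma r F Htheta HF Hg0 Hr).
  intros n T x HT; apply HR, HT. }
destruct (Glb_Rbar_correct E) as [L G].
(* The estimate holds for each admissible constant [r]; divided by [k], it exhibits a lower bound of
   the set and so passes to the infimum. *)
assert (G0 : Rbar_le (norm (opcalc A gamma F) / k) (Glb_Rbar E)).
{ apply G; intros r Hr; simpl; apply (Rmult_le_reg_r k); [exact Hk|].
  replace (norm (opcalc A gamma F) / k * k) with (norm (opcalc A gamma F)) by (field; lra).
  rewrite Rmult_comm; apply HE, Hr. }
destruct (Glb_Rbar E) as [r| |]; simpl in G0.
- simpl; apply (Rmult_le_compat_l k) in G0; [|lra].
  replace (k * (norm (opcalc A gamma F) / k)) with (norm (opcalc A gamma F)) in G0 by (field; lra).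
  exact G0.
(* Infinite R-bound: the product with the positive constant is [p_infty]. *)
- rewrite (is_Rbar_mult_unique _ _ _ (is_Rbar_mult_sym _ _ _ (is_Rbar_mult_p_infty_pos (Finite k) Hk))).
  exact I.
- contradiction.
Qed.
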